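(* Let $\mathcal R$ be an o-minimal expansion of the real field in which all definable o-minimal groups are definably isomorphic and in which every abelian definable extension of $(\mathbb R,+)$ by $(\mathbb R,+)$ splits. Then the supersolvable definable groups in $\mathcal R$ that are definably (topologically) homeomorphic to $\mathbb R^3$ are, modulo definable group isomorphism, the following: $(\mathbb R^3,+)$; $\mathcal G_{\mathrm{Heis}}$; $(\mathbb R\rtimes\mathbb R)\times\mathbb R$; $G_3$; and the groups $\mathbb R^2\rtimes_{\tau_c}\mathbb R$ with $c\in\mathbb R\setminus\{0\}$, where $\tau_c(z)(x,y)=(xe^{cz},ye^{z})$.
   Context: All objects are definable in $\mathcal R$; $\mathbb R$ also denotes its additive group. An o-minimal group is an infinite definable ordered group (with bi-invariant linear order) all of whose definable subsets are finite unions of open intervals and points. An abelian extension $1\to\mathbb R\to G\to\mathbb R\to1$ ($G$ abelian) splits if it has a definable homomorphic section. A definable group $G$ is supersolvable if it has a chain of definable subgroups $\{e\}=H_0\unlhd H_1\unlhd\dots\unlhd H_n=G$, each $H_i$ normal in $G$, with each $H_{i+1}/H_i$ definably isomorphic to $(\mathbb R,+)$. $\mathcal G_{\mathrm{Heis}}$ is $\mathbb R^3$ with $(x_1,y_1,z_1)\cdot(x_2,y_2,z_2)=(x_1+x_2,\;y_1+y_2,\;z_1+z_2+\tfrac12(x_1y_2-x_2y_1))$. $\mathbb R\rtimes\mathbb R$ is $\mathbb R^2$ with $(x_1,y_1)(x_2,y_2)=(x_1+e^{y_1}x_2,\;y_1+y_2)$. $G_3$ is $\mathbb R\times(\mathbb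 R\times\mathbb R)$ with $(x_1,(y_1,z_1))\cdot(x_2,(y_2,z_2))=(x_1+x_2e^{z_1}+y_2z_1e^{z_1},\;(y_1+y_2e^{z_1},\;z_1+z_2))$. $\mathbb R^2\rtimes_{\tau_c}\mathbb R$ is $\mathbb R^2\times\mathbb R$ with $((x,y),z)\cdot((x',y'),z')=((x+e^{cz}x',\;y+e^{z}y'),\;z+z')$. *)

(* Defs.v *)
(* MathComp-Analysis; the real field is an arbitrary [R : realType], and R^n is
   ['rV[R]_n] with its library topology. *)
From HB Require Import structures.
From mathcomp Require Import all_boot all_order all_algebra.
From mathcomp Require Import all_classical all_reals all_analysis.

Set Implicit Arguments.
Unset Strict Implicit.
Unset Printing Implicit Defensive.

Import Order.TTheory GRing.Theory Num.Theory.
Import numFieldNormedType.Exports.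

Local Open Scope classical_set_scope.
Local Open Scope ring_scope.

(** * Structures on the real field *)

(* A structure is given by its sets definable with parameters (van den Dries).
   Preimages under the coordinate maps R^n -> R^m induced by 'I_m -> 'I_n
   account for products with R, permutations of the coordinates and
   identification of variables. *)
Record structure (R : realType) := Structure {
  definable : forall n, set 'rV[R]_n -> Prop;
  definableC : forall n (A : set 'rV[R]_n), definable A -> definable (~` A);
  definableI : forall n (A B : set 'rV[R]_n),
    definable A -> definable B -> definable (A `&` B);
  definable_reindex : forall m n (s : 'I_m -> 'I_n) (A : set 'rV[R]_m),
    definable A -> definable [set x : 'rV[R]_n | A (\row_i x 0 (s i))];
  definable_proj : forall n m (A : set 'rV[R]_(n + m)),
    definable A ->
    definable [set x : 'rV[R]_n | exists y : 'rV[R]_m, A (row_mx x y)];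
  definable_eq : definable [set x : 'rV[R]_2 | x 0 0 = x 0 1];
  definable_point : forall a : R, definable [set x : 'rV[R]_1 | x 0 0 = a] }.

Definition expands_real_field (R : realType) (S : structure R) : Prop :=
  [/\ definable S [set x : 'rV[R]_2 | x 0 0 < x 0 1],
      definable S [set x : 'rV[R]_3 | x 0 2 = x 0 0 + x 0 1] &
      definable S [set x : 'rV[R]_3 | x 0 2 = x 0 0 * x 0 1]].

(* The interval of the ordered set [(G, lt)] with endpoints [a] and [b], where
   [None] stands for -oo on the left and for +oo on the right. *)
Definition open_itv (T : Type) (G : set T) (lt : T -> T -> Prop)
    (a b : option T) : set T :=
  [set x | [/\ G x, (if a is Some u then lt u x else True) &
                    (if b is Some v then lt x v else True)]].

Inductive finite_union_itv (T : Type) (G : set T) (lt : T -> T -> Prop) :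
    set T -> Prop :=
| Fui_empty : finite_union_itv G lt set0
| Fui_point a of G a : finite_union_itv G lt [set a]
| Fui_itv a b of (if a is Some u then G u else True) &
                 (if b is Some v then G v else True) :
    finite_union_itv G lt (open_itv G lt a b)
| Fui_union A B of finite_union_itv G lt A & finite_union_itv G lt B :
    finite_union_itv G lt (A `|` B).

Definition ominimal (R : realType) (S : structure R) : Prop :=
  forall A : set 'rV[R]_1, definable S A ->
    finite_union_itv setT (fun x y : 'rV[R]_1 => x 0 0 < y 0 0) A.

(* [f] is total, but only its restriction to [A] matters. *)
Definition definable_fun (R : realType) (S : structure R) m n
    (A : set 'rV[R]_m) (f : 'rV[R]_m -> 'rV[R]_n) : Prop :=
  definable S [set row_mx x (f x) | x in A].

(** * Definable groups *)

(* The operations are total; only their values on [gset] matter. *)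
Record group_data (R : realType) := GroupData {
  gdim : nat;
  gset : set 'rV[R]_gdim;
  gmul : 'rV[R]_gdim -> 'rV[R]_gdim -> 'rV[R]_gdim;
  gone : 'rV[R]_gdim;
  ginv : 'rV[R]_gdim -> 'rV[R]_gdim }.

Arguments gset {R} G : rename.
Arguments gmul {R} G : rename.
Arguments gone {R} G : rename.
Arguments ginv {R} G : rename.

Record is_group (R : realType) (G : group_data R) : Prop := IsGroup {
  gone_in : gset G (gone G);
  gmul_in : forall x y, gset G x -> gset G y -> gset G (gmul G x y);
  ginv_in : forall x, gset G x -> gset G (ginv G x);
  gmulA : forall x y z, gset G x -> gset G y -> gset G z ->
    gmul G x (gmul G y z) = gmul G (gmul G x y) z;
  gmul1 : forall x, gset G x -> gmul G (gone G) x = x /\ gmul G x (gone G) = x;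
  gmulV : forall x, gset G x ->
    gmul G (ginv G x) x = gone G /\ gmul G x (ginv G x) = gone G }.

Definition definable_group (R : realType) (S : structure R)
    (G : group_data R) : Prop :=
  [/\ is_group G, definable S (gset G) &
      definable S [set row_mx (row_mx x y) (gmul G x y)
                  | x in gset G & y in gset G]].

Definition abelian_group (R : realType) (G : group_data R) : Prop :=
  forall x y, gset G x -> gset G y -> gmul G x y = gmul G y x.

Definition definable_hom (R : realType) (S : structure R) (G H : group_data R)
    (f : 'rV[R]_(gdim G) -> 'rV[R]_(gdim H)) : Prop :=
  [/\ set_fun (gset G) (gset H) f, definable_fun S (gset G) f &
      forall x y, gset G x -> gset G y ->
        f (gmul G x y) = gmul H (f x) (f y)].

Definition definably_isomorphic (R : realType) (S : structure R)
    (G H : group_data R) : Prop :=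
  exists f : 'rV[R]_(gdim G) -> 'rV[R]_(gdim H),
    definable_hom S f /\ set_bij (gset G) (gset H) f.

Definition prod_group (R : realType) (G H : group_data R) : group_data R :=
  @GroupData R (gdim G + gdim H)
    [set x | gset G (lsubmx x) /\ gset H (rsubmx x)]
    (fun x y => row_mx (gmul G (lsubmx x) (lsubmx y))
                       (gmul H (rsubmx x) (rsubmx y)))
    (row_mx (gone G) (gone H))
    (fun x => row_mx (ginv G (lsubmx x)) (ginv H (rsubmx x))).

Definition add_group (R : realType) (n : nat) : group_data R :=
  @GroupData R n setT (fun x y => x + y) 0 (fun x => - x).

(** * O-minimal groups *)

Record is_group_order (R : realType) (G : group_data R)
    (lt : 'rV[R]_(gdim G) -> 'rV[R]_(gdim G) -> Prop) : Prop := IsGroupOrder {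
  glt_irr : forall x, gset G x -> ~ lt x x;
  glt_trans : forall x y z, gset G x -> gset G y -> gset G z ->
    lt x y -> lt y z -> lt x z;
  glt_total : forall x y, gset G x -> gset G y -> [\/ lt x y, x = y | lt y x];
  glt_mul : forall x y z, gset G x -> gset G y -> gset G z -> lt x y ->
    lt (gmul G z x) (gmul G z y) /\ lt (gmul G x z) (gmul G y z) }.

Definition ominimal_group (R : realType) (S : structure R)
    (G : group_data R) : Prop :=
  [/\ definable_group S G, infinite_set (gset G) &
      exists lt : 'rV[R]_(gdim G) -> 'rV[R]_(gdim G) -> Prop,
      [/\ is_group_order lt,
          definable S [set u : 'rV[R]_(gdim G + gdim G) |
            [/\ gset G (lsubmx u), gset G (rsubmx u) &
                lt (lsubmx u) (rsubmx u)]] &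
          forall A : set 'rV[R]_(gdim G), A `<=` gset G -> definable S A ->
            finite_union_itv (gset G) lt A]].

(** * Extensions of (R, +) by (R, +) *)

Record definable_extension (R : realType) (S : structure R) (N G Q : group_data R)
    (i : 'rV[R]_(gdim N) -> 'rV[R]_(gdim G))
    (p : 'rV[R]_(gdim G) -> 'rV[R]_(gdim Q)) : Prop := DefinableExtension {
  ext_group : definable_group S G;
  ext_inj_hom : definable_hom S i;
  ext_inj : set_inj (gset N) i;
  ext_proj_hom : definable_hom S p;
  ext_surj : set_surj (gset G) (gset Q) p;
  ext_exact : i @` gset N = [set x | gset G x /\ p x = gone Q] }.

Definition splits (R : realType) (S : structure R) (G Q : group_data R)
    (p : 'rV[R]_(gdim G) -> 'rV[R]_(gdim Q)) : Prop :=
  exists s : 'rV[R]_(gdim Q) -> 'rV[R]_(gdim G),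
    definable_hom S s /\ forall x, gset Q x -> p (s x) = x.

(** * Supersolvable groups *)

Definition subgroup_on (R : realType) (G : group_data R)
    (H : set 'rV[R]_(gdim G)) : group_data R :=
  @GroupData R (gdim G) H (gmul G) (gone G) (ginv G).

Definition definable_normal_subgroup (R : realType) (S : structure R)
    (G : group_data R) (H : set 'rV[R]_(gdim G)) : Prop :=
  [/\ H `<=` gset G, definable_group S (subgroup_on H) &
      forall g h, gset G g -> H h -> H (gmul G (gmul G g h) (ginv G g))].

(* [Q], with projection [pi], is a definable presentation of the quotient H/N;
   it is unique up to definable isomorphism, and exists by definable choice. *)
Definition definable_quotient (R : realType) (S : structure R)
    (H : group_data R) (N : set 'rV[R]_(gdim H)) (Q : group_data R)
    (pi : 'rV[R]_(gdim H) -> 'rV[R]_(gdim Q)) : Prop :=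
  [/\ definable_group S Q, definable_hom S pi,
      set_surj (gset H) (gset Q) pi &
      N = [set x | gset H x /\ pi x = gone Q]].

Definition supersolvable (R : realType) (S : structure R)
    (G : group_data R) : Prop :=
  exists (n : nat) (H : nat -> set 'rV[R]_(gdim G)),
  [/\ H 0%N = [set gone G], H n = gset G,
      forall i, (i <= n)%N -> definable_normal_subgroup S (H i) &
      forall i, (i < n)%N -> H i `<=` H i.+1 /\
        exists (Q : group_data R) (pi : 'rV[R]_(gdim G) -> 'rV[R]_(gdim Q)),
          definable_quotient (H := subgroup_on (H i.+1)) S (H i) pi /\
          definably_isomorphic S Q (add_group R 1)].

(** * The group topology *)

(* A definable group carries a unique group topology making it a definable
   manifold (Pillay), in general not the one induced by the ambient R^m.
   Here [e] identifies the space [T] with [gset G].  The condition on a chart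
   [phi] defined on [U] says that it is a definable homeomorphism from the open
   set [U] onto an open subset of R^N. *)
Record definable_group_topology (R : realType) (S : structure R)
    (G : group_data R) (T : topologicalType) (e : T -> 'rV[R]_(gdim G)) : Prop :=
  DefinableGroupTopology {
  topg_bij : set_bij setT (gset G) e;
  topg_mul : exists2 mul : T * T -> T, continuous mul &
    forall t u, e (mul (t, u)) = gmul G (e t) (e u);
  topg_inv : exists2 inv : T -> T, continuous inv &
    forall t, e (inv t) = ginv G (e t);
  topg_atlas : exists (N k : nat) (U : 'I_k -> set T)
      (phi : 'I_k -> T -> 'rV[R]_N),
    (forall t, exists i, U i t) /\
    forall i, [/\ open (U i), set_inj (U i) (phi i),
      forall V, V `<=` U i -> (open V <-> open (phi i @` V)) &
      definable S [set row_mx (e t) (phi i t) | t in U i]] }.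

Definition definably_homeomorphic_to_Rn (R : realType) (S : structure R)
    (G : group_data R) (n : nat) : Prop :=
  exists (T : topologicalType) (e : T -> 'rV[R]_(gdim G)),
    definable_group_topology S e /\
    exists (phi : T -> 'rV[R]_n) (psi : 'rV[R]_n -> T),
      [/\ cancel phi psi, cancel psi phi, continuous phi, continuous psi &
          definable S [set row_mx (e t) (phi t) | t in setT]].

(** * The groups of the classification *)

Definition row2 (R : realType) (x y : R) : 'rV[R]_2 :=
  \row_(i < 2) [:: x; y]`_i.

Definition row3 (R : realType) (x y z : R) : 'rV[R]_3 :=
  \row_(i < 3) [:: x; y; z]`_i.

Definition heis_group (R : realType) : group_data R :=
  @GroupData R 3 setT
    (fun u v => row3 (u 0 0 + v 0 0) (u 0 1 + v 0 1)
       (u 0 2 + v 0 2 + 2^-1 * (u 0 0 * v 0 1 - v 0 0 * u 0 1)))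
    0 (fun u => - u).

Definition affine_group (R : realType) : group_data R :=
  @GroupData R 2 setT
    (fun u v => row2 (u 0 0 + expR (u 0 1) * v 0 0) (u 0 1 + v 0 1))
    0 (fun u => row2 (- (expR (- u 0 1) * u 0 0)) (- u 0 1)).

Definition G3_group (R : realType) : group_data R :=
  @GroupData R 3 setT
    (fun u v => row3
       (u 0 0 + v 0 0 * expR (u 0 2) + v 0 1 * u 0 2 * expR (u 0 2))
       (u 0 1 + v 0 1 * expR (u 0 2))
       (u 0 2 + v 0 2))
    0
    (fun u => row3
       (- ((u 0 0 - u 0 1 * u 0 2) * expR (- u 0 2)))
       (- (u 0 1 * expR (- u 0 2)))
       (- u 0 2)).

Definition tau_group (R : realType) (c : R) : group_data R :=
  @GroupData R 3 setT
    (fun u v => row3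
       (u 0 0 + expR (c * u 0 2) * v 0 0)
       (u 0 1 + expR (u 0 2) * v 0 1)
       (u 0 2 + v 0 2))
    0
    (fun u => row3
       (- (expR (- (c * u 0 2)) * u 0 0))
       (- (expR (- u 0 2) * u 0 1))
       (- u 0 2)).

Inductive listed_group (R : realType) : group_data R -> Prop :=
| Listed_R3 : listed_group (add_group R 3)
| Listed_heis : listed_group (heis_group R)
| Listed_affine : listed_group (prod_group (affine_group R) (add_group R 1))
| Listed_G3 : listed_group (G3_group R)
| Listed_tau (c : R) of c != 0 : listed_group (tau_group c).

(* Main.v *)
(* Definable additive maps R -> R are linear, because an infinite definable subgroup of (R,+)
   contains an interval; hence definable characters are exponentials and exp is definable.
   The chain of a supersolvable group G gives, by definable choice, a definable bijection of G
   with R^n, and o-minimal dimension forces n = 3.  An extension of R by R splits: if the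
   character by which it acts on the kernel is nontrivial, the centralizer of an element acting
   without fixed points is a complement; if it is trivial, the commutator is a bilinear
   alternating form on R, so the extension is abelian and the hypothesis applies.  With
   H1 < H2 < G the chain, either H2 acts nontrivially on H1, and a centralizer exhibits G as an
   affine group times R, or H2 = R^2 is abelian, G = R^2 x| R, and the action is a
   one-parameter group of triangular matrices [[e^(at), u(t)], [0, e^(bt)]] whose normal form
   gives the list. *)
Require Import Defs.
From HB Require Import structures.
From mathcomp Require Import all_boot all_order all_algebra.
From mathcomp Require Import all_classical all_reals all_analysis.
From mathcomp Require Import ring lra.

Set Implicit Arguments.
Unset Strict Implicit.
Unset Printing Implicit Defensive.

Import Order.TTheory GRing.Theory Num.Theory.
Import numFieldNormedType.Exports.

Local Open Scope classical_set_scope.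
Local Open Scope ring_scope.

(** * Definable sets and functions *)

Section DefinableSpaces.
Context {R : realType} {S : structure R}.

(** Splitting is assumed only for a line over a line, whereas the projection of G onto G/H2 has a
    two-dimensional kernel. Its section is therefore built in two stages, and the intermediate
    quotient G/H1 has to be a definable group in its own right: definable choice supplies the
    transversal on which it is realized. The exponential enters through the multiplicative group of
    positive reals, which is o-minimal and hence definably isomorphic to (R,+). A definable
    character of a line could a priori take negative values; divisibility of (R,+) excludes this,
    since modulo the kernel every element is a square, and only then can logarithms be taken. For a
    character of G the argument is repeated along the layers of the chain. Dimension serves to
    compare R^n with R^3, so a notion defined by slicing along coordinates is enough. Its delicate
    point, the exchange of two coordinates, is settled by a cardinality argument: an interval is
    uncountable, yet every interval contains a rational. *)

Lemma definable_ext n (A B : set 'rV[R]_n) :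
  definable S A -> (forall x, A x <-> B x) -> definable S B.
Proof. by move=> dA AB; have <- : A = B by apply/funext => x; apply/propext. Qed.

(** The axioms give no full set. In positive arity it is pulled back from the complement of the
    intersection of the diagonal of the plane with its complement; in arity 0 it is the projection
    of a point of the line. *)
Lemma definable_setT n : definable S (@setT 'rV[R]_n).
Proof.
case: n => [|n].
  have := @definable_proj _ S 0 1 _ (definable_point S 0).
  move/definable_ext; apply=> x; split=> // _.
  by exists 0; have -> : x = 0 by [apply/rowP => -[]]; rewrite /= row_mx0 mxE.
have d2 : definable S (@setT 'rV[R]_2).
  rewrite -(setCK setT); apply: definableC.
  rewrite setCT -(setICr [set x : 'rV[R]_2 | x 0 0 = x 0 1]).
  by apply: definableI; [|apply: definableC]; apply: definable_eq.
exact: (definable_reindex (fun _ : 'I_2 => (ord0 : 'I_n.+1)) d2).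
Qed.

Lemma definable_bigI n (I : Type) (s : seq I) (A : I -> set 'rV[R]_n) :
  (forall i, definable S (A i)) ->
  definable S [set x | forall k, (k < size s)%N -> forall i0, A (nth i0 s k) x].
Proof.
move=> dA; elim: s => [|i s IHs].
  by apply: definable_ext (definable_setT n) _.
apply: definable_ext (definableI (dA i) IHs) _ => x; split=> [[Ai As]|As].
  by case=> [|k] //= ks i0; apply: As.
by split=> [|k ks i0]; [apply: (As 0%N)|apply: (As k.+1)].
Qed.

Lemma definable_forall_ord n m (A : 'I_m -> set 'rV[R]_n) :
  (forall i, definable S (A i)) -> definable S [set x | forall i, A i x].
Proof.
move=> dA; apply: definable_ext (definable_bigI (enum 'I_m) dA) _ => x.
split=> [Ax i|Ax k _ i0]; last exact: Ax.
have := Ax (enum_rank i) _ i; rewrite size_enum_ord -[X in (_ < X)%N]card_ord.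
by rewrite (nth_enum_rank i); apply; rewrite ltn_ord.
Qed.

(* A type embedded in some R^n with definable image: definability of predicates and functions on
   products, subgroups and quotients is tested through the encoding. *)
Class dspace (T : Type) := DSpace {
  ddim : nat;
  enc : T -> 'rV[R]_ddim;
  enc_inj : injective enc;
  enc_def : definable S (range enc) }.
Arguments ddim T {dspace}.

Definition dpred (T : Type) {dT : dspace T} (P : T -> Prop) : Prop :=
  definable S (enc @` P).

Section Spaces.
Context (T T' : Type) {dT : dspace T} {dT' : dspace T'}.

Lemma encP (U : Type) {dU : dspace U} (P : U -> Prop) x : (enc @` P) (enc x) <-> P x.
Proof. by split=> [[y Py /(@enc_inj _ dU) <-]|Px] //; exists x. Qed.

Lemma dpred_ext (P Q : T -> Prop) : dpred P -> (forall x, P x <-> Q x) -> dpred Q.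
Proof.
by move=> dP PQ; have <- : P = Q by apply/funext => x; apply/propext.
Qed.

Lemma dpred_True : dpred (fun _ : T => True).
Proof. exact: enc_def. Qed.

Lemma dpred_and (P Q : T -> Prop) : dpred P -> dpred Q -> dpred (fun x => P x /\ Q x).
Proof.
move=> dP dQ; apply: definable_ext (definableI dP dQ) _ => u; split.
  by case=> [[x Px <-] /encP Qx]; exists x.
by case=> x [Px Qx] <-; split; exists x.
Qed.

Lemma dpred_not (P : T -> Prop) : dpred P -> dpred (fun x => ~ P x).
Proof.
move=> dP.
apply: definable_ext (definableI enc_def (definableC dP)) _ => u; split.
  by case=> [[x _ <-] nPx]; exists x => // Px; apply: nPx; exists x.
by case=> x nPx <-; split=> [|/encP//]; exists x.
Qed.

Lemma dpred_or (P Q : T -> Prop) : dpred P -> dpred Q -> dpred (fun x => P x \/ Q x).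
Proof.
move=> dP dQ; apply: dpred_ext (dpred_not (dpred_and (dpred_not dP) (dpred_not dQ))) _.
by move=> x; rewrite not_andE !not_notE.
Qed.

Lemma dpred_imp (P Q : T -> Prop) : dpred P -> dpred Q -> dpred (fun x => P x -> Q x).
Proof.
move=> dP dQ; apply: dpred_ext (dpred_or (dpred_not dP) dQ) _ => x.
split=> [[nPx /nPx|Qx _]|PQ] //.
by have [/PQ|] := pselect (P x); [right|left].
Qed.

Lemma dpred_reindex (f : T -> T') (s : 'I_(ddim T') -> 'I_(ddim T)) (P : T' -> Prop) :
  (forall x i, enc (f x) 0 i = enc x 0 (s i)) -> dpred P -> dpred (fun x => P (f x)).
Proof.
move=> fs dP.
have fE x : \row_i enc x 0 (s i) = enc (f x) by apply/rowP => i; rewrite mxE fs.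
(* The reindexed set may also contain vectors that encode nothing, hence the intersection with the
   image of [enc]. *)
apply: definable_ext (definableI enc_def (definable_reindex s dP)) _ => u; split.
  by case=> -[x _ <-] /=; rewrite fE => /encP Pfx; exists x.
by case=> x Pfx <-; split; [exists x|rewrite /= fE; exists (f x)].
Qed.

End Spaces.

#[export] Instance dspace_rV n : dspace 'rV[R]_n :=
  @DSpace _ n id (fun _ _ => id) (definable_ext (definable_setT n)
    (fun x => conj (fun _ => ex_intro2 _ _ x I erefl) (fun _ => I))).

Lemma encode_R_inj : injective (fun x : R => \row_(_ < 1) x).
Proof. by move=> x y /rowP/(_ 0); rewrite !mxE. Qed.

Lemma encode_R_def : definable S (range (fun x : R => \row_(_ < 1) x)).
Proof.
apply: definable_ext (definable_setT 1) _ => u; split=> // _.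
by exists (u 0 0) => //; apply/rowP => i; rewrite mxE ord1.
Qed.

#[export] Instance dspace_R : dspace R := DSpace encode_R_inj encode_R_def.

Lemma encode_unit_inj : injective (fun x : unit => 0 : 'rV[R]_0).
Proof. by do 2!case. Qed.

Lemma encode_unit_def : definable S (range (fun x : unit => 0 : 'rV[R]_0)).
Proof.
apply: definable_ext (definable_setT 0) _ => u; split=> // _.
by exists tt => //; apply/rowP => -[].
Qed.

#[export] Instance dspace_unit : dspace unit :=
  DSpace encode_unit_inj encode_unit_def.

Lemma definable_lsubmx n m (A : set 'rV[R]_n) : definable S A ->
  definable S [set u : 'rV[R]_(n + m) | A (lsubmx u)].
Proof.
move=> dA; apply: definable_ext (definable_reindex (lshift m) dA) _ => u /=.
by have -> : lsubmx u = \row_i u 0 (lshift m i) by apply/rowP => i; rewrite !mxE.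
Qed.

Lemma definable_rsubmx n m (A : set 'rV[R]_m) : definable S A ->
  definable S [set u : 'rV[R]_(n + m) | A (rsubmx u)].
Proof.
move=> dA; apply: definable_ext (definable_reindex (@rshift n m) dA) _ => u /=.
by have -> : rsubmx u = \row_i u 0 (rshift n i) by apply/rowP => i; rewrite !mxE.
Qed.

Section Product.
Context (T T' : Type) {dT : dspace T} {dT' : dspace T'}.

Lemma encode_prod_inj : injective (fun z : T * T' => row_mx (enc z.1) (enc z.2)).
Proof. by move=> [x y] [x' y'] /eq_row_mx [/(@enc_inj _ dT) /= -> /(@enc_inj _ dT') /= ->]. Qed.

Lemma encode_prod_def :
  definable S (range (fun z : T * T' => row_mx (enc z.1) (enc z.2))).
Proof.
apply: definable_ext (definableI (definable_lsubmx _ (@enc_def T _))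
                                 (definable_rsubmx _ (@enc_def T' _))) _ => u.
split=> [[[x _ xu] [y _ yu]]|[[x y] _ <-]] /=.
  by exists (x, y) => //=; rewrite xu yu hsubmxK.
by rewrite row_mxKl row_mxKr; split; [exists x|exists y].
Qed.

#[export] Instance dspace_prod : dspace (T * T') :=
  DSpace encode_prod_inj encode_prod_def.

Lemma dpred_ex (P : T -> T' -> Prop) : dpred (fun z : T * T' => P z.1 z.2) ->
  dpred (fun x => exists y, P x y).
Proof.
move=> /definable_proj dP; apply: definable_ext dP _ => u; split.
  case=> v [[x y] /= Pxy] /eq_row_mx [<- _]; by exists x => //; exists y.
by case=> x [y Pxy] <-; exists (enc y), (x, y).
Qed.

Lemma dpred_all (P : T -> T' -> Prop) : dpred (fun z : T * T' => P z.1 z.2) ->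
  dpred (fun x => forall y, P x y).
Proof.
move=> /dpred_not/(dpred_ex (P := fun x y => ~ P x y))/dpred_not dP.
by apply: dpred_ext dP _ => x; rewrite -forallNE; split=> + y => /(_ y); rewrite ?not_notE.
Qed.

Definition dfun (f : T -> T') := dpred (fun z : T * T' => f z.1 = z.2).

End Product.

Lemma dpred_eq T {dT : dspace T} : dpred (fun z : T * T => z.1 = z.2).
Proof.
pose d := @ddim T dT; pose s (i : 'I_d) (k : 'I_2) :=
  if k == 0 then lshift d i else rshift d i.
have dE := definable_forall_ord (fun i => definable_reindex (s i) (definable_eq S)).
apply: definable_ext (definableI (@enc_def (T * T)%type _) dE) _ => u; split.
  case=> -[[x y] _ <-] /= xy; exists (x, y) => //=; apply: enc_inj.
  by apply/rowP => i; have := xy i; rewrite /= mxE [RHS]mxE /s /= row_mxEl row_mxEr.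
case=> -[x _] /= <- <-; split; first by exists (x, x).
by move=> i; rewrite /= mxE [RHS]mxE /s /= row_mxEl row_mxEr.
Qed.

(** Maps that only repeat, drop or permute encoded coordinates. They are the substitutions that
    reindexing handles directly; closure under composition with arbitrary definable functions is
    bootstrapped from them through graphs and projections. *)
Definition coordmap T T' {dT : dspace T} {dT' : dspace T'} (f : T -> T') : Prop :=
  exists s : 'I_(ddim T') -> 'I_(ddim T), forall x i, enc (f x) 0 i = enc x 0 (s i).

Section Coordmaps.
Context (T T1 T2 : Type) {dT : dspace T} {dT1 : dspace T1} {dT2 : dspace T2}.

Lemma coordmap_id : coordmap (fun x : T => x).
Proof. by exists id. Qed.

Lemma coordmap_fst (f : T -> T1 * T2) : coordmap f -> coordmap (fun x => (f x).1).
Proof. by case=> s fs; exists (fun i => s (lshift _ i)) => x i; rewrite -fs /= row_mxEl. Qed.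

Lemma coordmap_snd (f : T -> T1 * T2) : coordmap f -> coordmap (fun x => (f x).2).
Proof. by case=> s fs; exists (fun i => s (rshift _ i)) => x i; rewrite -fs /= row_mxEr. Qed.

Lemma coordmap_pair (f : T -> T1) (g : T -> T2) :
  coordmap f -> coordmap g -> coordmap (fun x => (f x, g x)).
Proof.
case=> s fs [s' gs']; pose d1 := @ddim T1 dT1; pose d2 := @ddim T2 dT2.
exists (fun i : 'I_(d1 + d2) => match fintype.split i with inl j => s j | inr j => s' j end).
move=> x i; rewrite /=; case: (splitP i) => j ij.
  have -> : i = lshift d2 j by apply/val_inj.
  by rewrite row_mxEl fs.
have -> : i = rshift d1 j by apply/val_inj.
by rewrite row_mxEr gs'.
Qed.

Lemma dpred_coordmap (f : T -> T1) (P : T1 -> Prop) :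
  dpred P -> coordmap f -> dpred (fun x => P (f x)).
Proof. by move=> dP [s fs]; apply: dpred_reindex fs dP. Qed.

End Coordmaps.
End DefinableSpaces.
Arguments dspace {R} S T.
Arguments dpred {R} S {T dT} P.
Arguments dfun {R} S {T T' dT dT'} f.
Arguments coordmap {R} S {T T' dT dT'} f.
Arguments ddim {R S} T {dspace}.

Ltac coordm := lazymatch goal with
  | |- coordmap _ (fun x => x) => exact: coordmap_id
  | |- coordmap _ (fun x => (_, _)) => apply: coordmap_pair; coordm
  | |- coordmap _ (fun x => (@?f x).1) => apply: (coordmap_fst (f := f)); coordm
  | |- coordmap _ (fun x => (@?f x).2) => apply: (coordmap_snd (f := f)); coordm
  | |- coordmap _ fst => apply: (coordmap_fst (f := fun x => x)); coordm
  | |- coordmap _ snd => apply: (coordmap_snd (f := fun x => x)); coordm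
  end.

Definition ite T (P : Prop) (a b : T) : T := if `[< P >] then a else b.

Section DefinableFunctions.
Context {R : realType} {S : structure R}.
Local Notation dspace := (dspace S).
Local Notation dpred := (dpred S).
Local Notation dfun := (dfun S).
Local Notation coordmap := (coordmap S).

Section Spaces.
Context (T T1 T2 T3 : Type) {dT : dspace T} {dT1 : dspace T1} {dT2 : dspace T2}
  {dT3 : dspace T3}.

Lemma dfun_coordmap (f : T -> T1) : coordmap f -> dfun f.
Proof.
case=> s fs.
apply: (@dpred_coordmap _ _ _ _ _ _ (fun z : T * T1 => (f z.1, z.2)) _ (@dpred_eq _ S T1 _)).
apply: coordmap_pair; last by coordm.
by exists (fun i => lshift _ (s i)) => z i; rewrite fs /= row_mxEl.
Qed.

Lemma dfun_comp (g : T1 -> T2) (f : T -> T1) :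
  dfun g -> dfun f -> dfun (fun x => g (f x)).
Proof.
move=> dg df.
have df' : dpred (fun w : T * T2 * T1 => f w.1.1 = w.2).
  by apply: (dpred_coordmap (f := fun w : T * T2 * T1 => (w.1.1, w.2)) df); coordm.
have dg' : dpred (fun w : T * T2 * T1 => g w.2 = w.1.2).
  by apply: (dpred_coordmap (f := fun w : T * T2 * T1 => (w.2, w.1.2)) dg); coordm.
apply: dpred_ext (dpred_ex (P := fun z y => f z.1 = y /\ g y = z.2) (dpred_and df' dg')) _ => z.
by split=> [[_ [<-]]|fz] //; exists (f z.1).
Qed.

Lemma dpred_comp (f : T -> T1) (P : T1 -> Prop) :
  dpred P -> dfun f -> dpred (fun x => P (f x)).
Proof.
move=> dP df.
have dP' : dpred (fun w : T * T1 => P w.2) by apply: (dpred_coordmap dP); coordm.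
apply: dpred_ext (dpred_ex (P := fun x y => f x = y /\ P y) (dpred_and df dP')) _ => x.
by split=> [[_ [<-]]|Pfx] //; exists (f x).
Qed.

Lemma dfun_pair (f : T -> T1) (g : T -> T2) :
  dfun f -> dfun g -> dfun (fun x => (f x, g x)).
Proof.
move=> df dg.
have df' : dpred (fun w : T * (T1 * T2) => f w.1 = w.2.1).
  by apply: (dpred_coordmap (f := fun w : T * (T1 * T2) => (w.1, w.2.1)) df); coordm.
have dg' : dpred (fun w : T * (T1 * T2) => g w.1 = w.2.2).
  by apply: (dpred_coordmap (f := fun w : T * (T1 * T2) => (w.1, w.2.2)) dg); coordm.
apply: dpred_ext (dpred_and df' dg') _ => -[x [y z]] /=.
by split=> [[-> ->]|[-> ->]].
Qed.

Lemma dpred_cst (P : Prop) : dpred (fun _ : T => P).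
Proof.
have [p|np] := pselect P; first by apply: dpred_ext (@dpred_True _ _ T _) _.
by apply: dpred_ext (dpred_not (@dpred_True _ _ T _)) _ => x; split=> // /(_ I).
Qed.

Lemma dfun_cst (c : T1) : dfun (fun _ : T => c).
Proof.
have dc : dpred (fun y : T1 => c = y).
  have dE (i : 'I_(ddim T1)) : definable S [set u : 'rV[R]_(ddim T1) | u 0 i = enc c 0 i].
    apply: definable_ext (definable_reindex (fun=> i) (definable_point S (enc c 0 i))) _.
    by move=> u /=; rewrite mxE.
  apply: definable_ext (definableI (@enc_def _ _ T1 _) (definable_forall_ord dE)) _ => u.
  split=> [[[y _ <-] /= yc]|[y <- <-]].
    by exists y => //; apply: (@enc_inj _ _ _ dT1); apply/rowP => i; rewrite yc.
  by split=> //; exists c.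
by apply: (dpred_coordmap (f := fun z : T * T1 => z.2) dc); coordm.
Qed.

End Spaces.

Section Coordinates.
Context (T T1 : Type) {dT : dspace T} {dT1 : dspace T1}.

Lemma dpred_forall_ord n (P : 'I_n -> T -> Prop) :
  (forall i, dpred (P i)) -> dpred (fun x => forall i, P i x).
Proof.
move=> dP; apply: definable_ext (definableI (@enc_def _ _ T _) (definable_forall_ord dP)) _.
move=> u; split=> [[[x _ <-] /= Px]|[x Px <-]].
  by exists x => // i; apply/(encP (P i)).
by split; [exists x|move=> i; exists x].
Qed.

Lemma dfun_eq (f g : T -> T1) : dfun f -> f =1 g -> dfun g.
Proof. by move=> df /funext <-. Qed.

Lemma dfun_coord n (f : T -> 'rV[R]_n) (i : 'I_n) : dfun f -> dfun (fun x => f x 0 i).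
Proof.
apply: (dfun_comp (g := fun u : 'rV[R]_n => u 0 i)).
by apply: dfun_coordmap; exists (fun=> i) => u j; rewrite mxE.
Qed.

End Coordinates.

Section Closure.
Context (T T1 T2 T3 : Type) {dT : dspace T} {dT1 : dspace T1} {dT2 : dspace T2}
  {dT3 : dspace T3}.

Lemma dfun_id : dfun (fun x : T => x).
Proof. by apply: dfun_coordmap; coordm. Qed.

Lemma dfun_fst (f : T -> T1 * T2) : dfun f -> dfun (fun x => (f x).1).
Proof. by apply: (dfun_comp (g := fst)); apply: dfun_coordmap; coordm. Qed.

Lemma dfun_snd (f : T -> T1 * T2) : dfun f -> dfun (fun x => (f x).2).
Proof. by apply: (dfun_comp (g := snd)); apply: dfun_coordmap; coordm. Qed.

Lemma dpred_comp2 (P : T1 -> T2 -> Prop) (f : T -> T1) (g : T -> T2) :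
  dpred (fun z => P z.1 z.2) -> dfun f -> dfun g -> dpred (fun x => P (f x) (g x)).
Proof. by move=> dP df dg; apply: (dpred_comp dP (dfun_pair df dg)). Qed.

Lemma dfun_comp2 (P : T1 -> T2 -> T3) (f : T -> T1) (g : T -> T2) :
  dfun (fun z => P z.1 z.2) -> dfun f -> dfun g -> dfun (fun x => P (f x) (g x)).
Proof. by move=> dP df dg; apply: (dfun_comp dP (dfun_pair df dg)). Qed.

Lemma dpred_eq2 (f g : T -> T1) : dfun f -> dfun g -> dpred (fun x => f x = g x).
Proof. by move=> df dg; apply: (dpred_comp (@dpred_eq _ S T1 _) (dfun_pair df dg)). Qed.

Lemma dfun_if (P : T -> Prop) (f g : T -> T1) :
  dpred P -> dfun f -> dfun g -> dfun (fun x => ite (P x) (f x) (g x)).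
Proof.
move=> dP df dg.
have dP' : dpred (fun z : T * T1 => P z.1).
  by apply: dpred_comp => //; apply: dfun_coordmap; coordm.
apply: dpred_ext (dpred_or (dpred_and dP' df) (dpred_and (dpred_not dP') dg)) _ => z.
by rewrite /ite; case: asboolP => Pz; split=> [[[]|[]]|] //; [left|right].
Qed.

Lemma dfun_rV n (f : T -> 'rV[R]_n) : (forall i, dfun (fun x => f x 0 i)) -> dfun f.
Proof.
move=> df; have dE i : dpred (fun z : T * 'rV[R]_n => f z.1 0 i = z.2 0 i).
  apply: (dpred_coordmap (f := fun z : T * 'rV[R]_n => (z.1, z.2 0 i)) (df i)).
  apply: coordmap_pair; first by coordm.
  by exists (fun=> rshift _ i) => z j; rewrite mxE /= row_mxEr.
apply: dpred_ext (dpred_forall_ord dE) _ => z.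
by split=> [fz|-> //]; apply/rowP.
Qed.

Lemma dfun_row_mx n m (f : T -> 'rV[R]_n) (g : T -> 'rV[R]_m) :
  dfun f -> dfun g -> dfun (fun x => row_mx (f x) (g x)).
Proof.
move=> df dg; apply: dfun_rV => i; case: (splitP i) => j ij.
  have -> : i = lshift m j by apply/val_inj.
  by apply: dfun_eq (dfun_coord j df) _ => z; rewrite row_mxEl.
have -> : i = rshift n j by apply/val_inj.
by apply: dfun_eq (dfun_coord j dg) _ => z; rewrite row_mxEr.
Qed.

Lemma dfun_lsubmx n m (f : T -> 'rV[R]_(n + m)) : dfun f -> dfun (fun x => lsubmx (f x)).
Proof.
move=> df; apply: dfun_rV => i.
by apply: dfun_eq (dfun_coord (lshift m i) df) _ => z; rewrite mxE.
Qed.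

Lemma dfun_rsubmx n m (f : T -> 'rV[R]_(n + m)) : dfun f -> dfun (fun x => rsubmx (f x)).
Proof.
move=> df; apply: dfun_rV => i.
by apply: dfun_eq (dfun_coord (rshift n i) df) _ => z; rewrite mxE.
Qed.

Lemma dfun_graph (Q : T -> T1 -> Prop) (f : T -> T1) :
  dpred (fun z => Q z.1 z.2) -> (forall x y, Q x y <-> f x = y) -> dfun f.
Proof. by move=> dQ Qf; apply: dpred_ext dQ _ => z; apply: Qf. Qed.

(* On ['rV_n] the encoding is the identity, so this is the bridge to [definable]. *)
Lemma dpred_rV n (A : set 'rV[R]_n) : dpred A <-> definable S A.
Proof. by rewrite /dpred image_id. Qed.

Lemma definable_range (P : T -> Prop) n (f : T -> 'rV[R]_n) :
  dpred P -> dfun f -> definable S (f @` P).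
Proof.
move=> dP df; apply/dpred_rV.
have dP' : dpred (fun z : 'rV[R]_n * T => P z.2) by apply: (dpred_coordmap dP); coordm.
have df' : dpred (fun z : 'rV[R]_n * T => f z.2 = z.1).
  by apply: (dpred_coordmap (f := fun z : 'rV[R]_n * T => (z.2, z.1)) df); coordm.
apply: dpred_ext (dpred_ex (P := fun u x => P x /\ f x = u) (dpred_and dP' df')) _ => u.
by split=> [[x [Px fx]]|[x Px fx]]; exists x.
Qed.

End Closure.

Lemma row2E0 (x y : R) : row2 x y 0 0 = x. Proof. by rewrite mxE. Qed.
Lemma row2E1 (x y : R) : row2 x y 0 1 = y. Proof. by rewrite mxE. Qed.
Lemma row3E0 (x y z : R) : row3 x y z 0 0 = x. Proof. by rewrite mxE. Qed.
Lemma row3E1 (x y z : R) : row3 x y z 0 1 = y. Proof. by rewrite mxE. Qed.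
Lemma row3E2 (x y z : R) : row3 x y z 0 2 = z. Proof. by rewrite mxE. Qed.
Definition rowE := (row2E0, row2E1, row3E0, row3E1, row3E2).

Section Rows.
Context (T : Type) {dT : dspace T}.
Implicit Types f g : T -> R.

Lemma dfun_row2 f g : dfun f -> dfun g -> dfun (fun x => row2 (f x) (g x)).
Proof.
move=> df dg; apply: dfun_rV => -[[|[|//]] i].
  by apply: dfun_eq df _ => x; rewrite mxE.
by apply: dfun_eq dg _ => x; rewrite mxE.
Qed.

Lemma dfun_row3 f g h : dfun f -> dfun g -> dfun h -> dfun (fun x => row3 (f x) (g x) (h x)).
Proof.
move=> df dg dh; apply: dfun_rV => -[[|[|[|//]]] i].
- by apply: dfun_eq df _ => x; rewrite mxE.
- by apply: dfun_eq dg _ => x; rewrite mxE.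
- by apply: dfun_eq dh _ => x; rewrite mxE.
Qed.

End Rows.

Section FieldOperations.
Hypothesis S_field : expands_real_field S.
Context (T : Type) {dT : dspace T}.
Implicit Types f g : T -> R.

Lemma dpred_lt f g : dfun f -> dfun g -> dpred (fun x => f x < g x).
Proof.
case: S_field => /dpred_rV dlt _ _ df dg.
by apply: dpred_ext (dpred_comp dlt (dfun_row2 df dg)) _ => x /=; rewrite !rowE.
Qed.

Lemma dpred_le f g : dfun f -> dfun g -> dpred (fun x => f x <= g x).
Proof.
move=> df dg; apply: dpred_ext (dpred_not (dpred_lt dg df)) _ => x.
by rewrite leNgt; split=> /negP.
Qed.

Lemma dfun_add f g : dfun f -> dfun g -> dfun (fun x => f x + g x).
Proof.
case: S_field => _ /dpred_rV dadd _ df dg.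
apply: (dfun_comp2 (P := fun x y : R => x + y)) df dg.
have d (h : R * R * R -> R) : coordmap h -> dfun h by apply: dfun_coordmap.
apply: dpred_ext (dpred_comp dadd (dfun_row3 (d (fun z => z.1.1) _) (d (fun z => z.1.2) _)
  (d (fun z => z.2) _))) _; try coordm.
by move=> z /=; rewrite !rowE; split=> ->.
Qed.

Lemma dfun_mul f g : dfun f -> dfun g -> dfun (fun x => f x * g x).
Proof.
case: S_field => _ _ /dpred_rV dadd df dg.
apply: (dfun_comp2 (P := fun x y : R => x * y)) df dg.
have d (h : R * R * R -> R) : coordmap h -> dfun h by apply: dfun_coordmap.
apply: dpred_ext (dpred_comp dadd (dfun_row3 (d (fun z => z.1.1) _) (d (fun z => z.1.2) _)
  (d (fun z => z.2) _))) _; try coordm.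
by move=> z /=; rewrite !rowE; split=> ->.
Qed.

Lemma dfun_opp f : dfun f -> dfun (fun x => - f x).
Proof.
by move=> df; apply: dfun_eq (dfun_mul (dfun_cst (- 1)) df) _ => x; rewrite mulN1r.
Qed.

End FieldOperations.

Lemma dfun_inv (S_field : expands_real_field S) (T : Type) {dT : dspace T} (f : T -> R) :
  dfun f -> dfun (fun x => (f x)^-1).
Proof.
apply: (dfun_comp (g := fun y : R => y^-1)).
have d (h : R * R -> R) : coordmap h -> dfun h by apply: dfun_coordmap.
have d1 : dfun (fun z : R * R => z.1) by apply: d; coordm.
have d2 : dfun (fun z : R * R => z.2) by apply: d; coordm.
apply: dpred_ext (dpred_or (dpred_and (dpred_eq2 d1 (dfun_cst 0)) (dpred_eq2 d2 (dfun_cst 0)))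
  (dpred_eq2 (dfun_mul S_field d1 d2) (dfun_cst 1))) _ => -[x y] /=.
split=> [[[-> ->]|xy]|<-].
- by rewrite invr0.
- have x0 : x != 0 by apply/eqP => x0; move: xy; rewrite x0 mul0r => /eqP; rewrite eq_sym oner_eq0.
  by apply: (mulfI x0); rewrite divff.
- by have [->|x0] := eqVneq x 0; [left; rewrite invr0|right; rewrite divff].
Qed.

End DefinableFunctions.

(** * Automation: definability by recursion on the syntax of predicates and functions *)

Ltac ddef_hook := fail.

Ltac ddef_field := lazymatch goal with
  | H : expands_real_field ?S |- _ => exact: H end.

Ltac ddef1 := lazymatch goal with
  | |- dpred _ (fun _ => ?P) => exact: dpred_cst
  | |- dpred _ (fun x => _ /\ _) => apply: dpred_and
  | |- dpred _ (fun x => _ \/ _) => apply: dpred_or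
  | |- dpred _ (fun x => ~ _) => apply: dpred_not
  | |- dpred _ (fun x => exists y, @?P x y) => apply: (dpred_ex (P := P)); cbv beta
  | |- dpred _ (fun x => @?P x -> @?Q x) => apply: (dpred_imp (P := P) (Q := Q))
  | |- dpred _ (fun x => forall y, @?P x y) => apply: (dpred_all (P := P)); cbv beta
  | |- dpred _ (fun x => @?f x = @?g x) => apply: (dpred_eq2 (f := f) (g := g))
  | |- dpred _ (fun x => is_true (@?f x < @?g x)) => apply: (dpred_lt _ (f := f) (g := g));
      first ddef_field
  | |- dpred _ (fun x => is_true (@?f x <= @?g x)) => apply: (dpred_le _ (f := f) (g := g));
      first ddef_field
  | |- dfun _ (fun x => x) => exact: dfun_id
  | |- dfun _ (fun _ => ?c) => exact: dfun_cst
  | |- dfun _ (GRing.mul ?c) => apply: (dfun_mul _ (f := fun=> c) (g := fun x => x));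
      first ddef_field
  | |- dfun _ (GRing.add ?c) => apply: (dfun_add _ (f := fun=> c) (g := fun x => x));
      first ddef_field
  | |- dfun _ (pair ?c) => apply: (dfun_pair (f := fun=> c) (g := fun x => x))
  | |- dfun _ fst => apply: (dfun_fst (f := fun x => x))
  | |- dfun _ snd => apply: (dfun_snd (f := fun x => x))
  | |- dfun _ (fun x => (_, _)) => apply: dfun_pair
  | |- dfun _ (fun x => (@?f x).1) => apply: (dfun_fst (f := f))
  | |- dfun _ (fun x => (@?f x).2) => apply: (dfun_snd (f := f))
  | |- dfun _ (fun x => ite (@?P x) (@?f x) (@?g x)) => apply: (dfun_if (P := P) (f := f) (g := g))
  | |- dfun _ (fun x => @?f x + @?g x) => apply: (dfun_add _ (f := f) (g := g));
      first ddef_field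
  | |- dfun _ (fun x => @?f x * @?g x) => apply: (dfun_mul _ (f := f) (g := g));
      first ddef_field
  | |- dfun _ (fun x => - @?f x) => apply: (dfun_opp _ (f := f));
      first ddef_field
  | |- dfun _ (fun x => (@?f x)^-1) => apply: (dfun_inv _ (f := f));
      first ddef_field
  | |- dfun _ (fun x => row_mx _ _) => apply: dfun_row_mx
  | |- dfun _ (fun x => lsubmx _) => apply: dfun_lsubmx
  | |- dfun _ (fun x => rsubmx _) => apply: dfun_rsubmx
  | |- dfun _ (fun x => row3 _ _ _) => apply: dfun_row3
  | |- dfun _ (fun x => fun_of_matrix (@?f x) _ _) => apply: (dfun_coord _ (f := f))
  end.

Ltac ddef_hyp := match goal with
  | H : dpred _ (fun z => ?P z.1 z.2) |- dpred _ (?P ?c) =>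
      apply: (dpred_comp2 (f := fun _ => c) (g := fun x => x) H)
  | H : dfun _ ?f |- dfun _ ?f => exact: H
  | H : dpred _ ?f |- dpred _ ?f => exact: H
  | H : dfun _ ?f |- dfun _ (fun x => ?f (@?g x)) => apply: (dfun_comp (f := g) H)
  | H : dpred _ ?P |- dpred _ (fun x => ?P (@?g x)) => apply: (dpred_comp (f := g) H)
  | H : dfun _ (fun z => ?f z.1 z.2) |- dfun _ (fun x => ?f (@?g x) (@?h x)) =>
      apply: (dfun_comp2 (f := g) (g := h) H)
  | H : dfun _ (fun z => ?f z.1 z.2) |- dfun _ (?f ?c) =>
      apply: (dfun_comp2 (f := fun _ => c) (g := fun x => x) H)
  | H : dpred _ (fun z => ?P z.1 z.2) |- dpred _ (fun x => ?P (@?g x) (@?h x)) =>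
      apply: (dpred_comp2 (f := g) (g := h) H)
  end.

(** Hypotheses come before the syntactic rules, so that the known definability of a named predicate
    or function is used first. [ddef_hook] is the slot through which group operations and [expR] are
    added once they exist. *)
Ltac ddef := repeat first [progress cbv beta | ddef_hyp | ddef_hook | ddef1].

(** * O-minimality *)

Definition hasitv (R : realType) (X : R -> Prop) : Prop :=
  exists a b : R, a < b /\ forall t, a < t -> t < b -> X t.

Section Intervals.
Context {R : realType}.
Implicit Types (X Y : R -> Prop).

Lemma hasitv_sub X Y : (forall t, X t -> Y t) -> hasitv X -> hasitv Y.
Proof. by move=> XY [a [b [ab Xab]]]; exists a, b; split=> // t at_ tb; apply/XY/Xab. Qed.

Lemma hasitv_ex X : hasitv X -> exists t, X t.
Proof. by case=> a [b [ab Xab]]; exists ((a + b) / 2); apply: Xab; lra. Qed.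

Lemma hasitv_rat X : hasitv X -> exists q : rat, X (ratr q).
Proof.
case=> a [b [ab Xab]]; have [q] := rat_in_itvoo ab.
by rewrite in_itv => /andP[aq qb]; exists q; apply: Xab.
Qed.

(** A countable set has Lebesgue measure 0, a nonempty open interval does not. *)
Lemma uncountable_hasitv X : hasitv X -> ~ countable (X : set R).
Proof.
case=> a [b [ab Xab]] cX.
have cI : countable `]a, b[%classic.
  apply: sub_countable cX; apply: subset_card_le => t.
  by rewrite /= in_itv => /andP[]; apply: Xab.
have := countable_lebesgue_measure0 cI; rewrite lebesgue_measure_itv /= lte_fin ab.
by rewrite -EFinB => -[] /eqP; rewrite subr_eq0 gt_eqF.
Qed.

Lemma infinite_hasitv X : hasitv X -> ~ finite_set (X : set R).
Proof. by move=> /uncountable_hasitv nX /finite_set_countable. Qed.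

End Intervals.

Section Ominimal.
Context {R : realType} {S : structure R}.
Hypothesis S_field : expands_real_field S.
Hypothesis S_ominimal : ominimal S.
Local Notation dspace := (dspace S).
Local Notation dpred := (dpred S).
Local Notation dfun := (dfun S).
Implicit Types (X Y : R -> Prop).

Lemma dpred_union_itv X : dpred X -> finite_union_itv setT
  (fun x y : 'rV[R]_1 => x 0 0 < y 0 0) [set u : 'rV[R]_1 | X (u 0 0)].
Proof.
move=> dX; apply: S_ominimal; apply: definable_ext dX _ => u.
split=> [[x Xx <-]|Xu] /=; first by rewrite mxE.
by exists (u 0 0) => //; apply/rowP => i; rewrite mxE ord1.
Qed.

Lemma omin_finite_or_itv X : dpred X -> finite_set (X : set R) \/ hasitv X.
Proof.
move=> /dpred_union_itv; set A := mkset _ => fA.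
suff : finite_set A \/ hasitv (fun t => A (\row_(_ < 1) t)).
  case=> [finA|iA]; [left|right]; last first.
    by apply: hasitv_sub iA => t; rewrite /A /= mxE.
  apply: sub_finite_set (finite_image (fun u : 'rV[R]_1 => u 0 0) finA) => t Xt.
  by exists (\row_(_ < 1) t); rewrite /A /= mxE.
elim: fA => {X A} [|a _|a b _ _|A B _ [fA|iA] _ [fB|iB]].
- by left; apply: finite_set0.
- by left; apply: finite_set1.
- have [[c [d [cd cdE]]]|noitv] := pselect (exists c d : R, c < d /\
      forall t, c < t -> t < d ->
        (if a is Some u then u 0 0 < t else True) /\ (if b is Some v then t < v 0 0 else True)).
    right; exists c, d; split=> // t ct td; case: (cdE t ct td).
    by rewrite /open_itv; case: a {cdE} => [a|] /=; case: b => [b|] //=; rewrite ?mxE.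
  left; suff -> : open_itv setT (fun x y : 'rV_1 => x 0 0 < y 0 0) a b = set0 by exact: finite_set0.
  rewrite -subset0 => u [_]; case: a noitv => [a|]; case: b => [b|] noitv /= au ub; apply: noitv.
  + by exists (a 0 0), (b 0 0); split=> //; apply: lt_trans au ub.
  + by exists (a 0 0), (u 0 0).
  + by exists (u 0 0), (b 0 0).
  + by exists 0, 1; split=> //; apply: ltr01.
- by left; rewrite finite_setU.
- by right; apply: hasitv_sub iB; right.
- by right; apply: hasitv_sub iA; left.
- by right; apply: hasitv_sub iA; left.
Qed.

(* [F] stands for the filter of right neighbourhoods of a point or of neighbourhoods of -oo. *)
Lemma omin_filter (F : set (set R)) :
  (forall X Y : set R, X `<=` Y -> F X -> F Y) ->
  (forall X Y, F X -> F Y -> F (X `&` Y)) ->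
  (forall c, F [set t | c < t] \/ F [set t | t <= c]) ->
  (forall c, F [set t | t < c] \/ F [set t | c <= t]) ->
  forall X, dpred X -> F X \/ F (~` X).
Proof.
move=> Fsub Fand Fgt Flt X /dpred_union_itv; set A := mkset _ => fA.
have FT : F setT by have [] := Fgt 0; apply: Fsub.
suff : F (fun t => A (\row_(_ < 1) t)) \/ F (fun t => ~ A (\row_(_ < 1) t)).
  by case=> h; [left|right]; apply: Fsub h => t; rewrite /A /= mxE.
elim: fA => {X A} [|a _|a b _ _|A B _ [fA|iA] _ [fB|iB]].
- by right; apply: Fsub FT => t _ [].
- have aE t : (\row_(_ < 1) t = a) <-> t = a 0 0.
    split=> [<-|->]; first by rewrite mxE.
    by apply/rowP => i; rewrite mxE ord1.
  case: (Fgt (a 0 0)) => [h|h1].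
    by right; apply: Fsub h => t /= ta /aE tE; rewrite tE ltxx in ta.
  case: (Flt (a 0 0)) => [h|h2].
    by right; apply: Fsub h => t /= ta /aE tE; rewrite tE ltxx in ta.
  by left; apply: Fsub (Fand _ _ h1 h2) => t /= [t1 t2]; apply/aE/le_anti/andP.
- have [ha|ha] : F [set t | if a is Some u then u 0 0 < t else True] \/
                 F [set t | ~ if a is Some u then u 0 0 < t else True].
  + case: a => [a|]; last by left.
    by case: (Fgt (a 0 0)) => h; [left|right; apply: Fsub h => t /=; rewrite ltNge => ->].
  + have [hb|hb] : F [set t | if b is Some v then t < v 0 0 else True] \/
                 F [set t | ~ if b is Some v then t < v 0 0 else True].
    * case: b => [b|]; last by left.
      by case: (Flt (b 0 0)) => h; [left|right; apply: Fsub h => t /=; rewrite ltNge => ->].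
    * left; apply: Fsub (Fand _ _ ha hb) => t /=.
      by rewrite /open_itv; case: a {ha} => [a|] /=; case: b {hb} => [b|] /= []; rewrite ?mxE.
    * right; apply: Fsub hb => t /= + [_ _]; case: b => [b|] //; by rewrite mxE.
  + right; apply: Fsub ha => t /= + [_ + _]; case: a => [a|] //; by rewrite mxE.
- by left; apply: Fsub fA; left.
- by left; apply: Fsub fA; left.
- by left; apply: Fsub fB; right.
- by right; apply: Fsub (Fand _ _ iA iB) => t [nA nB] [].
Qed.

Lemma omin_right X a : dpred X ->
  (exists2 u, a < u & forall t, a < t -> t < u -> X t) \/
  (exists2 u, a < u & forall t, a < t -> t < u -> ~ X t).
Proof.
apply: (omin_filter (F := fun X => exists2 u, a < u & forall t, a < t -> t < u -> X t)).
- by move=> Y Z YZ [u au h]; exists u => // t at_ tu; apply/YZ/h.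
- move=> Y Z [u au hu] [v av hv]; exists (Num.min u v); first by rewrite lt_min au.
  by move=> t at_; rewrite lt_min => /andP[tu tv]; split; [apply: hu|apply: hv].
- move=> c; case: (ltP a c) => ac; [right|left].
    by exists c => // t _ /= /ltW.
  by exists (a + 1); [lra|move=> t at_ _ /=; apply: le_lt_trans at_].
- move=> c; case: (ltP a c) => ac; [left|right].
    by exists c.
  by exists (a + 1); [lra|move=> t at_ _ /=; apply: le_trans (ltW at_)].
Qed.

Lemma omin_ninfty X : dpred X ->
  (exists u, forall t, t < u -> X t) \/ (exists u, forall t, t < u -> ~ X t).
Proof.
apply: (omin_filter (F := fun X => exists u, forall t, t < u -> X t)).
- by move=> Y Z YZ [u h]; exists u => t tu; apply/YZ/h.
- move=> Y Z [u hu] [v hv]; exists (Num.min u v).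
  by move=> t; rewrite lt_min => /andP[tu tv]; split; [apply: hu|apply: hv].
- by move=> c; right; exists c => t /= /ltW.
- by move=> c; left; exists c.
Qed.

Lemma dfun_sup T {dT : dspace T} (X : T -> R -> Prop) :
  dpred (fun z => X z.1 z.2) -> dfun (fun t => sup (X t : set R)).
Proof.
move=> dX.
pose ub t (u : R) := forall x, X t x -> x <= u.
pose good t := (exists x, X t x) /\ exists u, ub t u.
(* The second disjunct records the default value 0 of [sup] on sets without a supremum. *)
apply: (dfun_graph (Q := fun t y => (good t /\ ub t y /\ forall u, ub t u -> y <= u)
    \/ (~ good t /\ y = 0))).
  by rewrite /good /ub; ddef.
move=> t y.
have gE : good t <-> has_sup (X t).
  by split=> -[[x Xx] [u uX]]; split; [exists x|exists u|exists x|exists u].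
split=> [[[g [uy ly]]|[ng ->]]|<-].
- have hs := g; move/gE: hs => hs; apply/le_anti/andP; split; last first.
    by apply: ly => x Xx; apply: sup_upper_bound.
  by apply: ge_sup => //; case: g.
- by apply: sup_out; rewrite -gE.
- have [g|ng] := pselect (good t); [left|right]; last first.
    by split=> //; rewrite sup_out // -gE.
  split=> //; split=> [x Xx|u uX]; first by apply: sup_upper_bound => //; apply/gE.
  by apply: ge_sup => //; case: g.
Qed.

(* Infimum of [X], as a supremum of lower bounds; [0] when [X] is unbounded below. *)
Definition lower_end X : R := sup (fun u => forall x, X x -> u <= x).

(* The least element of [X] if there is one, and otherwise a point of the interval with which
   [X] begins. *)
Definition pick X : R :=
  let a := lower_end X in
  ite (X a) a (ite (exists u, forall x, X x -> u <= x)
    ((a + sup (fun u => u <= a + 1 /\ forall t, a < t -> t < u -> X t)) / 2)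
    (sup (fun u => u <= 0 /\ forall t, t < u -> X t) - 1)).

Lemma dfun_pick T {dT : dspace T} (X : T -> R -> Prop) :
  dpred (fun z => X z.1 z.2) -> dfun (fun t => pick (X t)).
Proof.
move=> dX.
have da : dfun (fun t => lower_end (X t)).
  by apply: (dfun_sup (X := fun t u => forall x, X t x -> u <= x)); ddef.
have d1 : dfun (fun t => sup (fun u : R => u <= lower_end (X t) + 1 /\
    forall x, lower_end (X t) < x -> x < u -> X t x)).
  apply: (dfun_sup (X := fun t u => u <= lower_end (X t) + 1 /\
    forall x, lower_end (X t) < x -> x < u -> X t x)).
  have da1 : dfun (fun z : T * R => lower_end (X z.1)) by apply: (dfun_comp da); ddef.
  have da2 : dfun (fun z : T * R * R => lower_end (X z.1.1)) by apply: (dfun_comp da); ddef.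
  by ddef.
have d2 : dfun (fun t => sup (fun u : R => u <= 0 /\ forall x, x < u -> X t x)).
  by apply: (dfun_sup (X := fun t u => u <= 0 /\ forall x, x < u -> X t x)); ddef.
by rewrite /pick; ddef.
Qed.

(** By o-minimality a set that lacks its infimum a contains an interval starting at a, and a set
    unbounded below contains a ray to -oo. The truncations [u <= a + 1] and [u <= 0] in [pick] bound
    the sets of admissible right ends, so that their suprema exist. *)
Lemma pickP X : dpred X -> (exists x, X x) -> X (pick X).
Proof.
move=> dX [x0 Xx0]; rewrite /pick /ite; case: asboolP => // nXa.
set a := lower_end X in nXa *.
case: asboolP => [[l lX]|nl].
  have hs : has_sup (fun u => forall x, X x -> u <= x).
    by split; [exists l|exists x0 => u; apply].
  have aX x : X x -> a <= x by move=> Xx; apply: ge_sup; [exists l|move=> u; apply].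
  (* If [X] avoided an interval to the right of a, the point u would be a lower bound larger than
     the infimum. *)
  have [[u au uX]|[u au uX]] := omin_right a dX; last first.
    have : u <= a; last by rewrite leNgt au.
    apply: sup_upper_bound => // x Xx; rewrite leNgt; apply/negP => xu.
    have [xa|ax] := ltP a x; first exact: (uX x).
    by have xE : x = a; [apply/le_anti; rewrite ax aX|rewrite xE in Xx].
  set J := fun u => _; have J0 : J (Num.min u (a + 1)).
    by split=> [|t at_]; rewrite ?ge_min ?lexx ?orbT // lt_min => /andP[tu _]; apply: uX.
  have hJ : has_sup J by split; [exists (Num.min u (a + 1))|exists (a + 1) => v []].
  have aJ : a < sup J.
    apply: (@lt_le_trans _ _ (Num.min u (a + 1))); first by rewrite lt_min au; lra.
    exact: sup_upper_bound.
  have [j [_ jX] js] : exists2 j, J j & (a + sup J) / 2 < j.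
    by apply: sup_gt; [case: hJ|lra].
  by apply: jX; lra.
have [[u uX]|[u uX]] := omin_ninfty dX; last first.
  by case: nl; exists u => x Xx; rewrite leNgt; apply/negP => /uX.
set J := fun u => _; have hJ : J !=set0.
  exists (Num.min u 0); split=> [|t]; first by rewrite ge_min lexx orbT.
  by rewrite lt_min => /andP[tu _]; apply: uX.
have [j [_ jX] /jX //] : exists2 j, J j & sup J - 1 < j.
by apply: sup_gt => //; rewrite ltrBlDr ltrDl ltr01.
Qed.

Lemma definable_choice_R T {dT : dspace T} (P : T -> R -> Prop) :
  dpred (fun z => P z.1 z.2) -> (forall t, exists x, P t x) ->
  exists2 f : T -> R, dfun f & forall t, P t (f t).
Proof.
move=> dP exP; exists (fun t => pick (P t)); first exact: dfun_pick.
by move=> t; apply: pickP => //; ddef.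
Qed.

Lemma dfun_const_row T {dT : dspace T} (f : T -> R) : dfun f -> dfun (fun t => \row_(_ < 1) f t).
Proof. by move=> df; apply: dfun_rV => i; apply: dfun_eq df _ => t; rewrite mxE. Qed.

(** The first coordinate is chosen among those with a nonempty fibre and then becomes a definable
    function of the parameter, so the induction stays over the same [T]. *)
Lemma definable_choice_rV n T {dT : dspace T} (P : T -> 'rV[R]_n -> Prop) :
  dpred (fun z => P z.1 z.2) -> (forall t, exists x, P t x) ->
  exists2 f : T -> 'rV[R]_n, dfun f & forall t, P t (f t).
Proof.
elim: n T dT P => [|n IHn] T dT P dP exP.
  exists (fun=> 0); first by ddef.
  by move=> t; have [x Px] := exP t; rewrite (_ : 0 = x) //; apply/rowP => -[].
pose sc (x : R) : 'rV[R]_1 := \row_(_ < 1) x.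
have dr : dfun sc by apply: dfun_const_row; ddef.
pose P1 t (x : R) := exists v : 'rV[R]_n, P t (row_mx (sc x) v).
have [||f df fP] := @definable_choice_R T dT P1.
- by rewrite /P1; ddef.
- move=> t; have [x Px] := exP t; exists (lsubmx (x : 'rV_(1 + n)) 0 0), (rsubmx (x : 'rV_(1 + n))).
  rewrite (_ : sc _ = lsubmx (x : 'rV_(1 + n))) ?hsubmxK //.
  by apply/rowP => i; rewrite mxE ord1.
have [||g dg gP] := IHn T dT (fun t v => P t (row_mx (sc (f t)) v)).
- by ddef.
- by move=> t; apply: fP.
exists (fun t => row_mx (sc (f t)) (g t)); last exact: gP.
by apply: (@dfun_row_mx _ _ _ _ 1 n) => //; ddef.
Qed.

Lemma dfun_enc T {dT : dspace T} : dfun (@enc R S T dT).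
Proof. by apply: dfun_coordmap; exists id. Qed.

Theorem definable_choice T T' {dT : dspace T} {dT' : dspace T'} (P : T -> T' -> Prop) :
  dpred (fun z => P z.1 z.2) -> (forall t, exists x, P t x) ->
  exists2 f : T -> T', dfun f & forall t, P t (f t).
Proof.
move=> dP exP; have de := @dfun_enc T' dT'.
have [||g dg gP] := @definable_choice_rV (ddim T') T dT (fun t u => exists x, enc x = u /\ P t x).
- by ddef.
- by move=> t; have [x Px] := exP t; exists (enc x), x.
have [f fP] := choice gP; exists f; last by move=> t; case: (fP t).
apply: (dfun_graph (Q := fun t x => enc x = g t)); first by ddef.
move=> t x; have [<- _] := fP t; split=> [|->] //.
by move/(@enc_inj _ _ _ dT').
Qed.

End Ominimal.

(** * Additive functions and definable subgroups of the line *)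

Section AdditiveFunctions.
Context {R : realType} (f : R -> R) (fD : forall x y, f (x + y) = f x + f y).

Lemma addf0 : f 0 = 0.
Proof. by apply: (addrI (f 0)); rewrite -fD !addr0. Qed.

Lemma addfN x : f (- x) = - f x.
Proof. by apply: (addrI (f x)); rewrite -fD !subrr addf0. Qed.

Lemma addfMn x n : f (x *+ n) = f x *+ n.
Proof. by elim: n => [|n IHn]; rewrite ?mulr0n ?addf0 // !mulrS fD IHn. Qed.

Lemma addfMz x (k : int) : f (x *~ k) = f x *~ k.
Proof. by case: k => n; rewrite ?NegzE ?mulrNz ?addfN addfMn. Qed.

(** Translating the interval bounds f above near 0. The additive function [g x = f x - f 1 * x]
    vanishes at 1/N, so it has period 1/N and is bounded above on the whole line; since g(ny) = n
    g(y) it is nonpositive, and oddness makes it 0. [N] is chosen so that a period fits into the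
    neighbourhood of 0. *)
Lemma addf_bounded_linear : (exists a b, a < b /\ forall t, a < t -> t < b -> f t <= 0) ->
  forall x, f x = f 1 * x.
Proof.
case=> a [b [ab fab]]; set m := (a + b) / 2; set d := (b - a) / 2.
have d0 : 0 < d by rewrite /d; lra.
have fd x : `|x| < d -> f x <= - f m.
  rewrite ltr_norml => /andP[dx xd].
  have : f (m + x) <= 0 by apply: fab; rewrite /m; rewrite /d in dx xd; lra.
  by rewrite fD; lra.
pose C := - f m.
set N := (Num.bound d^-1).
have N0 : 0 < N%:R :> R.
  by apply: le_lt_trans (archi_boundP _); rewrite ?invr_ge0 ltW.
have Nd : N%:R^-1 < d.
  by rewrite invf_plt ?posrE //; apply: archi_boundP; rewrite invr_ge0 ltW.
pose g x := f x - f 1 * x.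
have gD x y : g (x + y) = g x + g y by rewrite /g fD; lra.
have gN : g N%:R^-1 = 0.
  have : f (N%:R^-1 *+ N) = f N%:R^-1 *+ N by rewrite addfMn.
  rewrite -(mulr_natr (N%:R^-1)) mulVf ?gt_eqF // -(mulr_natr (f _)) /g => ->.
  by field; rewrite gt_eqF.
have gB : exists B, forall x, g x <= B.
  exists (C + `|f 1| * d) => x.
  pose k := Num.floor (x * N%:R); pose r := x - N%:R^-1 *~ k.
  have r0 : 0 <= r < N%:R^-1.
    have /andP[k1 k2] := floor_itv (x * N%:R).
    have -> : r = x - N%:R^-1 * k%:~R by rewrite /r mulrzr.
    rewrite subr_ge0 ler_pdivrMl // [N%:R * x]mulrC k1 /= ltrBlDr.
    rewrite -[X in X + _]mulr1 -mulrDr mulrC ltr_pdivlMr //.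
    by move: k2; rewrite intrD addrC.
  have -> : g x = g r.
    have -> : x = r + N%:R^-1 *~ k by rewrite subrK.
    rewrite gD; suff -> : g (N%:R^-1 *~ k) = 0 by rewrite addr0.
    have -> : g (N%:R^-1 *~ k) = g (N%:R^-1) *~ k.
      by rewrite /g addfMz mulrzDl mulrzAr mulNrz.
    by rewrite gN mul0rz.
  case/andP: r0 => r0 rN; have rd : `|r| < d by rewrite ger0_norm //; lra.
  rewrite /g; apply: lerD; first exact: fd.
  rewrite -mulNr; apply: (le_trans (ler_norm _)); rewrite normrM normrN.
  by apply: ler_wpM2l => //; apply: ltW.
case: gB => B gB x.
have g0 y : g y <= 0.
  rewrite leNgt; apply/negP => gy.
  have := gB (y *+ Num.bound (`|B| / g y)).
  have -> n : g (y *+ n) = g y *+ n by rewrite /g addfMn mulrnBl mulrnAr.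
  rewrite -mulr_natr leNgt => /negP; apply.
  rewrite mulrC -ltr_pdivrMr //.
  apply: le_lt_trans (archi_boundP _); last by rewrite divr_ge0 // ltW.
  by rewrite ler_pM2r ?invr_gt0 // ler_norm.
have gx := g0 x; have gNx := g0 (- x).
by rewrite /g addfN in gx gNx; lra.
Qed.

End AdditiveFunctions.

Section DefinableSubgroups.
Context {R : realType} {S : structure R}.
Hypothesis S_field : expands_real_field S.
Hypothesis S_ominimal : ominimal S.
Local Notation dspace := (dspace S).
Local Notation dpred := (dpred S).
Local Notation dfun := (dfun S).

(** The multiples of 1 make [X] infinite, so it contains an interval; subtracting the midpoint
    yields a neighbourhood of 0, and any x is the n-fold sum of x/n, which lies there for large
    n. *)
Lemma definable_subgroup_R (X : R -> Prop) : dpred X -> X 1 ->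
  (forall x y, X x -> X y -> X (x - y)) -> forall x, X x.
Proof.
move=> dX X1 XB.
have X0 : X 0 by rewrite -(subrr 1); apply: XB.
have XN x : X x -> X (- x) by rewrite -sub0r; apply: XB.
have XD x y : X x -> X y -> X (x + y) by move=> Xx /XN; rewrite -{2}(opprK y); apply: XB.
have XMn x n : X x -> X (x *+ n).
  by move=> Xx; elim: n => [|n IHn]; rewrite ?mulr0n // mulrS; apply: XD.
have [finX|[a [b [ab Xab]]]] := omin_finite_or_itv S_ominimal dX.
  exfalso; apply: infinite_nat.
  have : finite_set ((fun n : nat => n%:R : R) @^-1` X).
    by apply: finite_preimage finX => n m _ _ /eqP; rewrite eqr_nat => /eqP.
  by apply: sub_finite_set => n _; apply: XMn.
set m := (a + b) / 2; set d := (b - a) / 2.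
have d0 : 0 < d by rewrite /d; lra.
have Xd x : `|x| < d -> X x.
  rewrite ltr_norml => /andP[dx xd].
  have -> : x = (m + x) - m by rewrite addrC addKr.
  by rewrite /d in dx xd; apply: XB; apply: Xab; rewrite /m; lra.
move=> x; pose n := Num.bound (`|x| / d).
have n0 : `|x| / d < n%:R by apply: archi_boundP; rewrite divr_ge0 // ltW.
have n1 : 0 < n%:R :> R by apply: le_lt_trans n0; rewrite divr_ge0 // ltW.
have -> : x = (x / n%:R) *+ n by rewrite -mulr_natr divfK // gt_eqF.
apply/XMn/Xd; rewrite normrM normfV (ger0_norm (ltW n1)).
by rewrite ltr_pdivrMr // mulrC -ltr_pdivrMr.
Qed.

(** The points where f agrees with the linear map form a definable subgroup containing 1. *)
Lemma dfun_additive_linear (f : R -> R) : dfun f -> (forall x y, f (x + y) = f x + f y) ->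
  forall x, f x = f 1 * x.
Proof.
move=> df fD; apply: (definable_subgroup_R (X := fun x => f x = f 1 * x)).
- by ddef.
- by rewrite mulr1.
- by move=> x y fx fy; rewrite fD addfN // fx fy mulrBr.
Qed.

Lemma definable_funE m n (A : set 'rV[R]_m) (f : 'rV[R]_m -> 'rV[R]_n) :
  definable_fun S A f <-> dpred (fun z => A z.1 /\ f z.1 = z.2).
Proof.
have E u : [set row_mx x (f x) | x in A] u <->
    (exists2 z : 'rV[R]_m * 'rV[R]_n, A z.1 /\ f z.1 = z.2 & row_mx z.1 z.2 = u).
  by split=> [[x Ax <-]|[[x y] /= [Ax <-] <-]]; [exists (x, f x)|exists x].
by split=> d; apply: definable_ext d _ => u; [apply: E|apply: iff_sym; apply: E].
Qed.

Lemma definable_group_total (G : group_data R) : is_group G -> definable S (gset G) ->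
  dfun (fun z => gmul G z.1 z.2) -> definable_group S G.
Proof.
move=> gG dG dm; split=> //.
have dG' := dG; move/dpred_rV: dG' => dG'.
have d : definable S ((fun z => row_mx (row_mx z.1 z.2) (gmul G z.1 z.2)) @`
    (fun z => gset G z.1 /\ gset G z.2)).
  by apply: definable_range; ddef.
apply: definable_ext d _ => u.
by split=> [[[x y] /= [Gx Gy] <-]|[x Gx [y Gy <-]]];
  [exists x => //; exists y|exists (x, y)].
Qed.

End DefinableSubgroups.

(** * Definability of the exponential, by comparing (R,+) with the positive reals under
    multiplication *)

Definition mulpos_group (R : realType) : group_data R :=
  @GroupData R 1 [set u | 0 < u 0 0] (fun u v => \row_(_ < 1) (u 0 0 * v 0 0))
    (\row_(_ < 1) 1) (fun u => \row_(_ < 1) (u 0 0)^-1).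

Section Exponential.
Context {R : realType} {S : structure R}.
Hypothesis S_field : expands_real_field S.
Hypothesis S_ominimal : ominimal S.
Hypothesis S_ominimal_groups : forall G H : group_data R,
  ominimal_group S G -> ominimal_group S H -> definably_isomorphic S G H.
Local Notation dspace := (dspace S).
Local Notation dpred := (dpred S).
Local Notation dfun := (dfun S).

Lemma row1E (x : R) : (\row_(_ < 1) x) 0 0 = x. Proof. by rewrite mxE. Qed.

Lemma row1P (u v : 'rV[R]_1) : u 0 0 = v 0 0 -> u = v.
Proof. by move=> uv; apply/rowP => i; rewrite ord1. Qed.

Lemma add_is_group n : is_group (add_group R n).
Proof.
split=> //=; first by move=> x y z _ _ _; rewrite addrA.
  by move=> x _; rewrite add0r addr0.
by move=> x _; rewrite addNr addrN.
Qed.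

Lemma dfun_rVD T {dT : dspace T} n (f g : T -> 'rV[R]_n) : dfun f -> dfun g ->
  dfun (fun x => f x + g x).
Proof.
move=> df dg; apply: dfun_rV => i.
by apply: (dfun_eq (f := fun x => f x 0 i + g x 0 i)); [ddef|move=> x; rewrite mxE].
Qed.

Lemma add_definable_group n : definable_group S (add_group R n).
Proof.
apply: definable_group_total => /=; [exact: add_is_group|exact: definable_setT|].
by apply: dfun_rVD; ddef.
Qed.

Lemma add_ominimal_group : ominimal_group S (add_group R 1).
Proof.
split; first exact: add_definable_group.
  move=> /(finite_preimage (f := fun n : nat => (\row_(_ < 1) n%:R : 'rV[R]_1))).
  rewrite preimage_setT => finN; apply/infinite_nat/finN => n m _ _ /rowP/(_ 0).
  by rewrite !mxE => /eqP; rewrite eqr_nat => /eqP.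
exists (fun x y => x 0 0 < y 0 0); split.
- split.
  + by move=> x _; rewrite ltxx.
  + by move=> x y z _ _ _; apply: lt_trans.
  + move=> x y _ _; case: (ltgtP (x 0 0) (y 0 0)) => h;
      [constructor 1|constructor 3|constructor 2] => //.
    exact: row1P.
  + by move=> x y z _ _ _ xy /=; rewrite !mxE ltrD2l ltrD2r.
- apply/dpred_rV; have d : dpred (fun u : 'rV[R]_(1 + 1) => lsubmx u 0 0 < rsubmx u 0 0) by ddef.
  by apply: dpred_ext d _ => u /=; split=> [|[]].
- by move=> A _; apply: S_ominimal.
Qed.

Lemma mulpos_is_group : is_group (mulpos_group R).
Proof.
split=> /=.
- by rewrite mxE ltr01.
- by move=> x y x0 y0; rewrite mxE mulr_gt0.
- by move=> x x0; rewrite mxE invr_gt0.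
- by move=> x y z _ _ _; apply: row1P; rewrite !mxE mulrA.
- by move=> x _; split; apply: row1P; rewrite !mxE ?mul1r ?mulr1.
- by move=> x x0; split; apply: row1P; rewrite !mxE ?mulVf ?divff ?gt_eqF.
Qed.

Lemma mulpos_definable_group : definable_group S (mulpos_group R).
Proof.
apply: definable_group_total => /=; first exact: mulpos_is_group.
  by apply/dpred_rV; rewrite /mkset; ddef.
by apply: dfun_const_row; ddef.
Qed.

(** Endpoints have to lie in the group: a nonpositive left endpoint is replaced by [None], and a
    nonpositive right endpoint leaves an empty intersection. *)
Lemma union_itv_pos (A : set 'rV[R]_1) :
  finite_union_itv setT (fun x y : 'rV[R]_1 => x 0 0 < y 0 0) A ->
  finite_union_itv [set u : 'rV[R]_1 | 0 < u 0 0] (fun x y => x 0 0 < y 0 0)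
    (A `&` [set u | 0 < u 0 0]).
Proof.
elim=> {A} [|a _|a b _ _|A B _ IHA _ IHB].
- by rewrite set0I; constructor.
- have [a0|a0] := pselect (0 < a 0 0).
    rewrite (_ : _ `&` _ = [set a]); first by constructor.
    by apply/seteqP; split=> [u []|u /= ->].
  rewrite (_ : _ `&` _ = set0); first by constructor.
  by apply/seteqP; split=> [u [/= ->]|u []].
- have [b0|b0] := pselect (if b is Some v then 0 < v 0 0 else True); last first.
    rewrite (_ : _ `&` _ = set0); first by constructor.
    apply/seteqP; split=> [u [[_ _] ub /= u0]|u []]; apply: b0.
    by case: b ub => // v uv; apply: lt_trans uv.
  pose a' := if a is Some u then (if 0 < u 0 0 then a else None) else None.
  rewrite (_ : _ `&` _ = open_itv [set u : 'rV[R]_1 | 0 < u 0 0]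
    (fun x y => x 0 0 < y 0 0) a' b).
    by constructor=> //; rewrite /a'; case: a {a'} => // u; case: ifP.
  apply/seteqP; split=> u.
    case=> -[_ au ub] u0; split=> //; rewrite /a'; case: a {a'} au => // v vu.
    by case: ifP.
  case=> /= u0 au ub; split=> //; split=> //; move: au; rewrite /a'; case: a {a'} => // v.
  by case: ifPn => //; rewrite -leNgt => v0 _; apply: le_lt_trans u0.
- by rewrite setIUl; constructor.
Qed.

Lemma mulpos_ominimal_group : ominimal_group S (mulpos_group R).
Proof.
split; first exact: mulpos_definable_group.
  move=> /(finite_preimage (f := fun n : nat => (\row_(_ < 1) n.+1%:R : 'rV[R]_1))).
  rewrite (_ : _ @^-1` _ = setT); last by apply/seteqP; split=> // n _ /=; rewrite mxE.
  move=> finN; apply/infinite_nat/finN => n m _ _ /rowP/(_ 0).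
  by rewrite !mxE => /eqP; rewrite eqr_nat => /eqP[].
exists (fun x y => x 0 0 < y 0 0); split.
- split.
  + by move=> x _; rewrite ltxx.
  + by move=> x y z _ _ _; apply: lt_trans.
  + move=> x y _ _; case: (ltgtP (x 0 0) (y 0 0)) => h;
      [constructor 1|constructor 3|constructor 2] => //.
    exact: row1P.
  + move=> x y z x0 y0 z0 xy /=; rewrite !mxE ltr_pM2l ?ltr_pM2r //.
- apply/dpred_rV; have d : dpred (fun u : 'rV[R]_(1 + 1) => 0 < lsubmx u 0 0 /\
    0 < rsubmx u 0 0 /\ lsubmx u 0 0 < rsubmx u 0 0) by ddef.
  by apply: dpred_ext d _ => u /=; split=> [[? []]|[]].
- move=> A A0 dA; have := union_itv_pos (S_ominimal dA).
  by rewrite (_ : A `&` _ = A) //; apply/setIidl.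
Qed.

(* An isomorphism of (R,+) with the positive reals has the form e^(kx): its logarithm is additive
   and bounded above on an interval. *)
Theorem dfun_expR : dfun (@expR R).
Proof.
have [f [[f0 df fD] [_ finj fsurj]]] := S_ominimal_groups add_ominimal_group mulpos_ominimal_group.
have sc : dfun (fun x : R => \row_(_ < 1) x) by apply: dfun_const_row; ddef.
have df' : dfun f by move/definable_funE: df => df; apply: dpred_ext df _ => z; split=> [[]|].
pose F x := f (\row_(_ < 1) x) 0 0.
have dF : dfun F.
  by apply: dfun_coord; apply: (dfun_comp df' sc).
have F0 x : 0 < F x by apply: f0.
have FD x y : F (x + y) = F x * F y.
  rewrite /F (_ : \row__ (x + y) = (\row__ x) + (\row__ y)); last by apply: row1P; rewrite !mxE.
  by rewrite [f _]fD // row1E.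
pose L x := ln (F x).
have LD x y : L (x + y) = L x + L y by rewrite /L FD lnM ?posrE.
have dX : dpred (fun x => F x <= 1) by ddef.
(* One of the sets F <= 1 and F > 1 contains an interval. In the second case the reflected interval
   serves, because L is odd. *)
have itvL : exists a b, a < b /\ forall t, a < t -> t < b -> L t <= 0.
  have [finX|[a [b [ab h]]]] := omin_finite_or_itv S_ominimal dX; last first.
    by exists a, b; split=> // t at_ tb; apply/ln_le0/h.
  have [finY|[a [b [ab h]]]] := omin_finite_or_itv S_ominimal (dpred_not dX).
    exfalso; have i01 : hasitv (fun t : R => True) by exists 0, 1.
    apply: (infinite_hasitv i01).
    have : finite_set ((fun x => F x <= 1) `|` (fun x => ~ F x <= 1)) by rewrite finite_setU.
    by apply: sub_finite_set => t _; have [|] := pselect (F t <= 1); [left|right].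
  exists (- b), (- a); split; first by lra.
  move=> t bt ta; have : ~ F (- t) <= 1 by apply: h; lra.
  move/negP; rewrite -ltNge => /ln_gt0; rewrite -/(L (- t)) (addfN LD); lra.
have LE := addf_bounded_linear LD itvL.
pose k := L 1.
have FE x : F x = expR (k * x) by rewrite -LE lnK ?posrE.
have k0 : k != 0.
  apply/eqP => k0; have := finj (\row_(_ < 1) 0) (\row_(_ < 1) 1).
  rewrite !inE => /(_ I I); have -> : f (\row_(_ < 1) 0) = f (\row_(_ < 1) 1).
    by apply: row1P; rewrite -/(F 0) -/(F 1) !FE k0 !mul0r.
  by move=> /(_ erefl)/rowP/(_ 0); rewrite !mxE => /eqP; rewrite eq_sym oner_eq0.
apply: (dfun_eq (f := fun x => F (k^-1 * x))); first by ddef.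
by move=> x; rewrite FE mulrA divff // mul1r.
Qed.

End Exponential.

(** * Dimension *)

(** Nested pairs rather than row vectors: slicing at the first coordinate is then plain structural
    recursion. *)
Fixpoint Rn (R : realType) (n : nat) : Type :=
  if n is m.+1 then (R * Rn R m)%type else unit.

(* [dim_ge m A] says that [A] has dimension at least [m], computed by recursion on the fibres
   over the first coordinate. *)
Fixpoint dim_ge (R : realType) (n m : nat) : (Rn R n -> Prop) -> Prop :=
  match n return (Rn R n -> Prop) -> Prop with
  | 0 => fun A => m = 0%N /\ A tt
  | n'.+1 => fun A => match m with
    | 0 => exists x, dim_ge 0 (fun v => A (x, v))
    | m'.+1 => hasitv (fun x => dim_ge m' (fun v => A (x, v))) \/
               exists x, dim_ge m'.+1 (fun v => A (x, v))
    end
  end.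

Section Dimension.
Context {R : realType} {S : structure R}.
Hypothesis S_field : expands_real_field S.
Hypothesis S_ominimal : ominimal S.
Local Notation dspace := (dspace S).
Local Notation dpred := (dpred S).
Local Notation dfun := (dfun S).

#[export] Instance dspace_Rn n : dspace (Rn R n).
Proof. by elim: n => [|n IHn]; [exact: dspace_unit|exact: (@dspace_prod R S R (Rn R n))]. Defined.

Lemma dpred_hasitv T {dT : dspace T} (X : T -> R -> Prop) :
  dpred (fun z => X z.1 z.2) -> dpred (fun t => hasitv (X t)).
Proof. by move=> dX; rewrite /hasitv; ddef. Qed.

(** Containing an interval is a first-order condition, hence so is dimension. Sets of parameters
    with large fibres are thus themselves subject to o-minimality. *)
Lemma dpred_dim_ge n m T {dT : dspace T} (A : T -> Rn R n -> Prop) :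
  dpred (fun z => A z.1 z.2) -> dpred (fun t => dim_ge m (A t)).
Proof.
elim: n m T dT A => [|n IHn] m T dT A dA /=.
  by ddef.
have dA' : dpred (fun z : T * R * Rn R n => A z.1.1 (z.1.2, z.2)).
  apply: (dpred_comp2 (P := A)) => //; by ddef.
have h k : dpred (fun z : T * R => dim_ge k (fun v => A z.1 (z.2, v))).
  by apply: (IHn k (T * R)%type _ (fun z v => A z.1 (z.2, v))).
case: m => [|m].
  exact: (dpred_ex (P := fun t x => dim_ge 0 (fun v => A t (x, v)))).
apply: dpred_or; last exact: (dpred_ex (P := fun t x => dim_ge m.+1 (fun v => A t (x, v)))).
exact: (dpred_hasitv (X := fun t x => dim_ge m (fun v => A t (x, v)))).
Qed.

Lemma dim_ge_succ n m (A : Rn R n -> Prop) : dim_ge m.+1 A -> dim_ge m A.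
Proof.
elim: n m A => [|n IHn] [|m] A /=; try by case.
  case=> [/hasitv_ex[x Ax]|[x Ax]]; exists x => //; exact: IHn.
case=> [Ai|[x Ax]]; [left|right]; last by exists x; apply: IHn.
by apply: hasitv_sub Ai => x; apply: IHn.
Qed.

Lemma dim_ge_fiber n m (A : Rn R n.+1 -> Prop) x :
  dim_ge m (fun v => A (x, v)) -> dim_ge m A.
Proof. by case: m => [|m] Ax; [exists x|right; exists x]. Qed.

Lemma dim_ge0 n (A : Rn R n -> Prop) : dim_ge 0 A <-> exists v, A v.
Proof.
elim: n A => [|n IHn] A /=; first by split=> [[_ At]|[[] At]] //; exists tt.
split=> [[x /IHn[v Axv]]|[[x v] Axv]]; first by exists (x, v).
by exists x; apply/IHn; exists v.
Qed.

Lemma dim_ge_full n : dim_ge n (fun _ : Rn R n => True).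
Proof.
by elim: n => [|n IHn] //=; left; exists 0, 1; split=> //; apply: ltr01.
Qed.

Lemma hasitv_or (X Y : R -> Prop) : dpred X -> dpred Y ->
  hasitv (fun x => X x \/ Y x) -> hasitv X \/ hasitv Y.
Proof.
move=> dX dY XY.
case: (omin_finite_or_itv S_ominimal dX) => [fX|]; last by left.
case: (omin_finite_or_itv S_ominimal dY) => [fY|]; last by right.
by case: (infinite_hasitv XY); rewrite -[fun x => _]/(X `|` Y) finite_setU.
Qed.

(* A fibre with interior contains a rational, so uncountably many such fibres share one. *)
Lemma hasitv_exchange (C : R -> R -> Prop) : dpred (fun z => C z.1 z.2) ->
  hasitv (fun x => hasitv (C x)) -> hasitv (fun y => hasitv (fun x => C x y)).
Proof.
move=> dC hC.
have dC' : dpred (fun y => hasitv (fun x => C x y)).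
  by apply: (dpred_hasitv (X := fun y x => C x y)); ddef.
case: (omin_finite_or_itv S_ominimal dC') => // fD; exfalso.
set D := fun y => _ in fD dC'.
apply: (uncountable_hasitv hC).
(* Deleting the finite set [D] from a fibre with interior leaves an interval, hence a rational q
   outside [D]; over such a q only finitely many x lie. So the sets [F q] are finite and cover the
   uncountable set of x. *)
pose F (q : rat) : set R := fun x => C x (ratr q) /\ ~ D (ratr q).
apply: (@sub_countable _ _ _ (\bigcup_q F q)).
  apply: subset_card_le => x Cx.
  have : hasitv (fun y => D y \/ (C x y /\ ~ D y)).
    by apply: hasitv_sub Cx => y Cxy; have [|nD] := pselect (D y); [left|right].
  have dCx : dpred (fun y => C x y) by ddef.
  case/hasitv_or; [by []|by ddef|by move=> /infinite_hasitv|].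
  by move=> /hasitv_rat[q]; exists q.
apply: bigcup_countable => [|q _]; first exact: countableP.
apply: finite_set_countable.
have dCq : dpred (fun x => C x (ratr q)) by ddef.
have [fq|iq] := omin_finite_or_itv S_ominimal dCq.
  by apply: sub_finite_set fq => x [].
by apply: (@sub_finite_set _ _ set0) (finite_set0 _) => x [_ []].
Qed.

(** Pigeonhole: if only finitely many y occur, an interval of x is covered by finitely many
    definable sets, one of which is infinite and so contains an interval. *)
Lemma hasitv_project (D : R -> R -> Prop) : dpred (fun z => D z.1 z.2) ->
  hasitv (fun x => exists y, D x y) ->
  (exists y, hasitv (fun x => D x y)) \/ hasitv (fun y => exists x, D x y).
Proof.
move=> dD hD.
have dY : dpred (fun y => exists x, D x y) by ddef.
have [fY|] := omin_finite_or_itv S_ominimal dY; last by right.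
left; apply: contrapT => nD; apply: (infinite_hasitv hD).
apply: (@sub_finite_set _ _ (\bigcup_(y in fun y => exists x, D x y) (fun x => D x y))).
  by move=> x [y Dxy]; exists y => //; exists x.
apply: bigcup_finite => // y _.
have dx : dpred (fun x => D x y) by ddef.
by have [|iy] := omin_finite_or_itv S_ominimal dx; last by case: nD; exists y.
Qed.

(** Fixing the value of a definable function costs at most one dimension. By induction on n, each
    large slice has either a level set of full dimension or an interval of level sets of one
    dimension less, and one of the alternatives holds for an interval of x: [hasitv_project] handles
    the first, [hasitv_exchange] the second. For m = 0 slices are merely nonempty and projection
    suffices. *)
Lemma dim_ge_fibers n m (A : Rn R n -> Prop) (g : Rn R n -> R) :
  dpred A -> dfun g -> dim_ge m.+1 A ->
  (exists c, dim_ge m.+1 (fun v => A v /\ g v = c)) \/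
  hasitv (fun c => dim_ge m (fun v => A v /\ g v = c)).
Proof.
elim: n m A g => [|n IHn] m A g dA dg; first by case.
have dA2 : dpred (fun z : R * Rn R n => A (z.1, z.2)) by apply: dpred_comp; ddef.
have dAg : dpred (fun z : R * R * Rn R n => A (z.1.1, z.2) /\ g (z.1.1, z.2) = z.1.2).
  apply: dpred_and; first by apply: (dpred_comp (P := A)); ddef.
  by apply: dpred_eq2; [apply: (dfun_comp (g := g)); ddef|ddef].
pose D k x c := dim_ge k (fun v => A (x, v) /\ g (x, v) = c).
have dD k : dpred (fun z : R * R => D k z.1 z.2).
  by apply: (@dpred_dim_ge n k (R * R)%type _ (fun z v => A (z.1, v) /\ g (z.1, v) = z.2)).
have dAx x : dpred (fun v => A (x, v)) by apply: (dpred_comp (P := A)); ddef.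
have dgx x : dfun (fun v => g (x, v)) by apply: (dfun_comp (g := g)); ddef.
case=> [hX|[x Ax]]; last first.
  case: (IHn m _ _ (dAx x) (dgx x) Ax) => [[c hc]|hc]; [left; exists c|right].
    exact: (dim_ge_fiber (x := x)).
  by apply: hasitv_sub hc => c; apply: (dim_ge_fiber (x := x)).
have caseD : hasitv (fun x => exists c, D m x c) ->
    (exists c, dim_ge m.+1 (fun v => A v /\ g v = c)) \/
    hasitv (fun c => dim_ge m (fun v => A v /\ g v = c)).
  move=> /(hasitv_project (dD m))[[c hc]|hc]; [left|right].
    by exists c; left.
  by apply: hasitv_sub hc => c [x Dxc]; apply: (dim_ge_fiber (x := x)).
case: m caseD hX => [|m] caseD hX.
  apply: caseD; apply: hasitv_sub hX => x /dim_ge0[v Axv].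
  by exists (g (x, v)); apply/dim_ge0; exists v.
have : hasitv (fun x => (exists c, D m.+1 x c) \/ hasitv (D m x)).
  by apply: hasitv_sub hX => x; apply: IHn.
case/hasitv_or => [||//|hC].
- by apply: (dpred_ex (P := D m.+1)); apply: dD.
- by apply: (dpred_hasitv (X := D m)); apply: dD.
right; apply: hasitv_sub (hasitv_exchange (dD m) hC) => c hc.
by left.
Qed.

(** Each coordinate of f is fixed in turn at the cost of at most one dimension. What remains has
    dimension at least 1, hence two distinct points, and f is constant on it. *)
Lemma no_injection n m k (A : Rn R n -> Prop) (f : Rn R n -> Rn R k) :
  (k < m)%N -> dpred A -> dfun f -> dim_ge m A ->
  exists v w, [/\ A v, A w, v <> w & f v = f w].
Proof.
elim: k m A f => [|k IHk] [//|m] A f km dA df Am.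
  elim: n A f {dA df} Am => [|n IHn] A f; first by case.
  case=> [[a [b [ab h]]]|[x Ax]].
    have cA c : a < c < b -> exists v, A (c, v).
      move=> /andP[ac cb]; apply/dim_ge0.
      by elim: (m) (h _ ac cb) => // p IHp /dim_ge_succ.
    have [v Av] : exists v, A ((a + b) / 2, v) by apply: cA; apply/andP; split; lra.
    have [w Aw] : exists v, A ((2 * a + b) / 3, v) by apply: cA; apply/andP; split; lra.
    exists ((a + b) / 2, v), ((2 * a + b) / 3, w); split=> //; last by do 2!case: (f _).
    by case=> e _; move: e; lra.
  have [v [w [Av Aw vw _]]] := IHn _ (fun=> tt) Ax.
  exists (x, v), (x, w); split=> //; last by do 2!case: (f _).
  by case=> /vw.
have df1 : dfun (fun v => (f v).1) by apply: (dfun_fst (f := f)); ddef.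
have df2 : dfun (fun v => (f v).2) by apply: (dfun_snd (f := f)); ddef.
have [c hc] : exists c, dim_ge m (fun v => A v /\ (f v).1 = c).
  case: (dim_ge_fibers dA df1 Am) => [[c /dim_ge_succ]|/hasitv_ex[c]]; by exists c.
have dAc : dpred (fun v => A v /\ (f v).1 = c) by ddef.
have [v [w [[Av vc] [Aw wc] vw fvw]]] := IHk m _ _ km dAc df2 hc.
exists v, w; split=> //; rewrite [f v]surjective_pairing [f w]surjective_pairing.
by rewrite vc wc fvw.
Qed.

Theorem definable_injection_leq n k (f : Rn R n -> Rn R k) :
  dfun f -> injective f -> (n <= k)%N.
Proof.
move=> df finj; rewrite leqNgt; apply/negP => kn.
have dT : dpred (fun _ : Rn R n => True) by exact: dpred_True.
by have [v [w [_ _ vw /finj]]] := no_injection kn dT df (dim_ge_full n).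
Qed.

End Dimension.

(** * Definable groups *)

(** The operation lives on a whole type, so the laws carry no membership conditions. Groups given by
    [group_data] enter as sigma types, and the quotient of G by H1 as a group on pairs of reals. *)
Record dgroup (R : realType) (S : structure R) := DGroup {
  car :> Type;
  car_dspace : dspace S car;
  gop : car -> car -> car;
  ge : car;
  gi : car -> car;
  gopA : forall x y z, gop (gop x y) z = gop x (gop y z);
  ge1g : forall x, gop ge x = x;
  gg1e : forall x, gop x ge = x;
  giVg : forall x, gop (gi x) x = ge;
  ggVi : forall x, gop x (gi x) = ge;
  dfun_gop : dfun S (fun z => gop z.1 z.2) }.
#[export] Existing Instance car_dspace.
Arguments ge {R S G} : rename.
Arguments gop {R S G} x y : rename.
Arguments gi {R S G} x : rename.

Notation "x ** y" := (gop x y) (at level 40, left associativity).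

Section GroupTheory.
Context {R : realType} {S : structure R} {G : dgroup S}.
Implicit Types x y z g h : G.

Lemma gKV x y : gi x ** (x ** y) = y. Proof. by rewrite -gopA giVg ge1g. Qed.
Lemma gVK x y : x ** (gi x ** y) = y. Proof. by rewrite -gopA ggVi ge1g. Qed.

Lemma gopI x y z : x ** y = x ** z -> y = z.
Proof. by move=> e; rewrite -(gKV x y) e gKV. Qed.

Lemma gIop x y z : y ** x = z ** x -> y = z.
Proof. by move=> e; rewrite -(gg1e y) -(ggVi x) -gopA e gopA ggVi gg1e. Qed.

Lemma giI x : gi (gi x) = x.
Proof. by apply: (@gopI (gi x)); rewrite ggVi giVg. Qed.

Lemma giM x y : gi (x ** y) = gi y ** gi x.
Proof. by apply: (@gopI (x ** y)); rewrite ggVi gopA gVK ggVi. Qed.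

Lemma gi1 : gi (ge : G) = ge.
Proof. by rewrite -[LHS]ge1g ggVi. Qed.

Definition gsimp := (gopA, @ge1g R S G, @gg1e R S G, @giVg R S G, @ggVi R S G,
  gKV, gVK, giI, giM, gi1).

Lemma dfun_gi : dfun S (gi : G -> G).
Proof.
have dm := dfun_gop G.
apply: (dfun_graph (Q := fun x y => x ** y = ge)); first by ddef.
by move=> x y; split=> [xy|<-]; [apply: (@gopI x); rewrite ggVi xy|rewrite ggVi].
Qed.

Lemma dfun_op T {dT : dspace S T} (f g : T -> G) : dfun S f -> dfun S g ->
  dfun S (fun t : T => f t ** g t).
Proof. exact: (dfun_comp2 (dfun_gop G)). Qed.

Lemma dfun_opV T {dT : dspace S T} (f : T -> G) : dfun S f -> dfun S (fun t : T => gi (f t)).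
Proof. exact: (dfun_comp dfun_gi). Qed.

Record dsubgroup (E : G -> Prop) : Prop := DSubgroup {
  dsub_def : dpred S E;
  dsub1 : E ge;
  dsubM : forall x y, E x -> E y -> E (x ** y);
  dsubV : forall x, E x -> E (gi x) }.

Definition normal (N : G -> Prop) : Prop := forall g h, N h -> N (g ** h ** gi g).

Definition hom_on (E : G -> Prop) (p : G -> R) : Prop :=
  forall x y, E x -> E y -> p (x ** y) = p x + p y.

Definition rhom (i : R -> G) : Prop := forall a b : R, i (a + b) = i a ** i b.

Lemma rhom0 i : rhom i -> i 0 = ge.
Proof. by move=> iD; apply: (@gopI (i 0)); rewrite -iD addr0 gg1e. Qed.

Lemma hom_on1 E p : dsubgroup E -> hom_on E p -> p ge = 0.
Proof. by move=> sE pM; apply: (addrI (p ge)); rewrite -pM ?gg1e ?addr0 //; apply: dsub1. Qed.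

Lemma hom_onV E p x : dsubgroup E -> hom_on E p -> E x -> p (gi x) = - p x.
Proof.
move=> sE pM Ex; apply: (addrI (p x)); rewrite -pM ?subrr ?ggVi ?(hom_on1 sE) //.
exact: dsubV.
Qed.

(* [E] is an extension of (R,+) by the image of [i], with projection [p]; the values of [p]
   outside [E] are irrelevant. *)
Record extension (E : G -> Prop) (i : R -> G) (p : G -> R) : Prop := Extension {
  x_sub : dsubgroup E;
  x_di : dfun S i;
  x_dp : dfun S p;
  x_ihom : rhom i;
  x_iinj : injective i;
  x_phom : hom_on E p;
  x_psurj : forall t, exists2 g, E g & p g = t;
  x_ker : forall g, (E g /\ p g = 0) <-> exists a, g = i a }.

End GroupTheory.

Ltac ddef_hook ::= lazymatch goal with
  | |- dfun _ (fun x => gop (@?f x) (@?g x)) => apply: (dfun_op (f := f) (g := g))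
  | |- dfun _ (fun x => gi (@?f x)) => apply: (dfun_opV (f := f))
  | |- dfun _ (gop ?c) => apply: (dfun_op (f := fun=> c) (g := fun x => x))
  | |- dfun _ gi => exact: dfun_gi
  | H : dfun _ (@expR _) |- dfun _ (fun x => expR (@?f x)) => apply: (dfun_comp (f := f) H)
  end.

(** * Definable homomorphisms to the line and characters *)

Section Homomorphisms.
Context {R : realType} {S : structure R}.
Hypothesis S_field : expands_real_field S.
Hypothesis S_ominimal : ominimal S.
Hypothesis dexp : dfun S (@expR R).
Context {G : dgroup S}.
Implicit Types g h : G.
Local Notation dpred := (dpred S).
Local Notation dfun := (dfun S).

Lemma definable_section (E : G -> Prop) (p : G -> R) : dpred E -> dfun p ->
  (forall t, exists2 g, E g & p g = t) ->
  exists2 s : R -> G, dfun s & forall t, E (s t) /\ p (s t) = t.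
Proof.
move=> dE dp pE; apply: (definable_choice S_field S_ominimal (P := fun t g => E g /\ p g = t)).
  by ddef.
by move=> t; have [g Eg pg] := pE t; exists g.
Qed.

(** On [E], f is constant on the fibres of p. Hence f composed with a definable section s of p is
    additive, although s need not be a homomorphism, and therefore linear. *)
Lemma hom_factor (E : G -> Prop) (p f : G -> R) : dsubgroup E -> dfun p -> dfun f ->
  hom_on E p -> hom_on E f -> (forall t, exists2 g, E g & p g = t) ->
  (forall g, E g -> p g = 0 -> f g = 0) -> exists k, forall g, E g -> f g = k * p g.
Proof.
move=> sE dp df pM fM pE kf; have dE := dsub_def sE.
have [s ds sP] := definable_section dE dp pE.
have fs g : E g -> f g = f (s (p g)).
  move=> Eg; have [Es ps] := sP (p g); apply/eqP; rewrite -subr_eq0; apply/eqP.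
  have Ev := dsubV sE Es.
  by rewrite -(hom_onV sE fM) // -fM // kf ?pM ?(hom_onV sE pM) ?ps ?subrr //; apply: dsubM.
have FD x y : f (s (x + y)) = f (s x) + f (s y).
  have [Ex px] := sP x; have [Ey py] := sP y.
  by rewrite -fM // [RHS]fs ?pM ?px ?py //; apply: dsubM.
have dF : dfun (fun x => f (s x)) by ddef.
exists (f (s 1)) => g Eg.
by rewrite fs // (dfun_additive_linear S_field S_ominimal dF FD).
Qed.

(* Modulo the kernel of [p] every element is a square. *)
Lemma mult_positive (E : G -> Prop) (p f : G -> R) : dsubgroup E -> 
  hom_on E p -> (forall x y, E x -> E y -> f (x ** y) = f x * f y) ->
  (forall t, exists2 g, E g & p g = t) ->
  (forall g, E g -> p g = 0 -> 0 < f g) -> forall g, E g -> 0 < f g.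
Proof.
move=> sE pM fM pE kf g Eg.
have [h Eh ph] := pE (p g / 2); have Eh2 := dsubM sE Eh Eh; have Evh := dsubV sE Eh2.
have f0 : 0 < f (g ** gi (h ** h)).
  apply: kf; first exact: dsubM.
  by rewrite pM // (hom_onV sE pM) // pM // ph; lra.
have gE : g = g ** gi (h ** h) ** (h ** h) by rewrite !gsimp.
have Egv := dsubM sE Eg Evh.
rewrite gE fM // pmulr_rgt0 // fM // -expr2 exprn_even_gt0 //=.
apply/eqP => fh; have : f ge = 0 by rewrite -(ggVi h) fM ?fh ?mul0r //; apply: dsubV.
move=> f1; have := kf _ (dsub1 sE) (hom_on1 sE pM); by rewrite f1 ltxx.
Qed.

Lemma dfun_ln T {dT : dspace S T} (f : T -> R) : dfun f -> dfun (fun t : T => ln (f t)).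
Proof.
apply: (dfun_comp (g := @ln R)).
apply: (dfun_graph (Q := fun x y => (0 < x /\ expR y = x) \/ (x <= 0 /\ y = 0))); first by ddef.
move=> x y; split=> [[[x0 <-]|[x0 ->]]|<-]; first exact: expRK.
  exact: ln0.
by have [x0|x0] := ltP 0 x; [left; rewrite lnK ?posrE|right; rewrite ln0].
Qed.

Lemma mult_exp (E : G -> Prop) (p f : G -> R) : dsubgroup E -> dfun p -> dfun f ->
  hom_on E p -> (forall x y, E x -> E y -> f (x ** y) = f x * f y) ->
  (forall t, exists2 g, E g & p g = t) ->
  (forall g, E g -> p g = 0 -> f g = 1) -> exists k, forall g, E g -> f g = expR (k * p g).
Proof.
move=> sE dp df pM fM pE kf.
have f0 : forall g, E g -> 0 < f g.
  by apply: (mult_positive sE pM fM pE) => g Eg pg; rewrite kf.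
have dl : dfun (fun g => ln (f g)) by apply: dfun_ln.
have lM : hom_on E (fun g => ln (f g)).
  by move=> x y Ex Ey; rewrite fM // lnM ?posrE //; apply: f0.
have [g Eg pg|k kP] := hom_factor sE dp dl pM lM pE; first by rewrite kf // ln1.
by exists k => g Eg; rewrite -kP // lnK // posrE f0.
Qed.

(** Makes the parameter x of an element [i x] a definable function of that element. Off the image of
    i the choice is pinned to 0. *)
Lemma definable_retraction (i : R -> G) : dfun i -> injective i ->
  exists2 l : G -> R, dfun l & cancel i l.
Proof.
move=> di iI.
have [||l dl lP] := definable_choice S_field S_ominimal
    (P := fun g x => g = i x \/ ((forall y, g <> i y) /\ x = 0)).
- by ddef.
- move=> g; have [[x ->]|ng] := pselect (exists x, g = i x); first by exists x; left.
  by exists 0; right; split=> // y gy; apply: ng; exists y.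
by exists l => // x; have [/iI //|[/(_ x)]] := lP (i x).
Qed.

(* Definable automorphisms of (R,+) are homotheties, so conjugation on the image of [i] is
   given by a multiplicative character. *)
Lemma conjugation_character (i : R -> G) (E : G -> Prop) : dfun i -> rhom i -> injective i ->
  (forall g x, E g -> exists y, g ** i x ** gi g = i y) ->
  exists2 f : G -> R, dfun f & forall g x, E g -> g ** i x = i (f g * x) ** g.
Proof.
move=> di iD iI nE; have [l dl lK] := definable_retraction di iI.
exists (fun g => l (g ** i 1 ** gi g)); first by ddef.
move=> g x Eg.
have lE y : g ** i y ** gi g = i (l (g ** i y ** gi g)).
  by have [z ->] := nE g y Eg; rewrite lK.
have dF : dfun (fun y => l (g ** i y ** gi g)) by ddef.
have FD y z : l (g ** i (y + z) ** gi g) = l (g ** i y ** gi g) + l (g ** i z ** gi g).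
  by apply: iI; rewrite [RHS]iD -!lE iD !gsimp.
have /= <- := dfun_additive_linear S_field S_ominimal dF FD x.
by rewrite -lE !gsimp.
Qed.

Lemma conjugation_characterM (i : R -> G) (E : G -> Prop) (f : G -> R) :
  dsubgroup E -> rhom i -> injective i ->
  (forall g x, E g -> g ** i x = i (f g * x) ** g) ->
  forall g h, E g -> E h -> f (g ** h) = f g * f h.
Proof.
move=> sE iD iI fP g h Eg Eh; apply: iI; apply: (@gIop _ _ _ (g ** h)).
rewrite -[f (g ** h)]mulr1 -fP; last exact: dsubM.
by rewrite gopA fP // mulr1 -!gopA fP // mulrA.
Qed.

End Homomorphisms.

(** * Splitting of extensions of a line by a line *)

Definition abelian_extensions_split (R : realType) (S : structure R) : Prop :=
  forall (G : group_data R)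
    (i : 'rV[R]_(gdim (add_group R 1)) -> 'rV[R]_(gdim G))
    (p : 'rV[R]_(gdim G) -> 'rV[R]_(gdim (add_group R 1))),
  abelian_group G ->
  definable_extension (N := add_group R 1) (Q := add_group R 1) S i p ->
  splits (Q := add_group R 1) S p.

Section SubgroupData.
Context {R : realType} {S : structure R} (G : dgroup S) (E : G -> Prop).
Hypothesis sE : dsubgroup E.

Definition dec (u : 'rV[R]_(ddim G)) : G := 
  if pselect (exists x : G, enc x = u) is left h then projT1 (cid h) else ge.

Lemma encK x : dec (enc x) = x.
Proof.
rewrite /dec; case: pselect => [h|[]]; last by exists x.
by case: cid => y /= /(@enc_inj _ _ G _).
Qed.

(** The way back to [group_data], the form in which the splitting hypothesis is stated; [dec] undoes
    the encoding and defaults to the unit off its image. *)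
Definition subgroup_data : group_data R :=
  @GroupData R (ddim G) (enc @` E) (fun u v => enc (dec u ** dec v)) (enc (ge : G))
    (fun u => enc (gi (dec u))).

Lemma subgroup_data_definable : definable_group S subgroup_data.
Proof.
have [dE E1 EM EV] := sE.
split; [split=> /=|exact: dE|].
- by exists ge.
- by move=> _ _ [x Ex <-] [y Ey <-]; rewrite !encK; exists (x ** y) => //; apply: EM.
- by move=> _ [x Ex <-]; rewrite encK; exists (gi x) => //; apply: EV.
- by move=> _ _ _ [x Ex <-] [y Ey <-] [z Ez <-]; rewrite !encK gopA.
- by move=> _ [x Ex <-]; rewrite !encK ge1g gg1e.
- by move=> _ [x Ex <-]; rewrite !encK giVg ggVi.
have de : dfun S (fun x : G => enc x) by apply: dfun_enc.
have d : definable S ((fun z : G * G => row_mx (row_mx (enc z.1) (enc z.2)) (enc (z.1 ** z.2)))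
    @` (fun z => E z.1 /\ E z.2)).
  apply: definable_range; first by ddef.
  apply: dfun_row_mx; first by apply: dfun_row_mx; apply: (dfun_comp de); ddef.
  by apply: (dfun_comp de); ddef.
apply: definable_ext d _ => u; split=> [[[x y] /= [Ex Ey] <-]|[_ [x Ex <-] [_ [y Ey <-] <-]]] /=.
  by exists (enc x); [exists x|exists (enc y); [exists y|rewrite !encK]].
by exists (x, y) => //=; rewrite !encK.
Qed.

End SubgroupData.

Section Splitting.
Context {R : realType} {S : structure R}.
Hypothesis S_field : expands_real_field S.
Hypothesis S_ominimal : ominimal S.
Hypothesis dexp : dfun S (@expR R).
Hypothesis S_splits : abelian_extensions_split S.
Local Notation dpred := (dpred S).
Local Notation dfun := (dfun S).
Context {G : dgroup S}.
Implicit Types g h : G.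

Local Notation encG := (@enc R S G (car_dspace G)).
Local Notation dG := (@ddim R S G (car_dspace G)).

Lemma split_abelian (E : G -> Prop) (i : R -> G) (p : G -> R) : extension E i p ->
  (forall g h, E g -> E h -> g ** h = h ** g) ->
  exists2 s : R -> G, dfun s & rhom s /\ forall t, E (s t) /\ p (s t) = t.
Proof.
case=> sE di dp iD iI pM pS ker EC; have [dE E1 EM EV] := sE.
pose sc (x : R) : 'rV[R]_1 := \row_(_ < 1) x.
have dsc : dfun sc by apply: dfun_const_row; ddef.
have de : dfun (fun x : G => encG x) by apply: dfun_enc.
pose i' (u : 'rV[R]_1) : 'rV[R]_dG := encG (i (u 0 0)).
pose p' (u : 'rV[R]_dG) : 'rV[R]_1 := sc (p (dec u)).
have di' : dfun i' by apply: (dfun_comp de); ddef.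
have dp' : definable_fun S (encG @` E) p'.
  apply/definable_funE.
  have d : dpred (fun z : 'rV[R]_dG * 'rV[R]_1 =>
      exists g, E g /\ (encG g = z.1 /\ sc (p g) = z.2)) by ddef.
  apply: dpred_ext d _ => -[u v] /=; split=> [[g [Eg [<- <-]]]|[[g Eg <-] <-]].
    by rewrite /p' encK; split=> //; exists g.
  by exists g; rewrite /p' encK.
have Ei x : E (i x) by have [_ /(_ (ex_intro _ x erefl))[]] := ker (i x).
have ext : definable_extension (G := subgroup_data E) (N := add_group R 1)
    (Q := add_group R 1) S i' p'.
  split.
  - exact: subgroup_data_definable.
  - split=> /=.
    + by move=> u _; exists (i (u 0 0)).
    + apply/definable_funE; apply: dpred_ext di' _ => z.
      by split=> [|[]].
    + by move=> u v _ _; rewrite /i' !encK mxE iD.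
  - move=> u v _ _ /(@enc_inj _ _ G _)/iI; exact: row1P.
  - split=> //= _ _ [g Eg <-] [h Eh <-].
    by rewrite /p' !encK pM //; apply: row1P; rewrite !mxE.
  - move=> u _ /=; have [g Eg pg] := pS (u 0 0).
    exists (encG g); first by exists g.
    by rewrite /p' encK pg; apply: row1P; rewrite mxE.
  - apply/seteqP; split=> [_ [u _ <-]|_ [[g Eg <-]]] /=.
      have /ker[Eg pg] : exists x, i (u 0 0) = i x by exists (u 0 0).
      split; first by exists (i (u 0 0)).
      by rewrite /p' /i' encK pg; apply: row1P; rewrite !mxE.
    rewrite /p' encK => /rowP/(_ 0); rewrite !mxE => pg.
    have /ker[x gx] : E g /\ p g = 0 by [].
    by exists (sc x) => //; rewrite /i' gx /sc mxE.
have ab : abelian_group (subgroup_data E).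
  by move=> _ _ [g Eg <-] [h Eh <-] /=; rewrite !encK EC.
have [s [[sE' ds sD] ps]] := S_splits ab ext.
have sP t : exists2 g, E g & encG g = s (sc t) by apply: sE'.
pose s' t := dec (s (sc t)).
have sE0 t : E (s' t) by rewrite /s'; have [g Eg <-] := sP t; rewrite encK.
have s'E t : encG (s' t) = s (sc t) by rewrite /s'; have [g Eg <-] := sP t; rewrite encK.
exists s'; last split.
- move/definable_funE: ds => ds.
  have d : dpred (fun z : R * G => (setT (sc z.1) /\ s (sc z.1) = encG z.2)).
    apply: (dpred_comp (f := fun z : R * G => (sc z.1, encG z.2)) ds).
    by apply: dfun_pair; ddef.
  apply: dpred_ext d _ => -[t g] /=; rewrite -s'E.
  by split=> [[_ /(@enc_inj _ _ G _)]|<-].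
- move=> x y; apply: (@enc_inj _ _ G _); rewrite s'E.
  have -> : sc (x + y) = sc x + sc y by apply: row1P; rewrite !mxE.
  by rewrite [LHS](sD _ _ I I) /= -!s'E !encK.
- move=> t; split=> //; have := ps (sc t) I; rewrite -s'E /p' encK.
  by move/rowP/(_ 0); rewrite !mxE.
Qed.

(** The commutator c(g,h), read off the kernel, is additive in each variable and trivial on the
    kernel. If h1 projects to 1, then c(.,h1) = k p with k = c(h1,h1) = 0; then c(g,.) is the
    multiple c(g,h1) = 0 of p. *)
Lemma central_extension_abelian (E : G -> Prop) (i : R -> G) (p : G -> R) :
  extension E i p -> (forall g x, E g -> g ** i x = i x ** g) ->
  forall g h, E g -> E h -> g ** h = h ** g.
Proof.
case=> sE di dp iD iI pM pS ker Ci; have [dE E1 EM EV] := sE.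
have [l dl lK] := definable_retraction S_field S_ominimal di iI.
have comE g h : E g -> E h -> g ** h = i (l (g ** h ** gi (h ** g))) ** (h ** g).
  move=> Eg Eh; have /ker[x gh] : E (g ** h ** gi (h ** g)) /\ p (g ** h ** gi (h ** g)) = 0.
    have Egh := EM _ _ Eg Eh; have Ehg := EM _ _ Eh Eg; have Ev := EV _ Ehg.
    by split; [exact: EM|rewrite pM // (hom_onV sE pM) // !pM // [p h + _]addrC subrr].
  by rewrite gh lK -gh !gsimp.
pose c g h := l (g ** h ** gi (h ** g)).
have cMl g g' h : E g -> E g' -> E h -> c (g ** g') h = c g h + c g' h.
  move=> Eg Eg' Eh; apply: iI; apply: (@gIop _ _ _ (h ** (g ** g'))).
  rewrite -comE //; last exact: EM.
  rewrite gopA (comE g' h) // -/(c g' h) -(gopA g) Ci // gopA -(gopA g) (comE g h) // -/(c g h).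
  by rewrite addrC iD !gsimp.
have cMr g h h' : E g -> E h -> E h' -> c g (h ** h') = c g h + c g h'.
  move=> Eg Eh Eh'; apply: iI; apply: (@gIop _ _ _ ((h ** h') ** g)).
  rewrite -comE //; last exact: EM.
  rewrite -gopA (comE g h) // -/(c g h) !gopA (comE g h') // -/(c g h').
  by rewrite -(gopA h) Ci // iD !gsimp.
have Ei x : E (i x) by have [_ /(_ (ex_intro _ x erefl))[]] := ker (i x).
have ck1 g h : E g -> E h -> p h = 0 -> c g h = 0.
  move=> Eg Eh ph; have /ker[x ->] : E h /\ p h = 0 by [].
  apply: iI; rewrite (rhom0 iD); apply: (@gIop _ _ _ (i x ** g)).
  by rewrite -comE // ge1g Ci.
have ck2 g h : E g -> E h -> p g = 0 -> c g h = 0.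
  move=> Eg Eh pg; have /ker[x ->] : E g /\ p g = 0 by [].
  apply: iI; rewrite (rhom0 iD); apply: (@gIop _ _ _ (h ** i x)).
  by rewrite -comE // ge1g Ci.
have [h1 Eh1 ph1] := pS 1.
have dc g : dfun (fun h => c g h) by rewrite /c; ddef.
have dc' h : dfun (fun g => c g h) by rewrite /c; ddef.
have hM : hom_on E (c^~ h1) by move=> x y Ex Ey; apply: cMl.
have [g Eg pg|k kP] := hom_factor S_field S_ominimal sE dp (dc' h1) pM hM pS.
  exact: ck2.
have k0 : k = 0.
  have := kP h1 Eh1; rewrite ph1 mulr1 => <-; apply: iI; rewrite (rhom0 iD).
  by apply: (@gIop _ _ _ (h1 ** h1)); rewrite -comE // ge1g.
move=> g h Eg Eh; rewrite comE // -/(c g h).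
suff -> : c g h = 0 by rewrite (rhom0 iD) ge1g.
have gM : hom_on E (c g) by move=> x y Ex Ey; apply: cMr.
have [h' Eh' ph'|k' k'P] := hom_factor S_field S_ominimal sE dp (dc g) pM gM pS.
  exact: ck1.
by rewrite k'P //; have := k'P h1 Eh1; rewrite ph1 mulr1 kP // k0 mul0r => <-; rewrite mul0r.
Qed.

Theorem extension_splits (E : G -> Prop) (i : R -> G) (p : G -> R) : extension E i p ->
  exists2 s : R -> G, dfun s & rhom s /\ forall t, E (s t) /\ p (s t) = t.
Proof.
move=> ext; have [sE di dp iD iI pM pS ker] := ext; have [dE E1 EM EV] := sE.
have Ei x : E (i x) /\ p (i x) = 0 by apply/ker; exists x.
have [g x Eg|f df fP] := conjugation_character S_field S_ominimal (E := E) di iD iI.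
  have [Eix pix] := Ei x; have Eg' := EV _ Eg; have Egi := EM _ _ Eg Eix.
  apply/ker; split; first exact: EM.
  by rewrite !pM // (hom_onV sE pM) // pix addr0 subrr.
have fM := conjugation_characterM sE iD iI fP.
have [g Eg pg|k kP] := mult_exp S_field S_ominimal dexp sE dp df pM fM pS.
  have /ker[x gx] : E g /\ p g = 0 by [].
  apply: iI; apply: (@gIop _ _ _ g); rewrite -[f g]mulr1 -fP //.
  by rewrite gx -!iD addrC.
have [k0|k0] := eqVneq k 0.
  apply: (split_abelian ext); apply: (central_extension_abelian ext) => g x Eg.
  by rewrite fP // kP // k0 mul0r expR0 mul1r.
(* The centralizer of [h] is a complement since [h] acts on the kernel without fixed points. *)
have [h Eh ph] := pS 1.
have fh : f h - 1 != 0 by rewrite subr_eq0 kP // ph mulr1 -expR0 (inj_eq (@expR_inj R)).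
have Ex t : exists2 g, E g /\ g ** h = h ** g & p g = t.
  have [g Eg pg] := pS t; have Evh := EV _ Eh; have Evg := EV _ Eg.
  have /ker[z gz] : E (g ** h ** gi g ** gi h) /\ p (g ** h ** gi g ** gi h) = 0.
    have E1' := EM _ _ Eg Eh; have E2 := EM _ _ E1' Evg; have E3 := EM _ _ E2 Evh.
    by split=> //; rewrite !pM // !(hom_onV sE pM) //; lra.
  have gh : g ** h = i z ** h ** g by rewrite -gz !gsimp.
  (* Moving h across [i x ** g] from both sides leaves the equation x + z = f(h) x for this element
     to centralize h. *)
  pose x := z / (f h - 1); have [Eix pix] := Ei x.
  exists (i x ** g); last by rewrite pM // pix add0r.
  split; first exact: EM.
  rewrite gopA gh -[RHS]gopA fP // -!gopA -!iD; congr (i _ ** _ ** _).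
  by rewrite /x; field.
(* Two centralizing elements over the same point differ by some [i x] commuting with h, which forces
   x = 0. This uniqueness makes the chosen section a homomorphism. *)
have uniq g g' : E g -> E g' -> g ** h = h ** g -> g' ** h = h ** g' -> p g = p g' -> g = g'.
  move=> Eg Eg' gh gh' pgg; have Evg := EV _ Eg'.
  have /ker[x gx] : E (g ** gi g') /\ p (g ** gi g') = 0.
    by split; [exact: EM|rewrite pM // (hom_onV sE pM) // pgg subrr].
  have xh : h ** i x = i x ** h.
    rewrite -gx -gopA -gh !gopA; congr (g ** _).
    by apply: (@gopI _ _ _ g'); rewrite -gopA gh' !gsimp.
  move: xh; rewrite fP // => /(@gIop _ _ _ h)/iI /eqP.
  rewrite -subr_eq0 -[X in _ - X]mul1r -mulrBl mulf_eq0 (negPf fh) /= => /eqP x0.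
  move: gx; rewrite x0 (rhom0 iD) => gg.
  by rewrite -[g]gg1e -(giVg g') -gopA gg ge1g.
have [||s ds sP] := definable_choice S_field S_ominimal
    (P := fun t g => (E g /\ g ** h = h ** g) /\ p g = t).
- by ddef.
- by move=> t; have [g Eg pg] := Ex t; exists g.
exists s => //; split=> [x y|t]; last by have [[]] := sP t.
have [[E0 h0] p0] := sP (x + y); have [[E2 h2] p2] := sP x; have [[E3 h3] p3] := sP y.
apply: uniq => //; [exact: EM| |by rewrite pM // p0 p2 p3].
by rewrite gopA h3 -gopA h2 gopA.
Qed.

End Splitting.

(** * Coordinates on an iterated extension of lines *)

Section Quotients.
Context {R : realType} {S : structure R} (G : dgroup S).
Context (T : Type) {dT : dspace S T} (q : G -> T) (sec : T -> G).
Hypotheses (dq : dfun S q) (dsec : dfun S sec) (secK : cancel sec q).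
Hypothesis qM : forall g g' h h', q g = q g' -> q h = q h' -> q (g ** h) = q (g' ** h').

Let qL g h : q (sec (q g) ** h) = q (g ** h).
Proof. by apply: qM; rewrite ?secK. Qed.

Let qR g h : q (g ** sec (q h)) = q (g ** h).
Proof. by apply: qM; rewrite ?secK. Qed.

(** The classes of q form the quotient and [sec] picks representatives; by [qM] the class of a
    product does not depend on them, so the transversal need not be a subgroup. *)
Definition quotient_group : dgroup S.
Proof.
refine (@DGroup R S T dT (fun u v => q (sec u ** sec v)) (q ge) (fun u => q (gi (sec u)))
  _ _ _ _ _ _).
- by move=> u v w; rewrite qL qR gopA.
- by move=> u; rewrite qL ge1g secK.
- by move=> u; rewrite qR gg1e secK.
- by move=> u; rewrite qL giVg.
- by move=> u; rewrite qR ggVi.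
- by ddef.
Defined.

Lemma quotient_mapM g h : q (g ** h) = @gop R S quotient_group (q g) (q h).
Proof. by rewrite /= qL qR. Qed.

End Quotients.

Section Structure.
Context {R : realType} {S : structure R}.
Hypothesis S_field : expands_real_field S.
Hypothesis S_ominimal : ominimal S.
Hypothesis dexp : dfun S (@expR R).
Hypothesis S_splits : abelian_extensions_split S.
Local Notation dpred := (dpred S).
Local Notation dfun := (dfun S).
Local Notation R3 := (R * R * R)%type.

(** The bijection transports the group laws, so a coordinate system is described by its
    multiplication alone. *)
Definition coordinatized (G : dgroup S) (op : R3 -> R3 -> R3) : Prop :=
  exists psi : R3 -> G, [/\ dfun psi, injective psi, forall g, exists v, psi v = g &
    forall v w, psi (op v w) = psi v ** psi w].

Lemma coordinatized_reparam (G : dgroup S) (op op' : R3 -> R3 -> R3) (th th' : R3 -> R3) :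
  dfun th -> cancel th th' -> cancel th' th ->
  (forall v w, th (op' v w) = op (th v) (th w)) -> coordinatized G op -> coordinatized G op'.
Proof.
move=> dth thK thK' thM [psi [dpsi psiI psiS psiM]]; exists (fun v => psi (th v)); split.
- by ddef.
- by move=> v w /psiI/(can_inj thK).
- by move=> g; have [v <-] := psiS g; exists (th' v); rewrite thK'.
- by move=> v w; rewrite thM psiM.
Qed.

(** The last coordinate t acts on the plane by the matrix [[e^(at), u(t)], [0, e^(bt)]]. The
    constraint on u is recovered later from associativity. *)
Definition semidirect_op (a b : R) (u : R -> R) (v w : R3) : R3 :=
  (v.1.1 + expR (a * v.2) * w.1.1 + u v.2 * w.1.2, v.1.2 + expR (b * v.2) * w.1.2, v.2 + w.2).

Definition affine_op (v w : R3) : R3 :=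
  (v.1.1 + expR v.1.2 * w.1.1, v.1.2 + w.1.2, v.2 + w.2).

Context {G : dgroup S} (i : R -> G) (H2 : G -> Prop) (r2 r3 : G -> R).
Implicit Types g h : G.
Hypothesis ext2 : extension H2 i r2.
Hypothesis dr3 : dfun r3.
Hypothesis r3M : forall g h, r3 (g ** h) = r3 g + r3 h.
Hypothesis r3S : forall t, exists g, r3 g = t.
Hypothesis r3K : forall g, r3 g = 0 <-> H2 g.
Hypothesis iN : forall g x, exists y, g ** i x ** gi g = i y.

Let fullG (g : G) := True.

Let fullP : dsubgroup fullG.
Proof. by split=> //; apply: dpred_True. Qed.

Let r3F : hom_on fullG r3. Proof. by move=> *; apply: r3M. Qed.
Let r3FS t : exists2 g, fullG g & r3 g = t.
Proof. by have [g <-] := r3S t; exists g. Qed.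

Let r31 : r3 ge = 0. Proof. exact: (hom_on1 fullP r3F). Qed.
Let r3V g : r3 (gi g) = - r3 g. Proof. exact: (hom_onV fullP r3F). Qed.

Let di : dfun i. Proof. by case: ext2. Qed.
Let dr2 : dfun r2. Proof. by case: ext2. Qed.
Let iD : rhom i. Proof. by case: ext2. Qed.
Let iI : injective i. Proof. by case: ext2. Qed.
Let H2sub : dsubgroup H2. Proof. by case: ext2. Qed.
Let dH2 : dpred H2. Proof. exact: dsub_def. Qed.
Let r2M : hom_on H2 r2. Proof. by case: ext2. Qed.
Let r2S t : exists2 g, H2 g & r2 g = t. Proof. by case: ext2. Qed.
Let r2K g : (H2 g /\ r2 g = 0) <-> exists a, g = i a. Proof. by case: ext2. Qed.
Let H2M g h : H2 g -> H2 h -> H2 (g ** h). Proof. exact: dsubM. Qed.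
Let H2V g : H2 g -> H2 (gi g). Proof. exact: dsubV. Qed.
Let r2V g : H2 g -> r2 (gi g) = - r2 g. Proof. exact: hom_onV. Qed.
Let H2i x : H2 (i x). Proof. by have [_ /(_ (ex_intro _ x erefl))[]] := r2K (i x). Qed.
Let r2i x : r2 (i x) = 0. Proof. by have [_ /(_ (ex_intro _ x erefl))[]] := r2K (i x). Qed.
Let H2N g h : H2 h -> H2 (g ** h ** gi g).
Proof. by move=> /r3K rh; apply/r3K; rewrite !r3M r3V rh addr0 subrr. Qed.

Lemma split_H2 : exists2 j : R -> G, dfun j & rhom j /\ forall y, H2 (j y) /\ r2 (j y) = y.
Proof. exact: (extension_splits S_field S_ominimal dexp S_splits ext2). Qed.

(** Positivity of the character climbs the chain: it is 1 on the image of i, which is abelian, then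
    positive on [H2] and on G by divisibility of the lines H2/H1 and G/H2. *)
Lemma character1 : exists2 al : G -> R, dfun al &
  (forall g h, al (g ** h) = al g + al h) /\ forall g x, g ** i x = i (expR (al g) * x) ** g.
Proof.
have [g x _|f df fP] := conjugation_character S_field S_ominimal (E := fullG) di iD iI.
  exact: iN.
have fM := conjugation_characterM fullP iD iI fP.
have f0 g : 0 < f g.
  apply: (mult_positive fullP r3F fM r3FS) => // h _ /r3K Hh.
  apply: (mult_positive H2sub r2M _ r2S) Hh => [g1 g2 _ _|g1 Hg rg]; first exact: fM.
  have /r2K[x ->] : H2 g1 /\ r2 g1 = 0 by [].
  suff -> : f (i x) = 1 by [].
  apply: iI; apply: (@gIop _ _ _ (i x)); rewrite -[f (i x)]mulr1 -fP //.
  by rewrite -!iD addrC.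
exists (fun g => ln (f g)); first exact: dfun_ln.
split=> [g h|g x]; last by rewrite lnK ?posrE // fP.
by rewrite fM // lnM ?posrE.
Qed.

(** This is the action on H2/H1, seen through [r2]. It is multiplicative because the discrepancy
    between the conjugate of [j 1] by h and [j (mu h)] lies in the image of i, which conjugation
    preserves and [r2] kills. *)
Lemma character2 (j : R -> G) : dfun j -> rhom j -> (forall y, H2 (j y) /\ r2 (j y) = y) ->
  exists2 mu : G -> R, dfun mu & (forall g h, mu (g ** h) = mu g * mu h) /\
    forall g y, r2 (g ** j y ** gi g) = mu g * y.
Proof.
move=> dj jD jP.
have Hj y : H2 (j y) by case: (jP y).
have rj y : r2 (j y) = y by case: (jP y).
pose mu g := r2 (g ** j 1 ** gi g).
have muP g y : r2 (g ** j y ** gi g) = mu g * y.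
  have dF : dfun (fun y => r2 (g ** j y ** gi g)) by ddef.
  apply: (dfun_additive_linear S_field S_ominimal dF) => x z.
  by rewrite -r2M; [rewrite jD !gsimp|exact: H2N|exact: H2N].
exists mu; first by rewrite /mu; ddef.
split=> // g h; rewrite {1}/mu.
have [x hx] : exists x, h ** j 1 ** gi h = i x ** j (mu h).
  have Hh : H2 (h ** j 1 ** gi h) by apply: H2N.
  have Hv := H2V (Hj (mu h)).
  have /r2K[x hx] : H2 (h ** j 1 ** gi h ** gi (j (mu h))) /\
      r2 (h ** j 1 ** gi h ** gi (j (mu h))) = 0.
    by split; [exact: H2M|rewrite r2M // r2V // rj subrr].
  by exists x; rewrite -hx !gsimp.
have -> : g ** h ** j 1 ** gi (g ** h) = (g ** i x ** gi g) ** (g ** j (mu h) ** gi g).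
  transitivity (g ** (h ** j 1 ** gi h) ** gi g); first by rewrite !gsimp.
  by rewrite hx !gsimp.
have [z ->] := iN g x.
by rewrite r2M ?r2i ?add0r ?muP //; apply: H2N.
Qed.

Lemma H2E (j : R -> G) h : (forall y, H2 (j y)) -> (forall y, r2 (j y) = y) ->
  H2 h -> exists x, h = i x ** j (r2 h).
Proof.
move=> Hj rj Hh; have Hv := H2V (Hj (r2 h)).
have /r2K[x hx] : H2 (h ** gi (j (r2 h))) /\ r2 (h ** gi (j (r2 h))) = 0.
  by split; [exact: H2M|rewrite r2M // r2V // rj subrr].
by exists x; rewrite -hx !gsimp.
Qed.

(* [G / H1], realized on R^2 by means of a definable section, splits over [H2 / H1]; then so does
   the preimage of its complement over [H1]. *)
Lemma section_r3 : exists2 s : R -> G, dfun s & rhom s /\ forall t, r3 (s t) = t.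
Proof.
have [j dj [jD jP]] := split_H2.
have Hj y : H2 (j y) by case: (jP y).
have rj y : r2 (j y) = y by case: (jP y).
have [sg dsg sgP] : exists2 sg : R -> G, dfun sg & forall t, fullG (sg t) /\ r3 (sg t) = t.
  by apply: definable_section => //; apply: dsub_def fullP.
have r3sg t : r3 (sg t) = t by case: (sgP t).
(* Coordinates on G/H1: the fibres of q are the cosets of the image of i. [sg] is a definable
   section only, so the H2-part of g is taken relative to it. *)
pose q g : R * R := (r2 (g ** gi (sg (r3 g))), r3 g).
pose sec (u : R * R) : G := j u.1 ** sg u.2.
have dq : dfun q by rewrite /q; ddef.
have dsec : dfun sec by rewrite /sec; ddef.
have r3H g : H2 g -> r3 g = 0 by move/r3K.
have secE y t : q (j y ** sg t) = (y, t).
  by rewrite /q r3M r3H // add0r r3sg !gsimp rj.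
have secK : cancel sec q by case=> y t; rewrite /sec secE.
have Hq g : H2 (g ** gi (sg (r3 g))) by apply/r3K; rewrite r3M r3V r3sg subrr.
have qP g g' : q g = q g' <-> exists x, g = i x ** g'.
  split=> [[e2 e3]|[x ->]].
    have Hg := Hq g; have Hg' := Hq g'; have Hv := H2V Hg'.
    have /r2K[x gx] : H2 (g ** gi (sg (r3 g)) ** gi (g' ** gi (sg (r3 g')))) /\
        r2 (g ** gi (sg (r3 g)) ** gi (g' ** gi (sg (r3 g')))) = 0.
      by split; [exact: H2M|rewrite r2M // r2V // e2 subrr].
    by exists x; rewrite -gx e3 !gsimp.
  by rewrite /q r3M (r3H (i x)) // add0r gopA r2M // r2i add0r.
have iS g x : exists y, g ** i x = i y ** g.
  by have [y gy] := iN g x; exists y; rewrite -gy !gsimp.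
have qM g g' h h' : q g = q g' -> q h = q h' -> q (g ** h) = q (g' ** h').
  move=> /qP[x ->] /qP[y ->]; apply/qP; have [z gz] := iS g' y.
  by exists (x + z); rewrite iD gopA -(gopA g') gz !gsimp.
pose Q := quotient_group dq dsec secK qM.
have qQ g h : q (g ** h) = @gop R S Q (q g) (q h) := quotient_mapM dq dsec secK qM g h.
have extQ : @extension R S Q (fun _ => True) (fun y => q (j y)) (fun u => u.2).
  split.
  - by split=> //; apply: dpred_True.
  - by apply: (dfun_comp (g := q)); ddef.
  - by apply: (dfun_snd (f := fun u : R * R => u)); ddef.
  - by move=> x y; rewrite jD qQ.
  - move=> x y /qP[z /(congr1 r2)]; rewrite r2M // r2i add0r !rj.
  - by [].
  - by move=> u v _ _; rewrite -(secK u) -(secK v) -qQ /= r3M.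
  - by move=> t; exists (q (sg t)) => //=; apply: r3sg.
  - move=> u; split=> [[_ u0]|[y ->]]; last by split=> //=; apply: r3H.
    have Hu : H2 (sec u) by apply/r3K; rewrite /sec r3M r3H // add0r r3sg.
    exists (r2 (sec u)); rewrite -{1}(secK u); apply/qP; have [x hx] := H2E Hj rj Hu.
    by exists x.
have [sQ dsQ [sQD sQP]] := extension_splits S_field S_ominimal dexp S_splits extQ.
have dsQ' : dfun (sQ : R -> R * R) := dsQ.
have q1 : q ge = ge :> Q by [].
have sQ0 : sQ 0 = q ge by rewrite (rhom0 sQD).
(* The preimage in G of the complement [sQ]: the second coordinate of [sQ t] is t, so membership is
   tested at t = [r3 g]. *)
pose M g := q g = sQ (r3 g).
have sM : dsubgroup M.
  split.
  - by rewrite /M; ddef.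
  - by rewrite /M r31 sQ0.
  - by move=> g h Mg Mh; rewrite /M qQ r3M sQD Mg Mh.
  - move=> g Mg; apply: (@gopI R S Q (q g)); rewrite -qQ ggVi Mg r3V -sQD subrr.
    by rewrite sQ0.
have extM : extension M i r3.
  split=> //.
  - move=> t; have [_ st] := sQP t; exists (sec (sQ t)).
      by rewrite /M secK /sec r3M r3H // add0r r3sg st.
    by rewrite /sec r3M r3H // add0r r3sg st.
  - move=> g; split=> [[Mg g0]|[x ->]].
      have /qP[x gx] : q g = q ge by rewrite Mg g0 sQ0.
      by exists x; rewrite gx gg1e.
    have ix : r3 (i x) = 0 by apply: r3H.
    by split=> //; rewrite /M ix sQ0; apply/qP; exists x; rewrite gg1e.
have [s ds [sD sP]] := extension_splits S_field S_ominimal dexp S_splits extM.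
by exists s => //; split=> // t; case: (sP t).
Qed.

Lemma triangular_coordinates (j s : R -> G) (op : R3 -> R3 -> R3) :
  dfun j -> dfun s -> rhom j -> rhom s -> (forall y, H2 (j y) /\ r2 (j y) = y) ->
  (forall t, r3 (s t) = t) ->
  (forall v w : R3, i (op v w).1.1 ** j (op v w).1.2 ** s (op v w).2 =
     i v.1.1 ** j v.1.2 ** s v.2 ** (i w.1.1 ** j w.1.2 ** s w.2)) ->
  coordinatized G op.
Proof.
move=> dj ds jD sD jP r3s opE.
have Hj y : H2 (j y) by case: (jP y).
have rj y : r2 (j y) = y by case: (jP y).
have r3H g : H2 g -> r3 g = 0 by move/r3K.
have Hij x y : H2 (i x ** j y) by apply: H2M.
exists (fun v => i v.1.1 ** j v.1.2 ** s v.2); split=> //.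
- by ddef.
- move=> [[x y] t] [[x' y'] t'] /= e.
  have /= := congr1 r3 e; rewrite !r3M !r3s !(r3H (i _)) // !(r3H (j _)) // !add0r => tt'.
  move: e; rewrite tt' => /gIop e.
  have := congr1 r2 e; rewrite !r2M // !r2i !rj !add0r => yy'.
  by move: e; rewrite yy' => /gIop/iI ->.
- move=> g; have Hg : H2 (g ** gi (s (r3 g))) by apply/r3K; rewrite r3M r3V r3s subrr.
  have [x gx] := H2E Hj rj Hg; exists (x, r2 (g ** gi (s (r3 g))), r3 g).
  by rewrite /= -gx !gsimp.
Qed.

Lemma coordinates_unipotent (j s : R -> G) (al mu : G -> R) :
  dfun j -> dfun s -> rhom j -> rhom s -> (forall y, H2 (j y) /\ r2 (j y) = y) ->
  (forall t, r3 (s t) = t) -> dfun al -> dfun mu ->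
  (forall g h, al (g ** h) = al g + al h) ->
  (forall g x, g ** i x = i (expR (al g) * x) ** g) ->
  (forall g h, mu (g ** h) = mu g * mu h) ->
  (forall g y, r2 (g ** j y ** gi g) = mu g * y) ->
  (forall y, al (j y) = 0) ->
  exists a b u, dfun u /\ coordinatized G (semidirect_op a b u).
Proof.
move=> dj ds jD sD jP r3s dal dmu alM alP muM muP alj.
have Hj y : H2 (j y) by case: (jP y).
have rj y : r2 (j y) = y by case: (jP y).
have ijC x y : j y ** i x = i x ** j y by rewrite alP alj expR0 mul1r.
have ali x : al (i x) = 0.
  apply: expR_inj; rewrite expR0; apply: iI; apply: (@gIop _ _ _ (i x)).
  by rewrite -[expR _]mulr1 -alP -!iD addrC.
have H2D h : H2 h -> exists x, h = i x ** j (r2 h) by apply: H2E.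
have [h _ /r3K Hh|a aP] := hom_factor S_field S_ominimal fullP dr3 dal r3F
    (fun g h _ _ => alM g h) r3FS.
  by have [x ->] := H2D h Hh; rewrite alM ali alj addr0.
have [h _ /r3K Hh|b bP] := mult_exp S_field S_ominimal dexp fullP dr3 dmu r3F
    (fun g h _ _ => muM g h) r3FS.
  (* Here i and j commute, so [H2] is abelian and acts trivially on H2/H1. *)
  have [x hx] := H2D h Hh; have := muP h 1; rewrite mulr1 => <-.
  have -> : h ** j 1 = j 1 ** h.
    by rewrite hx gopA -jD addrC jD -!gopA ijC.
  by rewrite gopA ggVi gg1e rj.
have [l dl lK] := definable_retraction S_field S_ominimal di iI.
(* The component along i of the conjugate of [j y] by [s t]. Since i and j commute it is additive in
   y, hence equal to [U t 1 * y], and [U t 1] is the off-diagonal entry u(t). *)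
pose U t y := l (s t ** j y ** gi (s t) ** gi (j (expR (b * t) * y))).
have UE t y : s t ** j y = i (U t y) ** j (expR (b * t) * y) ** s t.
  have Hst : H2 (s t ** j y ** gi (s t)) by apply: H2N.
  have [x] := H2D _ Hst; rewrite muP bP // r3s => e.
  have -> : U t y = x by rewrite /U e !gsimp lK.
  by rewrite -e !gsimp.
have UD t y z : U t (y + z) = U t y + U t z.
  apply: iI; apply: (@gIop _ _ _ (j (expR (b * t) * (y + z)) ** s t)).
  rewrite -[LHS]gopA -UE jD -gopA UE [_ ** j z]gopA UE mulrDr jD iD !gopA.
  by rewrite -(gopA _ (i (U t z))) ijC !gopA.
have UM t y : U t y = U t 1 * y.
  have dU : dfun (fun y => U t y) by rewrite /U; ddef.
  exact: (dfun_additive_linear S_field S_ominimal dU).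
exists a, b, (fun t => U t 1); split; first by rewrite /U; ddef.
apply: (triangular_coordinates dj ds) => // -[[x y] t] [[x' y'] t'] /=.
have ijCA x1 y1 g : j y1 ** (i x1 ** g) = i x1 ** (j y1 ** g) by rewrite -gopA ijC gopA.
transitivity (i x ** j y ** (s t ** i x') ** j y' ** s t'); last by rewrite !gsimp.
rewrite alP aP // r3s.
transitivity (i x ** j y ** i (expR (a * t) * x') ** (s t ** j y') ** s t'); last by rewrite !gsimp.
by rewrite UE (UM t y') !iD jD sD !gsimp !ijCA.
Qed.

(* When [H2] is not abelian its conjugation action on [H2 / H1] must be trivial, and the
   centralizer of [j 1] is a complement of the image of [i]. *)
Lemma coordinates_affine (j : R -> G) (al mu : G -> R) :
  dfun j -> rhom j -> (forall y, H2 (j y) /\ r2 (j y) = y) -> dfun al ->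
  (forall g h, al (g ** h) = al g + al h) ->
  (forall g x, g ** i x = i (expR (al g) * x) ** g) ->
  (forall g y, r2 (g ** j y ** gi g) = mu g * y) ->
  al (j 1) != 0 -> coordinatized G affine_op.
Proof.
move=> dj jD jP dal alM alP muP; set a := al (j 1) => a0.
have Hj y : H2 (j y) by case: (jP y).
have rj y : r2 (j y) = y by case: (jP y).
have alF : hom_on fullG al by move=> g h _ _; apply: alM.
have alV g : al (gi g) = - al g by apply: (hom_onV fullP alF).
have ali x : al (i x) = 0.
  apply: expR_inj; rewrite expR0; apply: iI; apply: (@gIop _ _ _ (i x)).
  by rewrite -[expR _]mulr1 -alP -!iD addrC.
have H2D h : H2 h -> exists x, h = i x ** j (r2 h) by apply: H2E.
have alj y : al (j y) = a * y.
  have dF : dfun (fun y => al (j y)) by ddef.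
  by apply: (dfun_additive_linear S_field S_ominimal dF) => x z; rewrite jD alM.
(* [al] is invariant under conjugation, vanishes on the image of i and equals a y on [j y]; applied
   to the conjugate of [j 1] by g it gives a mu(g) = a. *)
have mu1 g : mu g = 1.
  have [x] := H2D _ (H2N g (Hj 1)); rewrite muP mulr1 => /(congr1 al).
  rewrite !alM ali alj alV (addrC (al g)) addrK alj mulr1 add0r => /eqP.
  by rewrite -{1}[a]mulr1 (inj_eq (mulfI a0)) => /eqP.
have conjE g y : exists z, g ** j y = i z ** j y ** g.
  have [x] := H2D _ (H2N g (Hj y)); rewrite muP mu1 mul1r => e.
  by exists x; rewrite -e !gsimp.
pose C g := g ** j 1 = j 1 ** g.
have dC : dpred C by rewrite /C; ddef.
have sC : dsubgroup C.
  split=> //; rewrite /C.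
  - by rewrite ge1g gg1e.
  - by move=> g h Cg Ch; rewrite gopA Ch -gopA Cg gopA.
  - by move=> g Cg; apply: (@gopI _ _ _ g); rewrite gVK -gopA Cg gopA ggVi gg1e.
have Cj y : C (j y) by rewrite /C -!jD addrC.
have ea : expR a - 1 != 0 by rewrite subr_eq0 -expR0 (inj_eq (@expR_inj R)).
have Cex g : exists x, C (i x ** g).
  (* The witness solves x + z = e^a x, the condition for [i x ** g] to commute with [j 1]. *)
  have [z gz] := conjE g 1; exists (z / (expR a - 1)).
  rewrite /C !gopA gz -[RHS]gopA alP -/a -!gopA -!iD; congr (i _ ** _ ** _).
  by field.
have Ci x : C (i x) -> x = 0.
  rewrite /C alP -/a => /(@gIop _ _ _ _ _)/iI/eqP.
  by rewrite -subr_eq0 -{1}[x]mul1r -mulrBl mulf_eq0 -oppr_eq0 opprB (negPf ea) => /eqP.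
(* The centralizer meets [H2] exactly in the image of j and meets every coset of the image of i, so
   it is an extension of lines with projection [r3]. *)
have extC : extension C j r3.
  split=> //.
  - by move=> x y /(congr1 r2); rewrite !rj.
  - move=> t; have [g gt] := r3S t; have [x Cx] := Cex g.
    by exists (i x ** g) => //; rewrite r3M gt (_ : r3 (i x) = 0) ?add0r //; apply/r3K.
  - move=> g; split=> [[Cg /r3K Hg]|[y ->]]; last by split=> //; apply/r3K.
    have [x gx] := H2D g Hg; exists (r2 g); rewrite {1}gx (Ci x) ?(rhom0 iD) ?ge1g //.
    have -> : i x = g ** gi (j (r2 g)) by rewrite {1}gx !gsimp.
    exact: (@dsubM _ _ _ _ sC _ _ Cg (dsubV sC (Cj _))).
have [s ds [sD sP]] := extension_splits S_field S_ominimal dexp S_splits extC.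
have r3s t : r3 (s t) = t by case: (sP t).
have Cs t : C (s t) by case: (sP t).
have sj t y : s t ** j y = j y ** s t.
  have [z e] := conjE (s t) y; rewrite e (Ci z) ?(rhom0 iD) ?ge1g //.
  have -> : i z = s t ** j y ** gi (s t) ** gi (j y) by rewrite e !gsimp.
  have Cv := dsubV sC (Cs t); have Cvj := dsubV sC (Cj y).
  by do 3![apply: (dsubM sC) => //].
have dals : dfun (fun t => al (s t)) by ddef.
have als t : al (s t) = al (s 1) * t.
  by apply: (dfun_additive_linear S_field S_ominimal dals) => x z; rewrite sD alM.
set a2 := al (s 1) in als.
(* The factor along j is chosen to cancel [al (s t) = a2 * t], so that [s'] commutes with i as well
   as with j and spans a direct factor. *)
pose s' t := s t ** j (- (a^-1 * a2 * t)).
have s'D : rhom s'.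
  move=> t t'; rewrite /s' sD mulrDr opprD jD !gsimp; congr (_ ** _).
  by rewrite -gopA sj gopA.
have ds' : dfun s' by rewrite /s'; ddef.
have r3s' t : r3 (s' t) = t by rewrite r3M r3s (_ : r3 (j _) = 0) ?addr0 //; exact/r3K.
have s'i t x1 g : s' t ** (i x1 ** g) = i x1 ** (s' t ** g).
  rewrite -gopA alP /s' alM alj als (_ : _ + _ = 0) ?expR0 ?mul1r ?gopA //.
  by rewrite mulrN !mulrA divff // mul1r subrr.
have s'j t y1 g : s' t ** (j y1 ** g) = j y1 ** (s' t ** g).
  by rewrite /s' !gopA -!(gopA (j (- _))) -jD addrC jD !gopA -(gopA (s t)) sj !gopA.
have ji y1 x1 g : j y1 ** (i x1 ** g) = i (expR (a * y1) * x1) ** (j y1 ** g).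
  by rewrite -gopA alP alj gopA.
clearbody s'.
have aff : coordinatized G (fun v w =>
    (v.1.1 + expR (a * v.1.2) * w.1.1, v.1.2 + w.1.2, v.2 + w.2)).
  apply: (triangular_coordinates (s := s') dj) => // -[[x y] t] [[x' y'] t'] /=.
  by rewrite iD jD s'D !gopA s'i s'j ji.
apply: (coordinatized_reparam (th := fun v => (v.1.1, a^-1 * v.1.2, v.2))
  (th' := fun v => (v.1.1, a * v.1.2, v.2))) aff.
- by ddef.
- by move=> [[x y] t] /=; rewrite mulrA divff // mul1r.
- by move=> [[x y] t] /=; rewrite mulrA mulVf // mul1r.
- by move=> [[x y] t] [[x' y'] t'] /=; rewrite mulrDr mulrA divff // mul1r.
Qed.

Theorem coordinates_of_chain :
  coordinatized G affine_op \/
  exists a b u, dfun u /\ coordinatized G (semidirect_op a b u).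
Proof.
have [j dj [jD jP]] := split_H2.
have [s ds [sD r3s]] := section_r3.
have [al dal [alM alP]] := character1.
have [mu dmu [muM muP]] := character2 dj jD jP.
have [alj0|alj0] := eqVneq (al (j 1)) 0; last first.
  by left; apply: (coordinates_affine dj jD jP dal alM alP muP alj0).
right; apply: (coordinates_unipotent dj ds jD sD jP r3s dal dmu alM alP muM muP) => y.
have dF : dfun (fun y => al (j y)) by ddef.
rewrite (dfun_additive_linear S_field S_ominimal dF) ?alj0 ?mul0r // => x z.
by rewrite jD alM.
Qed.

End Structure.

(** * Normal forms of the triangular actions *)

Section Classification.
Context {R : realType} {S : structure R}.
Hypothesis S_field : expands_real_field S.
Hypothesis S_ominimal : ominimal S.
Hypothesis dexp : dfun S (@expR R).
Local Notation dpred := (dpred S).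
Local Notation dfun := (dfun S).
Local Notation R3 := (R * R * R)%type.

Definition add_op (v w : R3) : R3 := (v.1.1 + w.1.1, v.1.2 + w.1.2, v.2 + w.2).

Definition heis_op (v w : R3) : R3 := (v.1.1 + w.1.1, v.1.2 + w.1.2,
  v.2 + w.2 + 2^-1 * (v.1.1 * w.1.2 - w.1.1 * v.1.2)).

Definition G3_op (v w : R3) : R3 :=
  (v.1.1 + w.1.1 * expR v.2 + w.1.2 * v.2 * expR v.2, v.1.2 + w.1.2 * expR v.2, v.2 + w.2).

Definition tau_op (c : R) (v w : R3) : R3 :=
  (v.1.1 + expR (c * v.2) * w.1.1, v.1.2 + expR v.2 * w.1.2, v.2 + w.2).

Inductive listed_op : (R3 -> R3 -> R3) -> Prop :=
| Op_add : listed_op add_op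
| Op_heis : listed_op heis_op
| Op_affine : listed_op (@affine_op R)
| Op_G3 : listed_op G3_op
| Op_tau c of c != 0 : listed_op (tau_op c).

Context {G : dgroup S}.

(** Associativity on two translations in t and the basis vector of the y-axis is multiplicativity of
    the off-diagonal matrix entry. *)
Lemma semidirect_cocycle a b (u : R -> R) : coordinatized G (semidirect_op a b u) ->
  forall t t', u (t + t') = expR (a * t) * u t' + u t * expR (b * t').
Proof.
case=> psi [dpsi psiI psiS psiM] t t'.
have := gopA (psi (0, 0, t)) (psi (0, 0, t')) (psi (0, 1, 0)).
rewrite -!psiM => /psiI[].
by rewrite /semidirect_op /= !mulr0 !mulr1 !addr0 !add0r.
Qed.

(* The matrix [[e^(at), u t], [0, e^(bt)]] is diagonalizable uniformly in [t]. *)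
Lemma classify_distinct a b (u : R -> R) : a != b -> coordinatized G (semidirect_op a b u) ->
  exists2 op, listed_op op & coordinatized G op.
Proof.
move=> ab cG; have uD := semidirect_cocycle cG.
have ab1 : expR a - expR b != 0 by rewrite subr_eq0 (inj_eq (@expR_inj R)).
(* Comparing the cocycle identity for u(1 + t) and u(t + 1) gives u(t)(e^a - e^b) = u(1)(e^(at) -
   e^(bt)). The shear by k then diagonalizes all the matrices at once. *)
pose k := u 1 / (expR a - expR b).
have uE t : u t = k * (expR (a * t) - expR (b * t)).
  have := uD 1 t; rewrite addrC uD !mulr1 => e.
  apply: (mulIf ab1); rewrite /k mulrAC divfK //; nra.
have diag : coordinatized G (semidirect_op a b (fun=> 0)).
  apply: (coordinatized_reparam (th := fun v => (v.1.1 - k * v.1.2, v.1.2, v.2))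
    (th' := fun v => (v.1.1 + k * v.1.2, v.1.2, v.2))) cG.
  - by ddef.
  - by move=> [[x y] t] /=; rewrite subrK.
  - by move=> [[x y] t] /=; rewrite addrK.
  - move=> [[x y] t] [[x' y'] t']; rewrite /semidirect_op /= uE; congr (_, _, _).
    by ring.
(* A zero exponent makes the corresponding line of the plane a direct factor, leaving an affine
   group in the other two coordinates. *)
have [b0|b0] := eqVneq b 0.
  have a0 : a != 0 by rewrite -b0.
  exists (@affine_op R); first by constructor.
  apply: (coordinatized_reparam (th := fun v => (v.1.1, v.2, a^-1 * v.1.2))
    (th' := fun v => (v.1.1, a * v.2, v.1.2))) diag.
  - by ddef.
  - by move=> [[x y] t] /=; rewrite mulrA divff // mul1r.
  - by move=> [[x y] t] /=; rewrite mulrA mulVf // mul1r.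
  - move=> [[x y] t] [[x' y'] t']; rewrite /semidirect_op /affine_op /= b0 !mul0r expR0.
    by rewrite !mul1r mulrA divff // mul1r addr0 mulrDr.
have [a0|a0] := eqVneq a 0.
  exists (@affine_op R); first by constructor.
  apply: (coordinatized_reparam (th := fun v => (v.2, v.1.1, b^-1 * v.1.2))
    (th' := fun v => (v.1.2, b * v.2, v.1.1))) diag.
  - by ddef.
  - by move=> [[x y] t] /=; rewrite mulrA divff // mul1r.
  - by move=> [[x y] t] /=; rewrite mulrA mulVf // mul1r.
  - move=> [[x y] t] [[x' y'] t']; rewrite /semidirect_op /affine_op /= a0 !mul0r expR0.
    by rewrite !mul1r mulrA divff // mul1r addr0 mulrDr.
(* Scaling t by 1/b turns e^(bt) into e^t and e^(at) into e^((a/b)t). *)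
exists (tau_op (a / b)); first by constructor; rewrite mulf_neq0 // invr_eq0.
apply: (coordinatized_reparam (th := fun v => (v.1.1, v.1.2, b^-1 * v.2))
  (th' := fun v => (v.1.1, v.1.2, b * v.2))) diag.
- by ddef.
- by move=> [[x y] t] /=; rewrite mulrA divff // mul1r.
- by move=> [[x y] t] /=; rewrite mulrA mulVf // mul1r.
- move=> [[x y] t] [[x' y'] t']; rewrite /semidirect_op /tau_op /= mul0r addr0 mulrDr.
  by rewrite !mulrA divff // mul1r.
Qed.

Lemma classify_equal a (u : R -> R) : dfun u -> coordinatized G (semidirect_op a a u) ->
  exists2 op, listed_op op & coordinatized G op.
Proof.
move=> du cG; have uD := semidirect_cocycle cG.
pose c := u 1 * expR (- a).
(* Multiplying by e^(-at) turns the cocycle identity into additivity; c is the value of the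
   resulting linear function at 1. *)
have uE t : u t = c * t * expR (a * t).
  have dF : dfun (fun t => u t * expR (- (a * t))) by ddef.
  have FD x y : u (x + y) * expR (- (a * (x + y))) =
      u x * expR (- (a * x)) + u y * expR (- (a * y)).
    rewrite uD mulrDr opprD expRD.
    have := expRxMexpNx_1 (a * x); have := expRxMexpNx_1 (a * y).
    move: (expR _) (expR (a * y)) (expR _) (expR _) => ex ey ny nx hy hx.
    ring: hx hy.
  have /= := dfun_additive_linear S_field S_ominimal dF FD t.
  rewrite mulr1 -/c => <-; rewrite -mulrA [_ * expR (a * t)]mulrC expRxMexpNx_1 mulr1 //.
have [c0|c0] := eqVneq c 0.
  have u0 t : u t = 0 by rewrite uE c0 !mul0r.
  have [a0|a0] := eqVneq a 0.
    exists add_op; first by constructor.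
    apply: (coordinatized_reparam (th := id) (th' := id)) cG => //.
      exact: dfun_id.
    move=> [[x y] t] [[x' y'] t']; rewrite /semidirect_op /add_op /= u0 a0.
    by rewrite !mul0r expR0 !mul1r addr0.
  exists (tau_op 1); first by constructor; rewrite oner_neq0.
  apply: (coordinatized_reparam (th := fun v => (v.1.1, v.1.2, a^-1 * v.2))
    (th' := fun v => (v.1.1, v.1.2, a * v.2))) cG.
  - by ddef.
  - by move=> [[x y] t] /=; rewrite mulrA divff // mul1r.
  - by move=> [[x y] t] /=; rewrite mulrA mulVf // mul1r.
  - move=> [[x y] t] [[x' y'] t']; rewrite /semidirect_op /tau_op /= u0 mul0r addr0 mulrDr.
    by rewrite !mulrA divff // !mul1r.
have [a0|a0] := eqVneq a 0.
  exists heis_op; first by constructor.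
  (* Now t acts by the unipotent matrices [[1, ct], [0, 1]]. The correction by half of the product
     replaces this one-sided bilinear term by the antisymmetric form of the Heisenberg law. *)
  apply: (coordinatized_reparam
    (th := fun v => (v.2 + 2^-1 * v.1.1 * v.1.2, c^-1 * v.1.2, v.1.1))
    (th' := fun v => (v.2, c * v.1.2, v.1.1 - 2^-1 * v.2 * (c * v.1.2)))) cG.
  - by ddef.
  - by move=> [[p q] r] /=; rewrite mulrA divff // mul1r addrK.
  - by move=> [[x y] t] /=; congr (_, _, _); field.
  - move=> [[p q] r] [[p' q'] r']; rewrite /semidirect_op /heis_op /= uE a0.
    rewrite !mul0r expR0 !mul1r mulr1; congr (_, _, _); by field.
exists G3_op; first by constructor.
(* The scaling of t normalizes the exponent a to 1; the scaling of y absorbs the factor c/a this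
   leaves in front of t e^t. *)
apply: (coordinatized_reparam (th := fun v => (v.1.1, a / c * v.1.2, a^-1 * v.2))
  (th' := fun v => (v.1.1, c / a * v.1.2, a * v.2))) cG.
- by ddef.
- by move=> [[x y] t] /=; congr (_, _, _); field; rewrite ?a0 ?c0.
- by move=> [[x y] t] /=; congr (_, _, _); field; rewrite ?a0 ?c0.
- move=> [[x y] t] [[x' y'] t']; rewrite /semidirect_op /G3_op /= uE.
  have -> : a * (a^-1 * t) = t by rewrite mulrA divff // mul1r.
  by congr (_, _, _); field; rewrite ?a0 ?c0.
Qed.

Theorem classify a b (u : R -> R) : dfun u -> coordinatized G (semidirect_op a b u) ->
  exists2 op, listed_op op & coordinatized G op.
Proof.
move=> du; have [->|ab] := eqVneq a b; first exact: classify_equal.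
exact: classify_distinct.
Qed.

End Classification.

(** * The listed groups *)

Section StandardTopology.
Context {R : realType} {S : structure R}.

Lemma continuous_rV (T : topologicalType) n (f : T -> 'rV[R]_n) :
  (forall i, continuous (fun t => f t 0 i)) -> continuous f.
Proof.
move=> cf t A [P fP sPA].
have : \forall s \near t, forall i, P 0 i (f s 0 i).
  by apply: filter_forall => i; apply: cf; apply: fP.
by apply: filterS => s Ps; apply: sPA => i j; rewrite (ord1 i).
Qed.

(** The identity of R^n is a single global chart, so continuity of the operations is all that has to
    be supplied. *)
Lemma standard_homeomorphic n mul one inv :
  is_group (@GroupData R n setT mul one inv) ->
  continuous (fun z => mul z.1 z.2 : 'rV[R]_n) -> continuous inv ->
  definably_homeomorphic_to_Rn S (@GroupData R n setT mul one inv) n.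
Proof.
move=> gG cm ci; exists 'rV[R]_n, id.
have dgraph : definable S [set row_mx t t | t in (setT : set 'rV[R]_n)].
  by apply/dpred_rV; rewrite /= -[X in dpred S X]/(_ @` _); apply/dpred_rV;
     apply: definable_range; [exact: dpred_True|apply: dfun_row_mx; exact: dfun_id].
split; last by exists id, id; split=> // t; apply: cvg_id.
split.
- by split=> // u _; exists u.
- by exists (fun z => mul z.1 z.2).
- by exists inv.
- exists n, 1%N, (fun=> setT), (fun=> id); split=> [t|i]; first by exists ord0.
  by split=> //; [exact: openT|move=> V _; rewrite image_id].
Qed.

End StandardTopology.

Section ContinuousFunctions.
Context {R : realType} {T : topologicalType}.
Implicit Types f g : T -> R.

Lemma continuous_add f g : continuous f -> continuous g -> continuous (fun t => f t + g t).
Proof. by move=> cf cg t; apply: cvgD; [apply: cf|apply: cg]. Qed.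

Lemma continuous_mul f g : continuous f -> continuous g -> continuous (fun t => f t * g t).
Proof. by move=> cf cg t; apply: cvgM; [apply: cf|apply: cg]. Qed.

Lemma continuous_opp f : continuous f -> continuous (fun t => - f t).
Proof. by move=> cf t; apply: cvgN; apply: cf. Qed.

Lemma continuous_exp f : continuous f -> continuous (fun t => expR (f t)).
Proof.
move=> cf t; apply: (@continuous_comp _ _ _ f (@expR R)); first exact: cf.
exact: continuous_expR.
Qed.

Lemma continuous_coord n (f : T -> 'rV[R]_n) i : continuous f -> continuous (fun t => f t 0 i).
Proof.
move=> cf t; apply: (@continuous_comp _ _ _ f (fun u : 'rV[R]_n => u 0 i)); first exact: cf.
exact: coord_continuous.
Qed.

Lemma continuous_eq f g : continuous f -> f =1 g -> continuous g.
Proof. by move=> cf /funext <-. Qed.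

Lemma continuous_row3 f g h : continuous f -> continuous g -> continuous h ->
  continuous (fun t => row3 (f t) (g t) (h t)).
Proof.
move=> cf cg ch; apply: continuous_rV => -[[|[|[|//]]] i].
- by apply: continuous_eq cf _ => t; rewrite mxE.
- by apply: continuous_eq cg _ => t; rewrite mxE.
- by apply: continuous_eq ch _ => t; rewrite mxE.
Qed.

Lemma continuous_const (c : R) : continuous (fun _ : T => c).
Proof. by move=> t; apply: cvg_cst. Qed.

Lemma continuous_prod1 (T1 T2 : topologicalType) : continuous (fun z : T1 * T2 => z.1).
Proof. by move=> z; apply: cvg_fst. Qed.

Lemma continuous_prod2 (T1 T2 : topologicalType) : continuous (fun z : T1 * T2 => z.2).
Proof. by move=> z; apply: cvg_snd. Qed.

Lemma continuous_idfun : continuous (fun t : T => t).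
Proof. by move=> t; apply: cvg_id. Qed.

End ContinuousFunctions.

Ltac ccont := repeat lazymatch goal with
  | |- continuous (fun z => z) => exact: continuous_idfun
  | |- continuous (fun z => z.1) => exact: continuous_prod1
  | |- continuous (fun z => z.2) => exact: continuous_prod2
  | |- continuous fst => exact: continuous_prod1
  | |- continuous snd => exact: continuous_prod2
  | |- continuous (fun _ => ?c) => exact: continuous_const
  | |- continuous (fun z => @?f z + @?g z) => apply: (continuous_add (f := f) (g := g))
  | |- continuous (fun z => @?f z * @?g z) => apply: (continuous_mul (f := f) (g := g))
  | |- continuous (fun z => - @?f z) => apply: (continuous_opp (f := f))
  | |- continuous (fun z => expR (@?f z)) => apply: (continuous_exp (f := f))
  | |- continuous (fun z => row3 (@?f z) (@?g z) (@?h z)) =>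
      apply: (continuous_row3 (f := f) (g := g) (h := h))
  | |- continuous (fun z => fun_of_matrix (@?f z) _ _) => apply: (continuous_coord (f := f))
  end.

Section ListedGroups.
Context {R : realType} {S : structure R}.
Hypothesis S_field : expands_real_field S.
Local Notation dpred := (dpred S).
Local Notation dfun := (dfun S).

Lemma definably_isomorphic_refl (G : group_data R) : definable_group S G ->
  definably_isomorphic S G G.
Proof.
move=> [gG dG _]; exists id; split; last by split=> // u; exists u.
split=> //; apply/definable_funE; move/dpred_rV: dG => dG; by ddef.
Qed.

(* The coordinates [e0], [e1], [e2] exhibit the chain of normal subgroups
   {u_e1 = u_e2 = 0} and {u_e2 = 0}. *)
Lemma triangular_group_supersolvable (mul : 'rV[R]_3 -> 'rV[R]_3 -> 'rV[R]_3) inv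
    (e0 e1 e2 : 'I_3) (k : R -> R) :
  (forall i, [\/ i = e0, i = e1 | i = e2]) -> e0 != e1 -> e0 != e2 -> e1 != e2 ->
  is_group (@GroupData R 3 setT mul 0 inv) ->
  dfun (fun z => mul z.1 z.2) ->
  k 0 = 1 ->
  (forall u v : 'rV[R]_3, mul u v 0 e2 = u 0 e2 + v 0 e2) ->
  (forall u v : 'rV[R]_3, mul u v 0 e1 = u 0 e1 + k (u 0 e2) * v 0 e1) ->
  (forall u v : 'rV[R]_3, u 0 e1 = 0 -> u 0 e2 = 0 -> v 0 e1 = 0 -> v 0 e2 = 0 ->
     mul u v 0 e0 = u 0 e0 + v 0 e0) ->
  supersolvable S (@GroupData R 3 setT mul 0 inv).
Proof.
move=> eP e01 e02 e12 gG dm k0 m2 m1 m0; set G := GroupData _ _ _ _.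
pose H (n : nat) : set 'rV[R]_3 := match n with
  | 0 => [set 0] | 1 => [set u | u 0 e1 = 0 /\ u 0 e2 = 0] | 2 => [set u | u 0 e2 = 0]
  | _ => setT end.
have V1 u : mul u (inv u) = 0 by have /= [] := gmulV gG (x := u) I.
have i2 u : inv u 0 e2 = - u 0 e2.
  by apply: (addrI (u 0 e2)); rewrite -m2 V1 mxE subrr.
have dv : dfun inv.
  apply: (dfun_graph (Q := fun u v => mul u v = 0)); first by ddef.
  move=> u v; split=> [uv|<- //].
  have e : mul (inv u) (mul u v) = inv u by rewrite uv; have /= [] := gmul1 gG (x := inv u) I.
  have /= A := @gmulA _ _ gG (inv u) u v I I I.
  have /= [Vu _] := gmulV gG (x := u) I; have /= [I1 _] := gmul1 gG (x := v) I.
  by rewrite -e A Vu I1.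
have dH n : dpred (H n).
  case: n => [|[|[|n]]].
  - by have d : dpred (fun u : 'rV[R]_3 => u = 0) by ddef.
  - by have d : dpred (fun u : 'rV[R]_3 => u 0 e1 = 0 /\ u 0 e2 = 0) by ddef.
  - by have d : dpred (fun u : 'rV[R]_3 => u 0 e2 = 0) by ddef.
  - exact: dpred_True.
have HG n : is_group (subgroup_on (G := G) (H n)).
  have [_ _ _ A I1 V] := gG; split => //=.
  - by case: n => [|[|[|n]]] //=; rewrite !mxE.
  - case: n => [|[|[|n]]] //= u v.
    + by move=> -> ->; have /= [] := I1 0 I.
    + by move=> [u1 u2] [v1 v2]; rewrite m1 m2 u1 u2 v1 v2 mulr0 !addr0.
    + by move=> u2 v2; rewrite m2 u2 v2 addr0.
  - case: n => [|[|[|n]]] //= u.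
    + by move=> ->; have /= [e _] := I1 (inv 0) I; rewrite -e V1.
    + move=> [u1 u2]; rewrite i2 u2 oppr0; split=> //.
      by have := congr1 (fun w : 'rV_3 => w 0 e1) (V1 u); rewrite m1 u1 u2 k0 mul1r add0r mxE.
    + by move=> u2; rewrite i2 u2 oppr0.
  - by move=> u v w _ _ _; apply: A.
  - by move=> u _; apply: I1.
  - by move=> u _; apply: V.
have dHG n : definable_group S (subgroup_on (G := G) (H n)).
  by apply: definable_group_total => //=; apply/dpred_rV.
have row1_hom m (e : 'I_3) :
    (forall u v : 'rV[R]_3, H m u -> H m v -> mul u v 0 e = u 0 e + v 0 e) ->
    definable_hom S (G := subgroup_on (G := G) (H m)) (H := add_group R 1)
      (fun u => \row_(_ < 1) u 0 e).
  move=> me; split=> //=; last by move=> u v Hu Hv; apply: row1P; rewrite !mxE me.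
  apply/definable_funE.
  have dr : dfun (fun u : 'rV[R]_3 => \row_(_ < 1) u 0 e) by apply: dfun_const_row; ddef.
  apply: dpred_and; last exact: dr.
  by apply: (dpred_comp (f := fun z => z.1) (dH m)); ddef.
exists 3%N, H; split=> //.
  move=> n _; split=> //= g h _.
  case: n => [|[|[|n]]] //=.
  + by move=> ->; have /= [_ ->] := gmul1 gG (x := g) I; rewrite V1.
  + move=> [h1 h2]; rewrite m1 !m2 m1 h1 h2 mulr0 !addr0 i2 subrr; split=> //.
    by rewrite -m1 V1 mxE.
  + by move=> h2; rewrite !m2 h2 addr0 i2 subrr.
pose del (e : 'I_3) (x : R) : 'rV[R]_3 := \row_i (if i == e then x else 0).
have delE e x : del e x 0 e = x by rewrite mxE eqxx.
have del0 e e' x : e' != e -> del e x 0 e' = 0 by rewrite mxE => /negPf ->.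
have qH n e : (forall u v : 'rV[R]_3, H n.+1 u -> H n.+1 v -> mul u v 0 e = u 0 e + v 0 e) ->
    (forall x, H n.+1 (del e x)) -> (forall u, H n u <-> H n.+1 u /\ u 0 e = 0) ->
  H n `<=` H n.+1 /\ exists (Q : group_data R) (pi : 'rV[R]_3 -> 'rV[R]_(gdim Q)),
    definable_quotient (H := subgroup_on (G := G) (H n.+1)) S (H n) pi /\
    definably_isomorphic S Q (add_group R 1).
  move=> mD dP HE; split; first by move=> u /HE[].
  exists (add_group R 1), (fun u => \row_(_ < 1) u 0 e); split; last first.
    exact/definably_isomorphic_refl/add_definable_group.
  split; [exact: add_definable_group|exact: row1_hom| |].
  - by move=> x _; exists (del e (x 0 0)); [apply: dP|apply: row1P; rewrite mxE delE].
  - apply/seteqP; split=> u.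
      by move=> /HE[Hu u0]; split=> //; apply: row1P; rewrite !mxE.
    by move=> [Hu /rowP/(_ 0)]; rewrite !mxE => u0; apply/HE.
move=> [|[|[|//]]] _.
- apply: (qH 0%N e0) => [u v [? ?] [? ?]|x|u] /=; first exact: m0.
    by rewrite !del0 // eq_sym.
  split=> [->|[[u1 u2] u0]]; first by rewrite !mxE.
  by apply/rowP => i; rewrite mxE; case: (eP i) => ->.
- apply: (qH 1%N e1) => [u v /= u2 v2|x|u] /=; first by rewrite m1 u2 k0 mul1r.
    by rewrite del0 // eq_sym.
  by split=> [[]|[]].
- by apply: (qH 2%N e2) => [u v _ _|x|u] //=; split=> [|[]].
Qed.

Lemma row3P (u v : 'rV[R]_3) : u 0 0 = v 0 0 -> u 0 1 = v 0 1 -> u 0 2 = v 0 2 -> u = v.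
Proof.
move=> e0 e1 e2; apply/rowP => -[[|[|[|//]]] i].
- by rewrite (_ : Ordinal i = 0) //; apply/val_inj.
- by rewrite (_ : Ordinal i = 1) //; apply/val_inj.
- by rewrite (_ : Ordinal i = 2) //; apply/val_inj.
Qed.

Lemma ord3P (i : 'I_3) : [\/ i = 0, i = 1 | i = 2].
Proof.
by case: i => -[|[|[|//]]] i; [constructor 1|constructor 2|constructor 3]; apply/val_inj.
Qed.

Lemma ord3_distinct (e0 e1 e2 : 'I_3) : e0 != e1 -> e0 != e2 -> e1 != e2 ->
  forall i, [\/ i = e0, i = e1 | i = e2].
Proof.
by case: (ord3P e0) => ->; case: (ord3P e1) => ->; case: (ord3P e2) => -> // _ _ _ i;
  case: (ord3P i) => ->; ((by constructor 1) || (by constructor 2) || (by constructor 3)).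
Qed.

Lemma triangular_group_properties (mul : 'rV[R]_3 -> 'rV[R]_3 -> 'rV[R]_3)
    (inv : 'rV[R]_3 -> 'rV[R]_3) (e0 e1 e2 : 'I_3) (k : R -> R) :
  let K := @GroupData R 3 setT mul 0 inv in
  e0 != e1 -> e0 != e2 -> e1 != e2 -> dfun (fun z => mul z.1 z.2) ->
  continuous (fun z => mul z.1 z.2) -> continuous inv -> k 0 = 1 ->
  (forall u v : 'rV[R]_3, mul u v 0 e2 = u 0 e2 + v 0 e2) ->
  (forall u v : 'rV[R]_3, mul u v 0 e1 = u 0 e1 + k (u 0 e2) * v 0 e1) ->
  (forall u v : 'rV[R]_3, u 0 e1 = 0 -> u 0 e2 = 0 -> v 0 e1 = 0 -> v 0 e2 = 0 ->
    mul u v 0 e0 = u 0 e0 + v 0 e0) -> is_group K ->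
  [/\ definable_group S K, supersolvable S K & definably_homeomorphic_to_Rn S K 3].
Proof.
move=> K e01 e02 e12 dm cm ci k0 m2 m1 m0 gK; split.
- by apply: definable_group_total => //; apply: definable_setT.
- by apply: (triangular_group_supersolvable _ e01 e02 e12 gK dm k0 m2 m1 m0); apply: ord3_distinct.
- exact: standard_homeomorphic.
Qed.

Definition affine3_mul (u v : 'rV[R]_3) : 'rV[R]_3 :=
  row3 (u 0 0 + expR (u 0 1) * v 0 0) (u 0 1 + v 0 1) (u 0 2 + v 0 2).

Definition affine3_inv (u : 'rV[R]_3) : 'rV[R]_3 :=
  row3 (- (expR (- u 0 1) * u 0 0)) (- u 0 1) (- u 0 2).

(** The product lives on rows of length [2 + 1], which computes to 3; as an equality of data this
    brings it under the treatment of the other groups on R^3. *)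
Lemma affine_prodE : prod_group (affine_group R) (add_group R 1) =
  @GroupData R 3 setT affine3_mul 0 affine3_inv.
Proof.
have l0 (u : 'rV[R]_(2 + 1)) : lsubmx u 0 0 = u 0 (0 : 'I_3).
  by rewrite mxE; congr (u _ _); apply/val_inj.
have l1 (u : 'rV[R]_(2 + 1)) : lsubmx u 0 1 = u 0 (1 : 'I_3).
  by rewrite mxE; congr (u _ _); apply/val_inj.
have r0 (u : 'rV[R]_(2 + 1)) : rsubmx u 0 0 = u 0 (2 : 'I_3).
  by rewrite mxE; congr (u _ _); apply/val_inj.
have rE (a : 'rV[R]_2) (b : 'rV[R]_1) : (row_mx a b : 'rV[R]_3) = row3 (a 0 0) (a 0 1) (b 0 0).
  by apply: row3P; rewrite !rowE -?l0 -?l1 -?r0 ?row_mxKl ?row_mxKr.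
rewrite /prod_group /affine3_mul /affine3_inv /=.
have -> : [set x : 'rV[R]_(2 + 1) | True /\ True] = setT by apply/seteqP; split.
have -> : row_mx 0 0 = 0 :> 'rV[R]_(2 + 1) by rewrite row_mx0.
congr (@GroupData R 3 setT _ _ _).
  apply/funext => u; apply/funext => v; rewrite rE !rowE !l0 !l1 !mxE.
  by congr (row3 _ _ (_ + _)); rewrite -r0 mxE.
by apply/funext => u; rewrite rE !rowE !l0 !l1 !mxE; congr (row3 _ _ (- _)); rewrite -r0 mxE.
Qed.

Hypothesis dexp : dfun (@expR R).

Lemma expNx (x : R) : expR (- x) * expR x = 1.
Proof. by rewrite mulrC expRxMexpNx_1. Qed.

Lemma listed_is_group K : listed_group K -> is_group (R := R) K.
Proof.
case.
- exact: add_is_group.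
- split=> //=.
  + by move=> u v w _ _ _; apply: row3P; rewrite !rowE; ring.
  + by move=> u _; split; apply: row3P; rewrite !rowE !mxE; ring.
  + by move=> u _; split; apply: row3P; rewrite !rowE !mxE; ring.
- rewrite affine_prodE; split=> //=.
  + by move=> u v w _ _ _; apply: row3P; rewrite !rowE ?expRD; ring.
  + by move=> u _; split; apply: row3P; rewrite !rowE !mxE ?expR0; ring.
  + move=> u _; split; apply: row3P; rewrite !rowE !mxE; try ring.
    by rewrite mulrN mulrA expRxMexpNx_1; ring.
- split=> //=.
  + by move=> u v w _ _ _; apply: row3P; rewrite !rowE ?expRD; ring.
  + by move=> u _; split; apply: row3P; rewrite !rowE !mxE ?expR0; ring.
  + move=> u _; have e := expNx (u 0 2).
    by split; apply: row3P; rewrite !rowE !mxE; ring: e.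
- move=> c _; split=> //=.
  + by move=> u v w _ _ _; apply: row3P; rewrite !rowE ?mulrDr ?expRD; ring.
  + by move=> u _; split; apply: row3P; rewrite !rowE !mxE ?mulr0 ?expR0; ring.
  + move=> u _; have e := expNx (u 0 2); have e' := expNx (c * u 0 2).
    by split; apply: row3P; rewrite !rowE !mxE ?mulrN; ring: e e'.
Qed.

Lemma listed_group_properties K : listed_group K ->
  [/\ definable_group S K, supersolvable S K & definably_homeomorphic_to_Rn S K 3].
Proof.
move=> lK; have := listed_is_group lK.
case: lK => [||||c c0] gK.
  - apply: (triangular_group_properties (e0 := 0) (e1 := 1) (e2 := 2) (k := fun=> 1)) gK => //=.
    + by apply: dfun_rVD; ddef.
    + apply: continuous_rV => i.
      apply: (continuous_eq (f := fun z : 'rV[R]_3 * 'rV[R]_3 => z.1 0 i + z.2 0 i)) => [|z].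
        by ccont.
      by rewrite mxE.
    + apply: continuous_rV => i.
      by apply: (continuous_eq (f := fun z : 'rV[R]_3 => - z 0 i)) => [|z]; [ccont|rewrite mxE].
    + by move=> u v; rewrite mxE.
    + by move=> u v; rewrite mxE mul1r.
    + by move=> u v _ _ _ _; rewrite mxE.
  (* The centre of the Heisenberg group is its last coordinate, so the chain runs through the
     coordinates in reverse. *)
  - apply: (triangular_group_properties (e0 := 2) (e1 := 1) (e2 := 0) (k := fun=> 1)) gK => //=.
    + by ddef.
    + by ccont.
    + apply: continuous_rV => i.
      by apply: (continuous_eq (f := fun z : 'rV[R]_3 => - z 0 i)) => [|z]; [ccont|rewrite mxE].
    + by move=> u v; rewrite rowE.
    + by move=> u v; rewrite rowE mul1r.
    + by move=> u v u1 u0 v1 v0; rewrite rowE u1 u0 v0 v1 mulr0 subrr mulr0 addr0.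
  - rewrite affine_prodE in gK *.
    apply: (triangular_group_properties (e0 := 0) (e1 := 1) (e2 := 2) (k := fun=> 1)) gK => //=.
    + by rewrite /affine3_mul; ddef.
    + by rewrite /affine3_mul; ccont.
    + by rewrite /affine3_inv; ccont.
    + by move=> u v; rewrite rowE.
    + by move=> u v; rewrite rowE mul1r.
    + by move=> u v u1 _ _ _; rewrite rowE u1 expR0 mul1r.
  - apply: (triangular_group_properties (e0 := 0) (e1 := 1) (e2 := 2) (k := @expR R)) gK => //=.
    + by ddef.
    + by ccont.
    + by ccont.
    + exact: expR0.
    + by move=> u v; rewrite rowE.
    + by move=> u v; rewrite rowE mulrC.
    + by move=> u v u1 u2 v1 v2; rewrite rowE u2 v1 expR0 mulr1 !mul0r addr0.
  - apply: (triangular_group_properties (e0 := 0) (e1 := 1) (e2 := 2) (k := @expR R)) gK => //=.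
    + by ddef.
    + by ccont.
    + by ccont.
    + exact: expR0.
    + by move=> u v; rewrite rowE.
    + by move=> u v; rewrite rowE.
    + by move=> u v u1 u2 v1 v2; rewrite rowE u2 mulr0 expR0 mul1r.
Qed.

End ListedGroups.

(** * Supersolvable groups *)

Section GroupOfData.
Context {R : realType} {S : structure R}.
Hypothesis S_field : expands_real_field S.
Local Notation dpred := (dpred S).
Local Notation dfun := (dfun S).
Context (G : group_data R) (dG : definable_group S G).

Let gG : is_group G. Proof. by case: dG. Qed.

Definition carrier := {u : 'rV[R]_(gdim G) | gset G u}.

Lemma carrier_inj : injective (fun x : carrier => sval x).
Proof. by move=> [u Gu] [v Gv] /= uv; subst v; congr exist; apply: Prop_irrelevance. Qed.

Lemma carrier_def : definable S (range (fun x : carrier => sval x)).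
Proof.
have [_ d _] := dG; apply: definable_ext d _ => u; split=> [Gu|[[v Gv] _ <-] //].
by exists (exist _ u Gu).
Qed.

#[local] Instance dspace_carrier : dspace S carrier := DSpace carrier_inj carrier_def.

Definition carrier_op (x y : carrier) : carrier :=
  exist _ (gmul G (sval x) (sval y)) (gmul_in gG (svalP x) (svalP y)).

Lemma dfun_sval : dfun (fun x : carrier => sval x).
Proof. exact: (@dfun_enc R S carrier _). Qed.

Lemma dfun_carrier_op : dfun (fun z => carrier_op z.1 z.2).
Proof.
have ds := dfun_sval; have [_ _ dM] := dG.
pose M := [set row_mx (row_mx x y) (gmul G x y) | x in gset G & y in gset G].
have {}dM : dpred M by apply/dpred_rV.
have d : dpred (fun w : carrier * carrier * carrier =>
    M (row_mx (row_mx (sval w.1.1) (sval w.1.2)) (sval w.2))).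
  apply: (dpred_comp dM); apply: dfun_row_mx; [apply: dfun_row_mx|].
  - by apply: (dfun_comp ds (f := fun w : carrier * carrier * carrier => w.1.1)); ddef.
  - by apply: (dfun_comp ds (f := fun w : carrier * carrier * carrier => w.1.2)); ddef.
  - by apply: (dfun_comp ds (f := fun w : carrier * carrier * carrier => w.2)); ddef.
apply: dpred_ext d _ => -[[x y] z] /=; split=> [[u Gu [v Gv]]|<-].
  by move=> /eq_row_mx[/eq_row_mx[ux vy] e]; apply: carrier_inj; rewrite /= -e ux vy.
by exists (sval x); [exact: svalP|exists (sval y); [exact: svalP|]].
Qed.

Definition dgroup_of_data : dgroup S.
Proof.
refine (@DGroup R S carrier _ carrier_op (exist _ (gone G) (gone_in gG))
  (fun x => exist _ (ginv G (sval x)) (ginv_in gG (svalP x))) _ _ _ _ _ dfun_carrier_op).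
- move=> x y z; apply: carrier_inj => /=.
  by rewrite (gmulA gG) //; apply: svalP.
- by move=> x; apply: carrier_inj => /=; have [] := gmul1 gG (svalP x).
- by move=> x; apply: carrier_inj => /=; have [] := gmul1 gG (svalP x).
- by move=> x; apply: carrier_inj => /=; have [] := gmulV gG (svalP x).
- by move=> x; apply: carrier_inj => /=; have [] := gmulV gG (svalP x).
Defined.

(** The isomorphism inverts the coordinate map. It comes from plain choice and is arbitrary off
    [gset G]; its graph over [gset G] is definable, being that of [th] read backwards. *)
Lemma isomorphic_of_coordinates (op : R * R * R -> R * R * R -> R * R * R) mul one inv :
  (forall u v : 'rV[R]_3, mul u v = row3 (op (u 0 0, u 0 1, u 0 2) (v 0 0, v 0 1, v 0 2)).1.1
     (op (u 0 0, u 0 1, u 0 2) (v 0 0, v 0 1, v 0 2)).1.2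
     (op (u 0 0, u 0 1, u 0 2) (v 0 0, v 0 1, v 0 2)).2) ->
  coordinatized dgroup_of_data op ->
  definably_isomorphic S G (@GroupData R 3 setT mul one inv).
Proof.
move=> mulE [psi [dpsi psiI psiS psiM]].
have dpsi' : dfun (psi : R * R * R -> carrier) := dpsi.
pose th (u : 'rV[R]_3) : carrier := psi (u 0 0, u 0 1, u 0 2).
have dth : dfun th by rewrite /th; ddef.
have thI : injective th by move=> u v /psiI[e0 e1 e2]; apply: row3P.
have thS u : gset G u -> exists v, sval (th v) = u.
  move=> Gu; have [[[x y] z] e] := psiS (exist _ u Gu).
  by exists (row3 x y z); rewrite /th !rowE e.
have thM u v : sval (th (mul u v)) = gmul G (sval (th u)) (sval (th v)).
  have := psiM (u 0 0, u 0 1, u 0 2) (v 0 0, v 0 1, v 0 2).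
  move=> /(congr1 (fun x : carrier => sval x)) /= <-.
  by rewrite /th mulE !rowE; congr (sval (psi _)); case: (op _ _) => -[].
have [f fP] : exists f, forall u, gset G u -> sval (th (f u)) = u.
  suff /choice[f fP] : forall u, exists v, gset G u -> sval (th v) = u by exists f.
  move=> u; have [Gu|nGu] := pselect (gset G u); last by exists 0.
  by have [v vP] := thS u Gu; exists v.
exists f; split; first split=> //=.
- apply/definable_funE; have ds := dfun_sval.
  have d : dpred (fun z : 'rV[R]_(gdim G) * 'rV[R]_3 => sval (th z.2) = z.1).
    apply: dpred_eq2; last by ddef.
    by apply: (dfun_comp (g := fun x : carrier => sval x)) => //; ddef.
  apply: dpred_ext d _ => -[u v] /=; split=> [<-|[Gu <-]]; last exact: fP.
  have Gv := svalP (th v); split=> //.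
  by apply: thI; apply: carrier_inj; apply: fP.
- move=> u v Gu Gv; apply: thI; apply: carrier_inj.
  by rewrite /= thM !fP //; apply: gmul_in.
- split=> //.
  + move=> u v; rewrite !inE => Gu Gv e.
    by rewrite -(fP u) // -(fP v) // e.
  + move=> v _; exists (sval (th v)); first exact: svalP.
    by apply: thI; apply: carrier_inj; apply: fP; apply: svalP.
Qed.

Lemma isomorphic_listed (op : R * R * R -> R * R * R -> R * R * R) :
  listed_op op -> coordinatized dgroup_of_data op ->
  exists2 K : group_data R, listed_group K & definably_isomorphic S G K.
Proof.
case=> [||||c c0] cG.
- exists (add_group R 3); first by constructor.
  by apply: isomorphic_of_coordinates cG => u v; apply: row3P; rewrite !rowE mxE.
- exists (heis_group R); first by constructor.
  by apply: isomorphic_of_coordinates cG.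
- exists (prod_group (affine_group R) (add_group R 1)); first by constructor.
  by rewrite affine_prodE; apply: isomorphic_of_coordinates cG.
- exists (G3_group R); first by constructor.
  by apply: isomorphic_of_coordinates cG.
- exists (tau_group c); first by constructor.
  by apply: isomorphic_of_coordinates cG.
Qed.

End GroupOfData.

(** * Chains of a supersolvable group and their length *)

Section Chains.
Context {R : realType} {S : structure R}.
Hypothesis S_field : expands_real_field S.
Hypothesis S_ominimal : ominimal S.
Local Notation dpred := (dpred S).
Local Notation dfun := (dfun S).

(** Each quotient of the chain is absorbed into a homomorphism [r k] from [H k.+1] to the line with
    kernel [H k]. *)
Record dchain (G : dgroup S) (n : nat) (H : nat -> G -> Prop) (r : nat -> G -> R) : Prop :=
  DChain {
    dc_bot : forall g, H 0 g <-> g = ge;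
    dc_top : forall g, H n g;
    dc_sub : forall k, (k <= n)%N -> dsubgroup (H k);
    dc_normal : forall k, (k <= n)%N -> normal (H k);
    dc_dfun : forall k, (k < n)%N -> dfun (r k);
    dc_hom : forall k, (k < n)%N -> hom_on (H k.+1) (r k);
    dc_surj : forall k, (k < n)%N -> forall t, exists2 g, H k.+1 g & r k g = t;
    dc_ker : forall k, (k < n)%N -> forall g, H k g <-> H k.+1 g /\ r k g = 0 }.

Lemma supersolvable_chain (G : group_data R) (dG : definable_group S G) :
  supersolvable S G -> exists n H r, @dchain (dgroup_of_data dG) n H r.
Proof.
case=> n [H [H0 Hn Hnorm Hq]].
pose D := dgroup_of_data dG.
pose Hc k (g : D) := H k (sval g).
have ds : dfun (fun g : D => sval g) := dfun_sval dG.
have dH k : (k <= n)%N -> dpred (Hc k).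
  move=> kn; have [_ [_ /dpred_rV d _] _] := Hnorm k kn.
  by apply: (dpred_comp d ds).
have HS k g : (k < n)%N -> Hc k g -> Hc k.+1 g.
  by move=> kn; have [HH _] := Hq k kn; apply: HH.
have ex k : exists r : D -> R, (k < n)%N -> [/\ dfun r, hom_on (Hc k.+1) r,
    forall t, exists2 g, Hc k.+1 g & r g = t &
    forall g, Hc k g <-> Hc k.+1 g /\ r g = 0].
  have [kn|] := boolP (k < n)%N; last by exists (fun=> 0).
  have [HH [Q [pi [[dQ [piin dpi piM] piS piK] [f [[fin df fM] [_ fI fS]]]]]]] := Hq k kn.
  have [Hsub _ _] := Hnorm k.+1 kn.
  have gQ : is_group Q by case: dQ.
  (* The value 0 off [H k.+1] makes r a total definable function. *)
  pose r (g : D) := ite (Hc k.+1 g) (f (pi (sval g)) 0 0) 0.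
  have rE g : Hc k.+1 g -> r g = f (pi (sval g)) 0 0.
    by move=> Hg; rewrite /r /ite; case: asboolP.
  have f1 : f (gone Q) = 0.
    apply: (addrI (f (gone Q))); rewrite addr0.
    have Q1 := gone_in gQ; have := fM _ _ Q1 Q1; have [-> _] := gmul1 gQ Q1.
    by move=> /= <-.
  exists r => _; split.
  - have dk : dpred (Hc k.+1) by apply: dH.
    move/definable_funE: dpi => dpi; move/definable_funE: df => df.
    apply: (dfun_graph (Q := fun g x => (Hc k.+1 g /\ exists v, exists w,
      (H k.+1 (sval g) /\ pi (sval g) = v) /\ ((gset Q v /\ f v = w) /\ w 0 0 = x)) \/
      (~ Hc k.+1 g /\ x = 0))).
      have d1 : dpred (fun z : D * R * 'rV[R]_(gdim Q) =>
          H k.+1 (sval z.1.1) /\ pi (sval z.1.1) = z.2).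
        apply: (dpred_comp (f := fun z : D * R * 'rV[R]_(gdim Q) => (sval z.1.1, z.2)) dpi).
        apply: dfun_pair; last by ddef.
        by apply: (dfun_comp (g := fun g : D => sval g)) => //; ddef.
      apply: dpred_or; last by ddef.
      apply: dpred_and; first by ddef.
      apply: dpred_ex; apply: dpred_ex; apply: dpred_and.
        by apply: (dpred_comp (f := fun z : D * R * 'rV[R]_(gdim Q) * 'rV[R]_1 => z.1) d1); ddef.
      apply: dpred_and; last by ddef.
      apply: (dpred_comp
        (f := fun z : D * R * 'rV[R]_(gdim Q) * 'rV[R]_1 => (z.1.2, z.2)) df).
      by ddef.
    move=> g x; rewrite /r /ite; case: asboolP => Hg; split.
    + by case=> [[_ [v [w [[_ <-] [[_ <-] <-]]]]]|[]].
    + move=> <-; left; split=> //; exists (pi (sval g)), (f (pi (sval g))).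
      by split=> //; split=> //; split=> //; apply: piin.
    + by case=> [[]|[_ ->]].
    + by move=> <-; right.
  - move=> g h Hg Hh; have [_ [gH _ _] _] := Hnorm k.+1 kn.
    have Hgh : Hc k.+1 (g ** h) by apply: (gmul_in gH).
    by rewrite !rE // (piM _ _ Hg Hh) fM ?mxE //; apply: piin.
  - move=> t; have [v Qv fv] := fS (\row_(_ < 1) t) I; have [u Hu uv] := piS v Qv.
    pose g : D := exist _ u (Hsub u Hu).
    exists g; first exact: Hu.
    by rewrite rE //= uv fv mxE.
  - move=> g; rewrite /Hc piK /=; split=> -[Hg].
      by move=> pig; split=> //; rewrite rE // pig f1 mxE.
    rewrite rE // => fg; split=> //; apply: fI; rewrite ?inE; [exact: piin|exact: gone_in|].
    by rewrite f1; apply: row1P; rewrite fg mxE.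
have [r rP] := choice ex.
exists n, Hc, r; split.
- move=> g; rewrite /Hc H0; split=> [e|-> //].
  exact: carrier_inj.
- by move=> g; rewrite /Hc Hn; apply: svalP.
- move=> k kn; have [_ [gH _ _] _] := Hnorm k kn; split; first exact: dH.
  + exact: (gone_in gH).
  + by move=> g h Hg Hh; apply: (gmul_in gH).
  + by move=> g Hg; apply: (ginv_in gH).
- move=> k kn g h Hh; have [_ _ N] := Hnorm k kn.
  by apply: N => //; apply: svalP.
- by move=> k /(rP k)[].
- by move=> k /(rP k)[].
- by move=> k /(rP k)[].
- by move=> k /(rP k)[].
Qed.

Lemma chain_bijection (G : dgroup S) n H r : @dchain G n H r -> forall k, (k <= n)%N ->
  exists Phi : Rn R k -> G, [/\ dfun Phi, injective Phi & forall g, H k g <-> exists v, Phi v = g].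
Proof.
case=> bot top sub nrm dr hom surj ker; elim=> [|k IHk] kn.
  exists (fun=> ge); split; first by ddef.
    by do 2!case.
  by move=> g; split=> [/bot ->|[_ <-]]; [exists tt|apply/bot].
have [Phi [dPhi PhiI PhiH]] := IHk (ltnW kn).
have sk := sub _ kn; have dk := dr _ kn; have dHk := dsub_def sk.
have [s ds sP] := definable_section S_field S_ominimal dHk dk (surj k kn).
have HP v : H k.+1 (Phi v) /\ r k (Phi v) = 0 by apply/(ker k kn)/PhiH; exists v.
have rP t v : r k (Phi v ** s t) = t.
  by have [Hv rv] := HP v; have [Hs rs] := sP t; rewrite hom // rv rs add0r.
exists (fun w => Phi w.2 ** s w.1); split.
- by ddef.
- move=> [t v] [t' v'] /= e; have := congr1 (r k) e; rewrite !rP => tt'.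
  by move: e; rewrite tt' => /gIop/PhiI ->.
- move=> g; split=> [Hg|[[t v] <-]] /=; last first.
    by have [Hv _] := HP v; have [Hs _] := sP t; apply: (dsubM sk).
  have [Hs rs] := sP (r k g); have Hv := dsubV sk Hs.
  have /PhiH[v Pv] : H k (g ** gi (s (r k g))).
    apply/(ker k kn); split; first exact: (dsubM sk).
    by rewrite hom // (hom_onV sk (hom k kn)) // rs subrr.
  by exists (r k g, v); rewrite /= Pv !gsimp.
Qed.

Lemma homeomorphic_bijection (G : group_data R) (dG : definable_group S G) m :
  definably_homeomorphic_to_Rn S G m ->
  exists2 D : dgroup_of_data dG -> 'rV[R]_m, dfun D & bijective D.
Proof.
case=> T [e [[[ein eI eS] _ _ _] [phi [psi [phiK psiK _ _ dphi]]]]].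
have ex (g : dgroup_of_data dG) : exists t, e t = sval g.
  by have [t _ et] := eS (sval g) (svalP g); exists t.
have [f fP] := choice ex.
exists (fun g => phi (f g)).
  have ds : dfun (fun g : dgroup_of_data dG => sval g) := dfun_sval dG.
  move/dpred_rV: dphi => d.
  have d' : dpred (fun z : dgroup_of_data dG * 'rV[R]_m =>
      [set row_mx (e t) (phi t) | t in [set: T]] (row_mx (sval z.1) z.2)).
    apply: (dpred_comp d); apply: dfun_row_mx; last by ddef.
    by apply: (dfun_comp (g := fun g : dgroup_of_data dG => sval g)) => //; ddef.
  apply: dpred_ext d' _ => -[g v] /=; split=> [[t _ /eq_row_mx[et <-]]|<-].
    by congr phi; apply: eI; rewrite ?inE // fP.
  by exists (f g) => //; rewrite fP.
exists (fun v => exist _ (e (psi v)) (ein (psi v) I)) => [g|v].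
  by apply: carrier_inj; rewrite /= phiK fP.
have -> : f (exist _ (e (psi v)) (ein (psi v) I)) = psi v.
  by apply: eI; rewrite ?inE // fP.
by rewrite psiK.
Qed.

(** Composing the chain coordinates with the bijection D, and conversely, gives definable injections
    between R^n and R^3 in both directions. *)
Lemma chain_length (G : dgroup S) n H r (D : G -> 'rV[R]_3) : @dchain G n H r ->
  dfun D -> bijective D -> n = 3.
Proof.
move=> ch dD [D' DK D'K].
have [Phi [dPhi PhiI PhiS]] := chain_bijection ch (leqnn n).
pose th (u : 'rV[R]_3) : Rn R 3 := (u 0 0, (u 0 1, (u 0 2, tt))).
have dth : dfun th.
  rewrite /th; apply: dfun_pair; first by ddef.
  apply: (@dfun_pair _ _ _ R (R * unit)%type); first by ddef.
  by apply: (@dfun_pair _ _ _ R unit); ddef.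
have thI : injective th by move=> u v [e0 e1 e2]; apply: row3P.
apply/eqP; rewrite eqn_leq; apply/andP; split.
  apply: (definable_injection_leq S_field S_ominimal (f := fun v => th (D (Phi v)))).
    by ddef.
  by move=> v w /thI/(can_inj DK)/PhiI.
have dD' : dfun D'.
  apply: (dfun_graph (Q := fun v g => D g = v)); first by ddef.
  by move=> v g; split=> <-; rewrite ?DK ?D'K.
have [||Psi dPsi PsiP] := definable_choice S_field S_ominimal (P := fun g v => Phi v = g).
- by ddef.
- by move=> g; apply/PhiS; exact: (dc_top ch g).
pose th' (w : Rn R 3) : 'rV[R]_3 := row3 w.1 w.2.1 w.2.2.1.
have dth' : dfun th'.
  rewrite /th'.
  have d0 : dfun (fun w : Rn R 3 => w) by exact: dfun_id.
  have d1 : dfun (fun w : Rn R 3 => w.1) := dfun_fst d0.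
  have d2 : dfun (fun w : Rn R 3 => w.2) := dfun_snd d0.
  have d21 : dfun (fun w : Rn R 3 => w.2.1) := dfun_fst d2.
  have d221 : dfun (fun w : Rn R 3 => w.2.2.1) := dfun_fst (dfun_snd d2).
  exact: dfun_row3.
apply: (definable_injection_leq S_field S_ominimal (f := fun w => Psi (D' (th' w)))).
  by ddef.
move=> v w /(can_inj (PsiP : cancel Psi Phi))/(can_inj D'K) e.
have := congr1 (fun u : 'rV[R]_3 => (u 0 0, u 0 1, u 0 2)) e; rewrite /th' !rowE.
by case: v w {e} => [x [y [z []]]] [x' [y' [z' []]]] /= [-> -> ->].
Qed.

End Chains.

Lemma chain3_coordinates (R : realType) (S : structure R)
    (S_field : expands_real_field S) (S_ominimal : ominimal S) (dexp : dfun S (@expR R))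
    (S_splits : abelian_extensions_split S)
    (G : dgroup S) (H : nat -> G -> Prop) (r : nat -> G -> R) :
  dchain 3 H r -> exists2 op, listed_op op & coordinatized G op.
Proof.
case=> bot top sub nrm dr hom surj ker.
have dH1 := dsub_def (sub 1%N isT).
have [i di iP] := definable_section S_field S_ominimal dH1 (dr 0%N isT) (surj 0%N isT).
have Hi x : H 1%N (i x) by case: (iP x).
have ri x : r 0%N (i x) = x by case: (iP x).
have H0 := hom 0%N isT; have s1 := sub 1%N isT.
have r0I g h : H 1%N g -> H 1%N h -> r 0%N g = r 0%N h -> g = h.
  move=> Hg Hh e; have Hv := dsubV s1 Hh.
  have /bot gh : H 0%N (g ** gi h).
    apply/(ker 0%N isT); split; first exact: (dsubM s1).
    by rewrite H0 // (hom_onV s1 H0) // e subrr.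
  by rewrite -[g]gg1e -(giVg h) -gopA gh ge1g.
(* [i] was chosen only as a section of [r 0]; it is a homomorphism because [r 0] is injective on
   [H 1], its kernel there being trivial. *)
have iD : rhom i.
  by move=> x y; apply: r0I; rewrite ?H0 ?ri //; apply: (dsubM s1).
have H1E g : H 1%N g <-> exists x, g = i x.
  by split=> [Hg|[x ->] //]; exists (r 0%N g); apply: r0I; rewrite ?ri.
have ext2 : extension (H 2%N) i (r 1%N).
  split=> //; [exact: sub|exact: dr|by move=> x y e; rewrite -(ri x) e ri|exact: hom|exact: surj|].
  by move=> g; rewrite -H1E (ker 1%N).
have r3M g h : r 2%N (g ** h) = r 2%N g + r 2%N h by apply: hom => //; apply: top.
have r3S t : exists g, r 2%N g = t by have [g _ <-] := surj 2%N isT t; exists g.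
have r3K g : r 2%N g = 0 <-> H 2%N g.
  by rewrite (ker 2%N) //; split=> [|[]//]; split=> //; apply: top.
have iN g x : exists y, g ** i x ** gi g = i y by apply/H1E; apply: nrm.
have [cG|[a [b [u [du cG]]]]] :=
  coordinates_of_chain S_field S_ominimal dexp S_splits ext2 (dr 2%N isT) r3M r3S r3K iN.
  by exists (@affine_op R); first by constructor.
exact: (classify S_field S_ominimal dexp du cG).
Qed.

Theorem mainTheorem5 (R : realType) (S : structure R)
    (S_field : expands_real_field S) (S_ominimal : ominimal S)
    (S_ominimal_groups : forall G H : group_data R,
       ominimal_group S G -> ominimal_group S H -> definably_isomorphic S G H)
    (S_splits : forall (G : group_data R)
       (i : 'rV[R]_(gdim (add_group R 1)) -> 'rV[R]_(gdim G))
       (p : 'rV[R]_(gdim G) -> 'rV[R]_(gdim (add_group R 1))),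
       abelian_group G ->
       definable_extension (N := add_group R 1) (Q := add_group R 1) S i p ->
       splits (Q := add_group R 1) S p) :
  (forall K : group_data R, listed_group K ->
     [/\ definable_group S K, supersolvable S K &
         definably_homeomorphic_to_Rn S K 3]) /\
  (forall G : group_data R, definable_group S G -> supersolvable S G ->
     definably_homeomorphic_to_Rn S G 3 ->
     exists2 K : group_data R, listed_group K & definably_isomorphic S G K).
Proof.
have dexp := dfun_expR S_field S_ominimal S_ominimal_groups.
split=> [K lK|G dG /(supersolvable_chain dG)[n [H [r ch]]]].
  exact: listed_group_properties.
move=> /(homeomorphic_bijection dG)[D dD bD].
have n3 := chain_length S_field S_ominimal ch dD bD; rewrite n3 in ch.
have [op lop cop] := chain3_coordinates S_field S_ominimal dexp S_splits ch.
exact: isomorphic_listed lop cop.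
Qed.
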